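(* Let $\beta,L,C,\Lambda,K,\Sigma,\Gamma>0$. Let $h=h_n=(\eta\log n)^{-1/2}$ with $0<\eta<\Sigma^{-2}$, let $M_n=m_nh_n^{-2}$ be positive numbers, where $(m_n)$ is a sequence of real numbers diverging to $+\infty$ at a slower rate than $\log n$ (i.e. $m_n=o(\log n)$), and let $\hat\rho_n$ be the estimator of $\rho$ (built from $X_1,\dots,X_n$, the bandwidth $h$, the truncation $M_n$, kernels $v,u,w$ and the sinc kernel $k$) defined in the context. Then there exist a constant $A>0$ and an integer $n_0$ such that for all $n\ge n_0$ $$\sup_{|\gamma|\le\Gamma}\ \sup_{\sigma\in(0,\Sigma]}\ \sup_{\rho\in W^*_{sym}(\beta,L,C,\Lambda,K)}\operatorname{MISE}[\hat\rho_n]\le A(\log n)^{-\beta},\qquad \operatorname{MISE}[\hat\rho_n]=\operatorname{E}\Bigl[\int_{-\infty}^{\infty}|\hat\rho_n(x)-\rho(x)|^2dx\Bigr].$$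
   Context: For $\gamma\in\mathbb{R}$, $\sigma\ge0$ and a Lévy density $\rho:\mathbb{R}\to[0,\infty)$ with $0<\lambda:=\int_{-\infty}^{\infty}\rho(x)\,dx<\infty$, let $X_1,\dots,X_n$ be i.i.d. copies of a random variable $X$ with characteristic function $$\phi_X(t)=\exp\Bigl[i\gamma t-\tfrac12\sigma^2t^2+\int_{\mathbb{R}}(e^{itx}-1)\rho(x)\,dx\Bigr].$$ Expectations are taken under the law determined by $(\gamma,\sigma^2,\rho)$. Write $f=\rho/\lambda$, $\phi_f(t)=\int e^{itx}f(x)\,dx$, $\phi_{emp}(t)=\frac1n\sum_{j=1}^n e^{itX_j}$. Classes: $$W(\beta,L,\Lambda,K)=\Bigl\{\rho:\ \rho=\lambda f,\ f\text{ a probability density},\ \int x^2f(x)\,dx\le K,\ \int|t|^\beta|\phi_f(t)|\,dt\le L,\ \lambda\in(0,\Lambda]\Bigr\};$$ $W_{sym}(\beta,L,\Lambda,K)$ is the set of symmetric (even) $\rho\in W(\beta,L,\Lambda,K)$; $W^*_{sym}(\beta,L,C,\Lambda,K)$ is the set of $\rho\in W_{sym}(\beta,L,\Lambda,K)$ with in addition $\int_{-\infty}^\infty|t|^{2\beta}|\phi_f(t)|^2dt\le C$. Kernels: $v,u,w:\mathbb{R}\to\mathbb{R}$ are continuous, supported on $[-1,1]$, each is $O(|t|^\beta)$ as $t\to0$, and $\int_{-1}^1v=0$, $\int_{-1}^1(-t^2/2)v(t)\,dt=1$; $\int_{-1}^1u=-1$, $\int_{-1}^1t^2u(t)\,dt=0$;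 $\int_{-1}^1t\,w(t)\,dt=1$. Put $v^h(t)=h^3v(ht)$, $u^h(t)=hu(ht)$, $w^h(t)=h^2w(ht)$. The kernel $k$ is the sinc kernel $k(x)=\sin x/(\pi x)$, with Fourier transform $\phi_k(t)=1_{[-1,1]}(t)$. Preliminary estimators: $$\tilde\sigma_n^2=\int_{-1/h}^{1/h}\max\{\min\{M_n,\log|\phi_{emp}(t)|\},-M_n\}v^h(t)\,dt,$$ $$\tilde\lambda_n=\int_{-1/h}^{1/h}\max\{\min\{M_n,\log|\phi_{emp}(t)|\},-M_n\}u^h(t)\,dt,$$ $$\tilde\gamma_n=\int_{-1/h}^{1/h}\max\{\min\{\Im(\operatorname{Log}(\phi_{emp}(t))),M_n\},-M_n\}w^h(t)\,dt.$$ (Convention $\log0=-\infty$.) $\operatorname{Log}$ is the distinguished logarithm: if $\phi_{emp}$ does not vanish on $[-h^{-1},h^{-1}]$, $\operatorname{Log}(\phi_{emp}(t))$ is the unique continuous function on $[-h^{-1},h^{-1}]$ with $\exp(\operatorname{Log}(\phi_{emp}(t)))=\phi_{emp}(t)$ and $\operatorname{Log}(\phi_{emp}(0))=0$; if $\phi_{emp}$ vanishes there, an arbitrary fixed value, e.g. zero, is assigned to it in the definition of $\tilde\gamma_n$. Estimator of $\rho$: $$\begin{aligned}\hat\rho_n(x)&=-i\tilde\gamma_n\frac1{2\pi}\int_{-1/h}^{1/h}e^{-itx}t\,dt+\tilde\lambda_n\frac1{2\pi}\int_{-1/h}^{1/h}e^{-itx}dt+\frac{\tilde\sigma_n^2}{2}\frac1{2\pi}\int_{-1/h}^{1/h}e^{-itx}t^2dt\\&\quad+\frac1{2\pi}\int_{-1/h}^{1/h}e^{-itx}\max\{\min\{M_n,\log(|\phi_{emp}(t)\phi_k(ht)|)\},-M_n\}dt\\&\quad+i\frac1{2\pi}\int_{-1/h}^{1/h}e^{-itx}\max\{\min\{M_n,\arg(\phi_{emp}(t)\phi_k(ht))\},-M_n\}dt,\end{aligned}$$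 where $\log|\cdot|$ and $\arg$ are the real and imaginary parts of the distinguished logarithm of $\phi_{emp}(t)\phi_k(ht)$ on $[-h^{-1},h^{-1}]$; for sample points where this is undefined, $\hat\rho_n(x)$ is set to zero. The constants $A,n_0$ do not depend on $n$ or on $(\gamma,\sigma,\rho)$ in the indicated classes (they may depend on the class parameters, $\eta$, $(m_n)$, $v,u,w$). *)

(* Defs.v *)
From HB Require Import structures.
From mathcomp Require Import all_boot all_order all_algebra.
From mathcomp Require Import all_classical all_reals all_analysis.
From mathcomp Require Import complex.

Set Implicit Arguments.
Unset Strict Implicit.
Unset Printing Implicit Defensive.

Import Order.TTheory GRing.Theory Num.Theory.
Import numFieldNormedType.Exports.
Import ComplexField.

Local Open Scope classical_set_scope.
Local Open Scope complex_scope.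
Local Open Scope ring_scope.

Section complex_valued_functions.
Context {R : realType}.

Definition expC (z : R[i]) : R[i] :=
  (expR (complex.Re z))%:C * (cos (complex.Im z) +i* sin (complex.Im z)).

Definition cintegral d (T : measurableType d) (mu : {measure set T -> \bar R})
    (D : set T) (f : T -> R[i]) : R[i] :=
  (\int[mu]_(x in D) complex.Re (f x))
  +i* (\int[mu]_(x in D) complex.Im (f x)).

(* The cast to numFieldType puts on R[i] the topology of the complex modulus. *)
Definition is_distinguished_log (a : R) (phi g : R -> R[i]) : Prop :=
  [/\ {within `[- a, a], continuous (g : R -> (R[i] : numFieldType))},
      forall t, t \in `[- a, a] -> expC (g t) = phi t
    & g 0 = 0].

Definition nonvanishing (a : R) (phi : R -> R[i]) : Prop :=
  forall t, t \in `[- a, a] -> phi t != 0.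

(* Only the values on [- a, a] are meaningful: there the distinguished
   logarithm is unique.  When there is none (phi vanishes), the value is 0. *)
Definition Log (a : R) (phi : R -> R[i]) : R -> R[i] :=
  xget (cst 0) [set g | is_distinguished_log a phi g].

End complex_valued_functions.

Section model.
Context {R : realType}.

Definition fourier (f : R -> R) (t : R) : R[i] :=
  cintegral lebesgue_measure setT (fun x => expC ('i * (t * x)%:C) * (f x)%:C).

Definition is_levy_density (rho : R -> R) : Prop :=
  [/\ measurable_fun setT rho,
      forall x, 0 <= rho x
    & (0 < \int[lebesgue_measure]_x (rho x)%:E < +oo)%E].

Definition intensity (rho : R -> R) : R := \int[lebesgue_measure]_x rho x.

Definition jump_density (rho : R -> R) : R -> R :=
  fun x => rho x / intensity rho.

Definition phiX (gamma sigma : R) (rho : R -> R) (t : R) : R[i] :=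
  expC ('i * (gamma * t)%:C - (2^-1 * sigma ^+ 2 * t ^+ 2)%:C
    + cintegral lebesgue_measure setT
        (fun x => (expC ('i * (t * x)%:C) - 1) * (rho x)%:C)).

Definition charfun d (T : measurableType d) (P : probability T R)
    (X : {RV P >-> R}) (t : R) : R[i] :=
  cintegral P setT (fun o => expC ('i * (t * X o)%:C)).

Definition mutually_independent d (T : measurableType d) (P : probability T R)
    n (X : 'I_n -> {RV P >-> R}) : Prop :=
  forall (J : {set 'I_n}) (B : 'I_n -> set R),
    (forall j, measurable (B j)) ->
    P (\bigcap_(j in [set` J]) (X j @^-1` B j))
      = (\prod_(j in J) P (X j @^-1` B j))%E.

Definition identically_distributed d (T : measurableType d)
    (P : probability T R) n (X : 'I_n -> {RV P >-> R}) : Prop :=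
  forall (j k : 'I_n) (B : set R), measurable B ->
    distribution P (X j) B = distribution P (X k) B.

Definition iid_with_charfun d (T : measurableType d) (P : probability T R)
    n (X : 'I_n -> {RV P >-> R}) (phi : R -> R[i]) : Prop :=
  [/\ mutually_independent X,
      identically_distributed X
    & forall j t, charfun (X j) t = phi t].

(* The sample X is fixed and the parameter (gamma, sigma, rho) selects the
   probability measure on the sample space. *)
Definition levy_sample d (T : measurableType d)
    (P : R -> R -> (R -> R) -> probability T R)
    n (X : 'I_n -> {mfun T >-> R}) : Prop :=
  forall gamma sigma rho, 0 <= sigma -> is_levy_density rho ->
    iid_with_charfun (P := P gamma sigma rho) X (phiX gamma sigma rho).

End model.

Section classes.
Context {R : realType}.

Definition is_probability_density (f : R -> R) : Prop :=
  [/\ measurable_fun setT f,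
      forall x, 0 <= f x
    & (\int[lebesgue_measure]_x (f x)%:E = 1)%E].

Definition W (beta L Lambda K : R) : set (R -> R) :=
  [set rho | exists lambda f,
    [/\ rho = (fun x => lambda * f x) /\ is_probability_density f,
        (\int[lebesgue_measure]_x (x ^+ 2 * f x)%:E <= K%:E)%E,
        (\int[lebesgue_measure]_t
           (`|t| `^ beta * Normc.normc (fourier f t))%:E <= L%:E)%E
      & 0 < lambda <= Lambda]].

Definition Wsym (beta L Lambda K : R) : set (R -> R) :=
  W beta L Lambda K `&` [set rho | forall x, rho (- x) = rho x].

Definition Wsym_star (beta L C Lambda K : R) : set (R -> R) :=
  Wsym beta L Lambda K `&`
  [set rho | (\int[lebesgue_measure]_t
    (`|t| `^ (2 * beta)
       * Normc.normc (fourier (jump_density rho) t) ^+ 2)%:E <= C%:E)%E].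

End classes.

Section kernels.
Context {R : realType}.
Implicit Types (beta : R) (v u w : R -> R).

Definition is_kernel beta v : Prop :=
  [/\ continuous v,
      forall t, 1 < `|t| -> v t = 0
    & v =O_0 (fun t : R => `|t| `^ beta)].

Definition is_kernel_v beta v : Prop :=
  [/\ is_kernel beta v,
      \int[lebesgue_measure]_(t in `[- 1, 1]) v t = 0
    & \int[lebesgue_measure]_(t in `[- 1, 1]) (- t ^+ 2 / 2 * v t) = 1].

Definition is_kernel_u beta u : Prop :=
  [/\ is_kernel beta u,
      \int[lebesgue_measure]_(t in `[- 1, 1]) u t = - 1
    & \int[lebesgue_measure]_(t in `[- 1, 1]) (t ^+ 2 * u t) = 0].

Definition is_kernel_w beta w : Prop :=
  is_kernel beta w /\
  \int[lebesgue_measure]_(t in `[- 1, 1]) (t * w t) = 1.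

(* The Fourier transform of the sinc kernel sin x / (pi x), which is not
   Lebesgue integrable. *)
Definition phi_k (t : R) : R := \1_(`[- 1, 1]) t.

End kernels.

Section estimators.
Context {R : realType}.
Variables (v u w : R -> R) (h M : R) (n : nat) (x : 'I_n -> R).

Definition phi_emp (t : R) : R[i] :=
  (n%:R^-1)%:C * \sum_(j < n) expC ('i * (t * x j)%:C).

(* Extended-real argument, because of the convention log 0 = -oo. *)
Definition trunc (y : \bar R) : R := fine (maxe (mine M%:E y) (- M)%:E).

(* lne 0 = -oo, whereas ln 0 = 0. *)
Definition log_abs_phi_emp (t : R) : \bar R :=
  lne (Normc.normc (phi_emp t))%:E.

Definition sigma2_tilde : R :=
  \int[lebesgue_measure]_(t in `[- h^-1, h^-1])
    (trunc (log_abs_phi_emp t) * (h ^+ 3 * v (h * t))).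

Definition lambda_tilde : R :=
  \int[lebesgue_measure]_(t in `[- h^-1, h^-1])
    (trunc (log_abs_phi_emp t) * (h * u (h * t))).

Definition gamma_tilde : R :=
  \int[lebesgue_measure]_(t in `[- h^-1, h^-1])
    (trunc (complex.Im (Log h^-1 phi_emp t))%:E * (h ^+ 2 * w (h * t))).

Definition phi_emp_k (t : R) : R[i] := phi_emp t * (phi_k (h * t))%:C.

(* (2 pi)^-1 times the integral over [- 1/h, 1/h] of exp (- i t y) g(t). *)
Definition inv_fourier (g : R -> R) (y : R) : R[i] :=
  ((2 * pi)^-1)%:C *
  cintegral lebesgue_measure `[- h^-1, h^-1]
    (fun t => expC (- 'i * (t * y)%:C) * (g t)%:C).

Definition rho_hat (y : R) : R[i] :=
  if `[< nonvanishing h^-1 phi_emp_k >] then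
    - 'i * gamma_tilde%:C * inv_fourier id y
    + lambda_tilde%:C * inv_fourier (cst 1) y
    + (sigma2_tilde / 2)%:C * inv_fourier (fun t => t ^+ 2) y
    + inv_fourier (fun t => trunc (complex.Re (Log h^-1 phi_emp_k t))%:E) y
    + 'i * inv_fourier (fun t => trunc (complex.Im (Log h^-1 phi_emp_k t))%:E) y
  else 0.

End estimators.

Section risk.
Context {R : realType}.

Definition MISE (v u w : R -> R) (h M : R) d (T : measurableType d)
    (P : probability T R) n (X : 'I_n -> {mfun T >-> R}) (rho : R -> R) :
    \bar R :=
  (\int[P]_o \int[lebesgue_measure]_y
     ((Normc.normc (rho_hat v u w h M (fun j => X j o) y - (rho y)%:C))
        ^+ 2)%:E)%E.

Definition bandwidth (eta : R) (n : nat) : R := (eta * ln n%:R) `^ (- 2^-1).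

Definition truncation (eta : R) (m : nat -> R) (n : nat) : R :=
  m n * bandwidth eta n ^- 2.

End risk.

(* Main.v *)
(** Write T = 1/h.  A symmetric rho = lambda f makes phi_f real, and
    log phi_X(t) = i gamma t - sigma^2 t^2 / 2 - lambda + lambda phi_f(t).
    The moment conditions on v, u, w extract sigma^2, lambda, gamma from this logarithm up to
    the contribution of phi_f, which is O(h^beta) (times a power of h) because the kernels are
    O(|t|^beta) at 0 and |t|^beta |phi_f(t)| is integrable.  So if phi_emp is uniformly close to
    phi_X on [-T, T], relatively to |phi_X|, its distinguished logarithm is close to that of
    phi_X, the truncations are inactive, and the Fourier transform of rho_hat differs from
    lambda phi_f by O(h^(1 + beta)) on [-T, T].  Plancherel's inequality then bounds the
    integrated squared error by O(T h^(2 + 2 beta)) plus the tail of |phi_f|^2 beyond T, which is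
    O(T^(-2 beta)).

    Closeness fails with small probability: the deviation phi_emp - phi_X vanishes at 0 and its
    derivative has L^2([0, T]) norm of mean square O(T / n), so Cauchy-Schwarz controls the
    supremum and Markov's inequality its tail.  On the bad event the truncations still give a
    bound polynomial in T.  Since n = exp(T^2 / eta), while |phi_X|^(-2) is at most a constant
    times exp(Sigma^2 T^2), the condition eta < Sigma^(-2) makes that contribution negligible.

    Plancherel's inequality and the inversion formula (needed to identify f almost everywhere
    with the inverse transform of phi_f) are obtained by Abel summation with the weight
    exp(-e |t|), whose transform is the Poisson kernel. *)

Require Import Defs.
From HB Require Import structures.
From mathcomp Require Import all_boot all_order all_algebra.
From mathcomp Require Import all_classical all_reals all_analysis.
From mathcomp Require Import complex.
From mathcomp Require Import measurable_realfun.
From mathcomp Require Import ring lra.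

Set Implicit Arguments.
Unset Strict Implicit.
Unset Printing Implicit Defensive.

Import Order.TTheory GRing.Theory Num.Theory.
Import numFieldNormedType.Exports.

Local Open Scope classical_set_scope.
Local Open Scope ring_scope.

(** * Integration and the Poisson kernel *)

(** The loss depends on the sample through a distinguished logarithm picked by [xget], whose
    measurability in the sample is unclear. It is therefore never evaluated as an integral: it is
    dominated pointwise by an affine function of [deviation_energy], which is measurable by
    Tonelli's theorem, and monotonicity of the integral of nonnegative functions does the rest. The
    sequence [m] enters twice. Its divergence puts the truncation level above the size of the
    logarithm of phi_X, uniformly over the parameters, with room for the perturbation; [m = o(ln n)]
    keeps the level below [T^4 / eta], hence polynomial in T. The law of the sample is known only
    through its characteristic function, so second moments are recovered from [1 - cos] near 0, and
    independence is used pairwise. The accuracy h^(1 + beta) asked of the logarithm is the order of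
    the bias of [lambda_tilde]. The estimates of sigma^2 and gamma meet it after multiplication by
    t^2 and t on the window, since their kernels carry two and one more powers of h. One power of h
    is then to spare: T h^(2 + 2 beta) = h^(1 + 2 beta). *)

Section integration.
Context d (T : measurableType d) (R : realType).
Variable mu : {measure set T -> \bar R}.

(* Monotone without measurability, since the integral of a nonnegative function is a supremum
   over simple functions below it: this avoids proving that the distinguished logarithm is
   measurable in the sample. *)
Lemma le_integral_nonmeasurable (D : set T) (f g : T -> \bar R) :
  (forall x, D x -> (0 <= f x)%E) -> (forall x, D x -> (f x <= g x)%E) ->
  (\int[mu]_(x in D) f x <= \int[mu]_(x in D) g x)%E.
Proof.
move=> f0 fg; rewrite (integral_mkcond D f) (integral_mkcond D g).
have h0 : forall x, (0 <= (f \_ D) x)%E by move=> x; exact: erestrict_ge0.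
have hg : forall x, ((f \_ D) x <= (g \_ D) x)%E.
  by move=> x; rewrite !patchE; case: ifPn => // /set_mem; exact: fg.
rewrite ge0_integralTE// [leRHS]ge0_integralTE; last first.
  by move=> x; exact: le_trans (h0 x) (hg x).
apply: ge_ereal_sup => _ [h /= hf <-]; apply: ereal_sup_ubound; exists h => //= x.
exact: le_trans (hf x) (hg x).
Qed.

(** The positive and negative parts of [f] both lie between 0 and [c], so by monotonicity alone
    their integrals lie between 0 and [c * mu D]. This too avoids measurability, here of the
    truncated logarithm. *)
Lemma Rintegral_le_bound (D : set T) (f : T -> R) (c : R) : measurable D ->
  (mu D < +oo)%E -> 0 <= c -> (forall x, D x -> `|f x| <= c) ->
  `|\int[mu]_(x in D) f x| <= c * fine (mu D).
Proof.
move=> mD Doo c0 fc; rewrite /Rintegral integralE.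
have muD : (c%:E * mu D)%E \is a fin_num.
  by rewrite fin_numM// ge0_fin_numE.
have b (g : T -> \bar R) : (forall x, 0 <= g x)%E ->
    (forall x, D x -> (g x <= c%:E)%E) ->
    exists2 r, (0 <= r <= c * fine (mu D)) & (\int[mu]_(x in D) g x)%E = r%:E.
  move=> g0 gc.
  have i0 : (0 <= \int[mu]_(x in D) g x)%E by exact: integral_ge0.
  have ic : (\int[mu]_(x in D) g x <= c%:E * mu D)%E.
    rewrite -integral_cst//; exact: le_integral_nonmeasurable.
  have fn : (\int[mu]_(x in D) g x)%E \is a fin_num.
    by rewrite ge0_fin_numE// (le_lt_trans ic)// -ge0_fin_numE// mule_ge0.
  exists (fine (\int[mu]_(x in D) g x)%E); last by rewrite fineK.
  rewrite fine_ge0//= -lee_fin fineK// EFinM fineK// ge0_fin_numE//.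
have [||r /andP[r0 rc] ->] := b (fun x => (EFin \o f)^\+ x)%E.
- by move=> x; rewrite funeposE le_max lexx orbT.
- move=> x Dx; rewrite funeposE/= ge_max !lee_fin c0 andbT.
  exact: le_trans (ler_norm _) (fc _ Dx).
have [||s /andP[s0 sc] ->] := b (fun x => (EFin \o f)^\- x)%E.
- by move=> x; rewrite funenegE le_max lexx orbT.
- move=> x Dx; rewrite funenegE/= ge_max !lee_fin c0 andbT.
  by rewrite (le_trans _ (fc _ Dx))// -normrN ler_norm.
by rewrite /= ler_norml; apply/andP; split; lra.
Qed.

Lemma integrable_boundedM (D : set T) (f k : T -> R) (c : R) : measurable D ->
  mu.-integrable D (EFin \o f) -> measurable_fun D k ->
  (forall x, D x -> `|k x| <= c) ->
  mu.-integrable D (EFin \o (fun x => k x * f x)).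
Proof.
move=> mD fi mk k1.
apply: (@le_integrable _ _ _ _ _ mD _ (fun x => (c * f x)%:E)) => /=.
- apply/measurable_EFinP; apply: measurable_funM => //.
  by apply/measurable_EFinP; exact: (measurable_int mu).
- move=> x Dx; rewrite lee_fin !normrM ler_wpM2r//.
  exact: le_trans (k1 _ Dx) (ler_norm _).
- have := integrableZl mD c fi; apply: eq_integrable => // x _.
Qed.

(** Monotone convergence along an exhaustion; it serves for compact intervals filling the line and
    for the events [|X| <= n] filling the sample space. *)
Lemma ge0_integral_le_cover (F : (set T)^nat) (f : T -> \bar R) (c : \bar R) :
  {homo F : n m / (n <= m)%N >-> n `<=` m} -> (forall n, measurable (F n)) ->
  (forall x, exists n, F n x) -> measurable_fun setT f ->
  (forall x, (0 <= f x)%E) -> (forall n, (\int[mu]_(x in F n) f x <= c)%E) ->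
  (\int[mu]_x f x <= c)%E.
Proof.
move=> ndF mF cF mf f0 fc.
have ndF' : {homo F : n m / (n <= m)%N >-> (n <= m)%O}.
  by move=> n m nm; apply/subsetPset; exact: ndF.
have cvgF := ge0_nondecreasing_set_cvg_integral (mu := mu) ndF' mF
  (fun n => measurable_funTS mf) (fun n x _ => f0 x).
have UF : \bigcup_n F n = setT.
  by rewrite -subTset => x _; have [n ?] := cF x; exists n.
rewrite UF in cvgF; rewrite -(cvg_lim _ cvgF)//; apply: lime_le.
  by apply/cvg_ex; eexists; exact: cvgF.
exact: nearW.
Qed.

End integration.

(** * Fubini's theorem for a bounded kernel between two integrable weights *)

Section fubini_kernel.
Context d1 d2 (T1 : measurableType d1) (T2 : measurableType d2) (R : realType).
Variables (m1 : {sigma_finite_measure set T1 -> \bar R})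
  (m2 : {sigma_finite_measure set T2 -> \bar R}).
Variables (a : T1 -> R) (q : T2 -> R) (k : T1 * T2 -> R) (c : R).
Hypothesis ia : m1.-integrable setT (EFin \o a).
Hypothesis iq : m2.-integrable setT (EFin \o q).
Hypothesis mk : measurable_fun setT k.
Hypothesis kc : forall z, `|k z| <= c.

Let ma : measurable_fun setT a.
Proof. by apply/measurable_EFinP; exact: (measurable_int m1). Qed.

Let mq : measurable_fun setT q.
Proof. by apply/measurable_EFinP; exact: (measurable_int m2). Qed.

Lemma integrable_bounded_mulr y :
  m2.-integrable setT (EFin \o (fun s => k (y, s) * q s)).
Proof.
apply: (@le_integrable _ _ _ _ _ measurableT _ (fun s => (c * q s)%:E)) => /=.
- apply/measurable_EFinP; apply: measurable_funM => //.
  exact: (measurableT_comp mk (measurable_pair1 _)).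
- move=> s _; rewrite lee_fin !normrM ler_wpM2r//.
  exact: le_trans (kc _) (ler_norm _).
- rewrite (_ : (fun s => (c * q s)%:E) = (fun s => c%:E * (EFin \o q) s)%E)//.
  exact: integrableZl.
Qed.

Lemma integrable_bounded_mull s :
  m1.-integrable setT (EFin \o (fun y => k (y, s) * a y)).
Proof.
apply: (@le_integrable _ _ _ _ _ measurableT _ (fun s => (c * a s)%:E)) => /=.
- apply/measurable_EFinP; apply: measurable_funM => //.
  exact: (measurableT_comp mk (measurable_pair2 _)).
- move=> y _; rewrite lee_fin !normrM ler_wpM2r//.
  exact: le_trans (kc _) (ler_norm _).
- rewrite (_ : (fun s => (c * a s)%:E) = (fun s => c%:E * (EFin \o a) s)%E)//.
  exact: integrableZl.
Qed.

(** Tonelli's theorem applied to the dominating product [|c| |a| |q|]. *)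
Lemma integrable_kernel :
  (m1 \x m2)%E.-integrable setT (fun z => (k z * (a z.1 * q z.2))%:E).
Proof.
have mF : measurable_fun setT (fun z : T1 * T2 => (k z * (a z.1 * q z.2))%:E).
  apply/measurable_EFinP; apply: measurable_funM => //.
  by apply: measurable_funM; exact: measurableT_comp.
apply/integrable12ltyP => //.
pose Q := fine (\int[m2]_s `|q s|%:E)%E.
have QE : (\int[m2]_s `|q s|%:E)%E = Q%:E.
  rewrite fineK// ge0_fin_numE//; last by apply: integral_ge0 => s _.
  by case/integrableP: iq.
apply: (@le_lt_trans _ _ (\int[m1]_x ((`|c| * Q)%:E * `|(a x)%:E|))%E).
  apply: le_integral_nonmeasurable => [x _|x _]; first exact: integral_ge0.
  rewrite [leRHS](_ : _ = (`|c| * `|a x|)%:E * \int[m2]_s `|q s|%:E)%E; last first.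
    by rewrite QE -!EFinM; congr EFin; ring.
  rewrite -ge0_integralZl_EFin//; last first.
    by apply/measurable_EFinP; exact: measurableT_comp.
  apply: le_integral_nonmeasurable => // s _.
  rewrite lee_fin !normrM mulrA ler_wpM2r// ler_wpM2r//.
  exact: le_trans (kc _) (ler_norm _).
have Q0 : 0 <= `|c| * Q.
  by rewrite mulr_ge0// fine_ge0//; apply: integral_ge0.
rewrite ge0_integralZl_EFin//; last first.
  by apply/measurable_EFinP; exact: measurableT_comp.
by rewrite lte_mul_pinfty//; case/integrableP: ia.
Qed.

Let intq y : (\int[m2]_s (k (y, s) * (a y * q s))%:E)%E =
  (a y * \int[m2]_s (k (y, s) * q s))%:E.
Proof.
under eq_integral do rewrite mulrCA.
rewrite -RintegralZl//; last exact: integrable_bounded_mulr.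
rewrite fineK//; apply: integrable_fin_num => //.
have := integrableZl measurableT (a y) (integrable_bounded_mulr y).
by apply: eq_integrable.
Qed.

Let inta s : (\int[m1]_y (k (y, s) * (a y * q s))%:E)%E =
  (q s * \int[m1]_y (k (y, s) * a y))%:E.
Proof.
under eq_integral do rewrite mulrA mulrC.
rewrite -RintegralZl//; last exact: integrable_bounded_mull.
rewrite fineK//; apply: integrable_fin_num => //.
have := integrableZl measurableT (q s) (integrable_bounded_mull s).
by apply: eq_integrable.
Qed.

Lemma Rintegral_kernelC :
  \int[m1]_y (a y * \int[m2]_s (k (y, s) * q s)) =
  \int[m2]_s (q s * \int[m1]_y (k (y, s) * a y)).
Proof.
have := Fubini integrable_kernel => /=.
under eq_integral do rewrite intq.
by under [in RHS]eq_integral do rewrite inta; rewrite /Rintegral => ->.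
Qed.

Lemma integrable_kernell :
  m1.-integrable setT (EFin \o (fun y => a y * \int[m2]_s (k (y, s) * q s))).
Proof.
have := integrable_fubini_F integrable_kernel.
by apply: eq_integrable => // y _; rewrite /fubini_F/= intq.
Qed.

End fubini_kernel.

Lemma integrable_kernelr d1 d2 (T1 : measurableType d1)
    (T2 : measurableType d2) (R : realType)
    (m1 : {sigma_finite_measure set T1 -> \bar R})
    (m2 : {sigma_finite_measure set T2 -> \bar R})
    (a : T1 -> R) (q : T2 -> R) (k : T1 * T2 -> R) (c : R) :
  m1.-integrable setT (EFin \o a) -> m2.-integrable setT (EFin \o q) ->
  measurable_fun setT k -> (forall z, `|k z| <= c) ->
  m2.-integrable setT (EFin \o (fun s => q s * \int[m1]_y (k (y, s) * a y))).
Proof.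
move=> ia iq mk kc.
apply: (@integrable_kernell _ _ _ _ _ m2 m1 q a (k \o (fun z => (z.2, z.1))) c) => // [|z].
  by apply: measurableT_comp => //; exact: measurable_fun_pair.
exact: kc.
Qed.

Section calculus.
Context {R : realType}.
Local Notation mu := (@lebesgue_measure R).
Implicit Types (f g F : R -> R) (x a b c : R).

Lemma is_derive_fun f a x b : is_derive x 1 f a -> a = b -> is_derive x 1 f b.
Proof. by move=> ? <-. Qed.

Lemma is_derive_addf f g x a b : is_derive x 1 f a -> is_derive x 1 g b ->
  is_derive x 1 (fun y => f y + g y) (a + b).
Proof. exact: is_deriveD. Qed.

Lemma is_derive_mulf f g x a b : is_derive x 1 f a -> is_derive x 1 g b ->
  is_derive x 1 (fun y => f y * g y) (a * g x + f x * b).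
Proof.
move=> fa gb; apply: (is_derive_fun (is_deriveM fa gb)).
by rewrite addrC; congr (_ + _); exact: mulrC.
Qed.

Lemma is_derive_scalef f c x a : is_derive x 1 f a ->
  is_derive x 1 (fun y => c * f y) (c * a).
Proof.
move=> fa; apply: (is_derive_fun (is_derive_mulf (is_derive_cst c x 1) fa)).
by rewrite mul0r add0r.
Qed.

Lemma is_derive_scale c x : is_derive x 1 (fun y => c * y) c.
Proof.
apply: (is_derive_fun (is_derive_scalef c (is_derive_id x 1))).
by rewrite mulr1.
Qed.

Lemma is_derive_compf f g x a b : is_derive (g x) 1 f a -> is_derive x 1 g b ->
  is_derive x 1 (fun y => f (g y)) (a * b).
Proof. exact: is_derive1_comp. Qed.

Lemma is_derive_continuous f x a : is_derive x 1 f a -> {for x, continuous f}.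
Proof.
by move=> fa; apply/differentiable_continuous/derivable1_diffP; case: fa.
Qed.

Lemma Rintegral_itv_FTC f F a b : a <= b -> continuous f ->
  (forall x, is_derive x 1 F (f x)) ->
  \int[mu]_(x in `[a, b]) f x = F b - F a.
Proof.
rewrite le_eqVlt => /predU1P[->|ab] cf Ff.
  by rewrite set_itv1 Rintegral_set1 subrr.
rewrite /Rintegral (@continuous_FTC2 _ _ F)//.
- exact: continuous_subspaceT.
- split.
  + by move=> x _; case: (Ff x).
  + by apply: cvg_at_right_filter; exact: (is_derive_continuous (Ff a)).
  + by apply: cvg_at_left_filter; exact: (is_derive_continuous (Ff b)).
- by move=> x _; rewrite derive1E; case: (Ff x).
Qed.

(** [F] has to be a primitive at nonnegative points only, so a smooth [F] serves for functions of
    [|x|] that have a kink at 0. *)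
Lemma ge0_integral_even_FTC f F (l : R) : (forall x, 0 <= f x) ->
  continuous f -> (forall x, f (- x) = f x) ->
  (forall x, 0 <= x -> is_derive x 1 F (f x)) -> F x @[x --> +oo] --> l ->
  (\int[mu]_x (f x)%:E = (2 * (l - F 0))%:E)%E.
Proof.
move=> f0 cf ef Ff Fl; rewrite ge0_symfun_integralT//; last first.
  by move=> x; rewrite /= ef.
rewrite -set_itvcy (@ge0_continuous_FTC2y _ _ F 0 l)//.
- exact: continuous_subspaceT.
- by move=> x x0; case: (Ff x (ltW x0)).
- apply: cvg_at_right_filter.
  exact: (is_derive_continuous (Ff 0 (lexx _))).
- move=> x; rewrite in_itv/= andbT => /ltW x0.
  by rewrite derive1E; case: (Ff x x0).
Qed.

Lemma ge0_integral_le_itv (f : R -> \bar R) (c : \bar R) :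
  measurable_fun setT f -> (forall x, 0 <= f x)%E ->
  (forall n : nat, \int[mu]_(x in `[(- n%:R)%R, n%:R%R]) f x <= c)%E ->
  (\int[mu]_x f x <= c)%E.
Proof.
move=> mf f0 fc.
apply: (ge0_integral_le_cover (mu := mu)
  (F := fun n : nat => `[- n%:R, n%:R]%classic : set R) (f := f)) => //.
- move=> n m nm x /=; rewrite !in_itv/= -!ler_norml => /le_trans; apply.
  by rewrite ler_nat.
- move=> x; exists (Num.Def.truncn `|x|).+1; rewrite /= in_itv/= -ler_norml.
  exact: ltW (truncnS_gt _).
Qed.

End calculus.

Section poisson_kernel.
Context {R : realType}.
Local Notation mu := (@lebesgue_measure R).

(** Unnormalised: [2 * pi] times the Cauchy density of scale [e]. *)
Definition poisson (e t : R) : R := 2 * e / (e ^+ 2 + t ^+ 2).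

Lemma poisson_ge0 (e t : R) : 0 < e -> 0 <= poisson e t.
Proof.
by move=> e0; rewrite /poisson divr_ge0 ?mulr_ge0 ?addr_ge0 ?sqr_ge0// ltW.
Qed.

Lemma poissonN (e t : R) : poisson e (- t) = poisson e t.
Proof. by rewrite /poisson sqrrN. Qed.

Lemma continuous_expR_abs (e : R) : continuous (fun y : R => expR (- (e * `|y|))).
Proof.
move=> y; apply: (@continuous_comp _ _ _ (fun y : R => - (e * `|y|)) expR).
  apply: continuousN; apply: (@continuous_comp _ _ _ (fun y : R => `|y|) ( *%R e)).
    exact: norm_continuous.
  exact: mulrl_continuous.
exact: continuous_expR.
Qed.

Lemma measurable_expR_abs (e : R) :
  measurable_fun setT (fun y : R => expR (- (e * `|y|))).
Proof. by apply: continuous_measurable_fun; exact: continuous_expR_abs. Qed.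

(** A primitive of [expR (- e * y) * (1 + cos (t * y))]. Adding 1 to the cosine keeps the integrand
    nonnegative, as [ge0_integral_even_FTC] requires; the added part is subtracted afterwards. *)
Let primitive (e t y : R) : R :=
  expR ((- e) * y) * (- e^-1 + (e ^+ 2 + t ^+ 2)^-1 * (t * sin (t * y) + (- e) * cos (t * y))).

Let is_derive_primitive (e t y : R) : 0 < e ->
  is_derive y 1 (primitive e t) (expR ((- e) * y) * (1 + cos (t * y))).
Proof.
move=> e0.
have dex : is_derive y 1 (fun y => expR ((- e) * y)) (expR ((- e) * y) * (- e)).
  exact: (is_derive_compf (is_derive_expR _) (is_derive_scale _ _)).
have ds : is_derive y 1 (fun y => sin (t * y)) (cos (t * y) * t).
  exact: (is_derive_compf (is_derive_sin _) (is_derive_scale _ _)).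
have dc : is_derive y 1 (fun y => cos (t * y)) ((- sin (t * y)) * t).
  exact: (is_derive_compf (is_derive_cos _) (is_derive_scale _ _)).
have dd := is_derive_addf (is_derive_cst (- e^-1) y 1)
  (is_derive_scalef (e ^+ 2 + t ^+ 2)^-1
  (is_derive_addf (is_derive_scalef t ds) (is_derive_scalef (- e) dc))).
apply: (is_derive_fun (is_derive_mulf dex dd)) => /=; rewrite /cst/=.
have ne : e ^+ 2 + t ^+ 2 != 0 by rewrite gt_eqF// ltr_pwDl ?sqr_ge0 ?exprn_gt0.
by field; rewrite ne gt_eqF.
Qed.

Let cvg_primitive (e t : R) : 0 < e -> primitive e t y @[y --> +oo] --> (0 : R).
Proof.
move=> e0.
pose B := e^-1 + (e ^+ 2 + t ^+ 2)^-1 * (`|t| + e).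
have ex0 : (fun y => expR (- (e * y))) @ +oo --> (0 : R).
  have := @cvgr_expR R; apply: cvg_comp.
  apply/cvgryPge => A; near=> y.
  by rewrite -ler_pdivrMl//; near: y; exact: nbhs_pinfty_ge.
have ex1 : (fun y => B * expR (- (e * y))) @ +oo --> (0 : R).
  by rewrite -(mulr0 B); apply: cvgM => //; exact: cvg_cst.
apply/cvgr0Pnorm_le => /= d d0.
move/cvgr0Pnorm_le: ex1 => /(_ _ d0); apply: filterS => y.
apply: le_trans; rewrite /primitive mulNr normrM mulrC [leRHS]normrM ler_wpM2r//.
have p0 : 0 <= (e ^+ 2 + t ^+ 2)^-1 by rewrite invr_ge0 addr_ge0 ?sqr_ge0.
have e0' : 0 <= e^-1 by rewrite invr_ge0 ltW.
have B0 : 0 <= B by rewrite addr_ge0// mulr_ge0// addr_ge0// ltW.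
rewrite (ger0_norm B0); apply: le_trans (ler_normD _ _) _.
rewrite normrN ger0_norm// lerD2l normrM ger0_norm// ler_wpM2l//.
apply: le_trans (ler_normD _ _) _; rewrite !normrM normrN (gtr0_norm e0).
by rewrite lerD// ler_piMr ?normr_ge0 ?(ltW e0)// ler_norml
  ?sin_geN1 ?sin_le1 ?cos_geN1 ?cos_le1.
Unshelve. all: by end_near. Qed.

Lemma integral_expR_cos1 (e t : R) : 0 < e ->
  (\int[mu]_y (expR (- (e * `|y|)) * (1 + cos (t * y)))%:E =
   (2 * e^-1 + poisson e t)%:E)%E.
Proof.
move=> e0.
have f0 (y : R) : 0 <= expR (- (e * `|y|)) * (1 + cos (t * y)).
  by rewrite mulr_ge0 ?expR_ge0// -lerBlDl sub0r cos_geN1.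
have cf : continuous (fun y : R => expR (- (e * `|y|)) * (1 + cos (t * y))).
  move=> y; apply: cvgM; first exact: continuous_expR_abs.
  apply: cvgD; first exact: cvg_cst.
  exact: (is_derive_continuous
    (is_derive_compf (is_derive_cos _) (is_derive_scale _ _))).
have ef (y : R) : expR (- (e * `|- y|)) * (1 + cos (t * - y)) =
    expR (- (e * `|y|)) * (1 + cos (t * y)) by rewrite normrN mulrN cosN.
have df (y : R) : 0 <= y ->
    is_derive y 1 (primitive e t) (expR (- (e * `|y|)) * (1 + cos (t * y))).
  by move=> y0; rewrite (ger0_norm y0) -mulNr; exact: is_derive_primitive.
rewrite (ge0_integral_even_FTC f0 cf ef df (cvg_primitive t e0)).
congr EFin; rewrite /primitive !mulr0 expR0 sin0 cos0 /poisson.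
have ne : e ^+ 2 + t ^+ 2 != 0.
  by rewrite gt_eqF// ltr_pwDl ?sqr_ge0 ?exprn_gt0.
by field; rewrite ne gt_eqF.
Qed.

(** The case [t = 0] of [integral_expR_cos1], where the integrand is twice the exponential. *)
Lemma integral_expR_abs (e : R) : 0 < e ->
  (\int[mu]_y (expR (- (e * `|y|)))%:E = (2 * e^-1)%:E)%E.
Proof.
move=> e0; have := integral_expR_cos1 0 e0.
under eq_integral do rewrite mul0r cos0 (mulrC (expR _)) (_ : 1 + 1 = 2)// EFinM.
have h1 (y : R) : setT y -> (0 <= (expR (- (e * `|y|)))%:E)%E.
  by rewrite lee_fin expR_ge0.
have h2 : measurable_fun setT (EFin \o (fun y : R => expR (- (e * `|y|)))).
  by apply/measurable_EFinP; exact: measurable_expR_abs.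
have /= -> := ge0_integralZl_EFin mu measurableT h1 h2 (ler0n R 2).
have -> : (2 * e^-1 + poisson e 0 = 2 * (2 * e^-1)).
  by rewrite /poisson; field; rewrite gt_eqF.
rewrite EFinM => h; rewrite -[LHS]mul1e -[1%E](_ : (2^-1 * 2)%:E = _); last first.
  by rewrite mulVf.
rewrite EFinM -muleA h -!EFinM; congr EFin.
by rewrite mulrA mulVf// mul1r.
Qed.

Lemma integrable_expR_abs (e : R) : 0 < e ->
  mu.-integrable setT (EFin \o (fun y : R => expR (- (e * `|y|)))).
Proof.
move=> e0; apply/integrableP; split.
  by apply/measurable_EFinP; exact: measurable_expR_abs.
under eq_integral do rewrite /= ger0_norm ?expR_ge0//.
by rewrite integral_expR_abs// ltry.
Qed.

Lemma measurable_cosM (t : R) : measurable_fun setT (fun y : R => cos (t * y)).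
Proof.
apply: continuous_measurable_fun => y.
exact: (is_derive_continuous (is_derive_compf (is_derive_cos _) (is_derive_scale _ _))).
Qed.

Lemma norm_cos_le1 (x : R) : `|cos x| <= 1.
Proof. by rewrite ler_norml cos_geN1 cos_le1. Qed.

Lemma norm_sin_le1 (x : R) : `|sin x| <= 1.
Proof. by rewrite ler_norml sin_geN1 sin_le1. Qed.

Lemma Rintegral_expR_cos (e t : R) : 0 < e ->
  \int[mu]_y (cos (t * y) * expR (- (e * `|y|))) = poisson e t.
Proof.
move=> e0; have := integral_expR_cos1 t e0.
have ie := integrable_expR_abs e0.
have ic : mu.-integrable setT
    (EFin \o (fun y : R => cos (t * y) * expR (- (e * `|y|)))).
  by apply: (integrable_boundedM _ ie (measurable_cosM t)) => // x _; exact: norm_cos_le1.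
move=> /(congr1 fine); under eq_integral do rewrite mulrDr mulr1 (mulrC (expR _)).
rewrite -/(Rintegral _ _ _) RintegralD//= /Rintegral integral_expR_abs//=.
by move/addrI.
Qed.

Lemma continuous_poisson (e x : R) : 0 < e -> continuous (fun y => poisson e (x - y)).
Proof.
move=> e0 y.
have ne : e ^+ 2 + (x - y) ^+ 2 != 0.
  by rewrite gt_eqF// ltr_pwDl ?sqr_ge0 ?exprn_gt0.
apply: cvgM; first exact: cvg_cst.
apply: cvgV => //; apply: cvgD; first exact: cvg_cst.
apply: (@continuous_comp _ _ _ (fun y => x - y) (fun u : R => u ^+ 2)).
  by apply: cvgB; [exact: cvg_cst|exact: cvg_id].
exact: exprn_continuous.
Qed.

Lemma Rintegral_poisson_itv (e x a b : R) : 0 < e -> a <= b ->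
  \int[mu]_(y in `[a, b]) poisson e (x - y) =
    2 * (atan (e^-1 * (b - x)) - atan (e^-1 * (a - x))).
Proof.
move=> e0 ab.
have df (y : R) : is_derive y 1 (fun y => 2 * atan (e^-1 * (y - x))) (poisson e (x - y)).
  have d1 : is_derive y 1 (fun y => y - x) (1 + 0).
    exact: (is_derive_addf (is_derive_id y 1) (is_derive_cst (- x) y 1)).
  apply: (is_derive_fun (is_derive_scalef 2
    (is_derive_compf (is_derive1_atan _) (is_derive_scalef e^-1 d1)))).
  have h : e ^+ 2 + (y - x) ^+ 2 != 0.
    by rewrite gt_eqF// ltr_pwDl ?sqr_ge0 ?exprn_gt0.
  have -> : poisson e (x - y) = poisson e (y - x) by rewrite -poissonN opprB.
  rewrite addr0 mulr1 /poisson exprMn exprVn.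
  have -> : 1 + e ^- 2 * (y - x) ^+ 2 = (e ^+ 2 + (y - x) ^+ 2) / e ^+ 2.
    by field; rewrite gt_eqF.
  by field; rewrite h gt_eqF.
by rewrite (Rintegral_itv_FTC ab (@continuous_poisson e x e0) df) -mulrBr.
Qed.

(** Over an interval the mass is twice a difference of two arctangents, hence at most [2 * pi]. This
    upper bound is all that Plancherel's inequality asks for. *)
Lemma integral_poisson_le (e x : R) : 0 < e ->
  (\int[mu]_y (poisson e (x - y))%:E <= (2 * pi)%:E)%E.
Proof.
move=> e0.
have cp := @continuous_poisson e x e0.
apply: ge0_integral_le_itv.
- by apply/measurable_EFinP; exact: continuous_measurable_fun.
- by move=> y; rewrite lee_fin poisson_ge0.
move=> n; have n0 : - n%:R <= n%:R :> R by rewrite ge0_cp.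
have ip : mu.-integrable `[- n%:R, n%:R] (EFin \o (fun y => poisson e (x - y))).
  apply: continuous_compact_integrable; first exact: segment_compact.
  exact: continuous_subspaceT.
rewrite -[leLHS]fineK; last exact: integrable_fin_num.
rewrite lee_fin -/(Rintegral _ _ _) Rintegral_poisson_itv// ler_pM2l//.
have := @atan_ltpi2 R (e^-1 * (n%:R - x)).
have := @atan_gtNpi2 R (e^-1 * (- n%:R - x)).
set p := pi; lra.
Qed.

End poisson_kernel.

(** * Trigonometric transforms on the line *)

Section trigonometric_transform.
Context {R : realType}.
Local Notation mu := (@lebesgue_measure R).
Implicit Types (c q a f : R -> R).

(** With [c] equal to [cos] or [sin] these are the real and imaginary parts of the Fourier transform
    of [q]. The wave [c] is a parameter so that each Fubini argument is made once for both. *)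
Definition trigT c q (y : R) : R := \int[mu]_t (c (y * t) * q t).

Definition bounded_wave c := continuous c /\ forall x, `|c x| <= 1.

Lemma wave_cos : bounded_wave cos.
Proof. by split; [exact: continuous_cos|exact: norm_cos_le1]. Qed.

Lemma wave_sin : bounded_wave sin.
Proof. by split; [exact: continuous_sin|exact: norm_sin_le1]. Qed.

Lemma wave_comp_continuous c (y : R) : bounded_wave c -> continuous (fun t => c (y * t)).
Proof.
move=> [cc _] t; apply: (@continuous_comp _ _ _ ( *%R y) c).
  exact: mulrl_continuous.
exact: cc.
Qed.

Lemma measurable_wave c (y : R) : bounded_wave c ->
  measurable_fun setT (fun t => c (y * t)).
Proof.
by move=> wc; apply: continuous_measurable_fun; exact: wave_comp_continuous.
Qed.

Lemma measurable_wave_prod c : bounded_wave c ->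
  measurable_fun setT (fun z : R * R => c (z.1 * z.2)).
Proof.
move=> [cc _]; apply: (measurableT_comp (continuous_measurable_fun cc)).
exact: measurable_funM.
Qed.

Lemma integrable_wave c q (y : R) : bounded_wave c ->
  mu.-integrable setT (EFin \o q) ->
  mu.-integrable setT (EFin \o (fun t => c (y * t) * q t)).
Proof.
move=> wc iq; apply: (integrable_boundedM (c := 1) _ iq (measurable_wave y wc)) => //.
by move=> x _; exact: wc.2.
Qed.

Lemma continuous_trigT c q : bounded_wave c -> mu.-integrable setT (EFin \o q) ->
  continuous (trigT c q).
Proof.
move=> wc iq y.
have cq (t : R) :
    {in (`]y - 1, y + 1[%classic : set R), continuous (fun x : R => c (x * t) * q t)}.
  move=> x _; apply: cvgM; last exact: cvg_cst.
  under eq_fun do rewrite mulrC.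
  by rewrite mulrC; exact: (wave_comp_continuous wc).
have ub (x : R) : `]y - 1, y + 1[%classic x ->
    {ae mu, forall t, setT t -> `|c (x * t) * q t| <= `|q t|}.
  move=> _; apply: aeW => t _; rewrite normrM ler_piMl//; exact: wc.2.
apply: (@continuity_under_integral R _ _ mu (fun y t => c (y * t) * q t) setT
  measurableT (y - 1) (y + 1) _ _ (fun t => `|q t|) _ ub).
- by move=> x _; exact: integrable_wave.
- by apply: aeW => t _; exact: cq.
- exact: (integrable_norm iq).
- by rewrite inE/= in_itv/=; apply/andP; split; lra.
Qed.

Lemma measurable_trigT c q : bounded_wave c -> mu.-integrable setT (EFin \o q) ->
  measurable_fun setT (trigT c q).
Proof. by move=> wc iq; apply: continuous_measurable_fun; exact: continuous_trigT. Qed.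

Lemma trigT_bound c q : bounded_wave c -> mu.-integrable setT (EFin \o q) ->
  forall y, `|trigT c q y| <= \int[mu]_t `|q t|.
Proof.
move=> wc iq y; have iw := integrable_wave y wc iq.
apply: le_trans (le_normr_Rintegral measurableT iw) _.
apply: le_Rintegral => //; [exact: (integrable_norm iw)|exact: (integrable_norm iq)|].
by move=> t _; rewrite normrM ler_piMl//; exact: wc.2.
Qed.

Lemma trigTC c a q : bounded_wave c -> mu.-integrable setT (EFin \o a) ->
  mu.-integrable setT (EFin \o q) ->
  \int[mu]_y (a y * trigT c q y) = \int[mu]_s (q s * trigT c a s).
Proof.
move=> wc ia iq.
rewrite /trigT (Rintegral_kernelC ia iq (measurable_wave_prod wc) (fun z => wc.2 _)).
apply: eq_Rintegral => s _; congr (_ * _); apply: eq_Rintegral => y _ /=.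
by congr (c _ * _); exact: mulrC.
Qed.

Lemma integrable_mul_trigT c a q : bounded_wave c -> mu.-integrable setT (EFin \o a) ->
  mu.-integrable setT (EFin \o q) ->
  mu.-integrable setT (EFin \o (fun y => a y * trigT c q y)).
Proof.
move=> wc ia iq.
exact: (integrable_kernell ia iq (measurable_wave_prod wc) (fun z => wc.2 _)).
Qed.

(* The double use of Fubini behind Plancherel's inequality. *)
Lemma weighted_trigT c q (e s : R) : bounded_wave c -> 0 < e ->
  mu.-integrable setT (EFin \o q) ->
  trigT c (fun y => expR (- (e * `|y|)) * trigT c q y) s =
  \int[mu]_t (q t * trigT c (fun y => c (s * y) * expR (- (e * `|y|))) t).
Proof.
move=> wc e0 iq; have ie := integrable_expR_abs e0.
rewrite -trigTC//; last exact: integrable_wave.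
by apply: eq_Rintegral => y _; rewrite mulrA.
Qed.

(** By the addition formula the two products of waves combine into [cos ((s - t) * y)]. *)
Lemma sum_trigT_poisson (e s t : R) : 0 < e ->
  trigT cos (fun y => cos (s * y) * expR (- (e * `|y|))) t +
  trigT sin (fun y => sin (s * y) * expR (- (e * `|y|))) t = poisson e (s - t).
Proof.
move=> e0; have ie := integrable_expR_abs e0.
have ic := integrable_wave t wave_cos (integrable_wave s wave_cos ie).
have is_ := integrable_wave t wave_sin (integrable_wave s wave_sin ie).
rewrite /trigT -RintegralD// -Rintegral_expR_cos//.
apply: eq_Rintegral => y _; rewrite mulrBl cosB; ring.
Qed.

(** The transform of an integrable function is bounded but need not be integrable; the exponential
    weight is what makes the exchange of integrals legitimate. *)
Lemma weighted_plancherel q (e : R) : 0 < e -> mu.-integrable setT (EFin \o q) ->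
  \int[mu]_y (expR (- (e * `|y|)) * (trigT cos q y ^+ 2 + trigT sin q y ^+ 2)) =
  \int[mu]_s (q s * \int[mu]_t (q t * poisson e (s - t))).
Proof.
move=> e0 iq; have ie := integrable_expR_abs e0.
pose wq c y := expR (- (e * `|y|)) * trigT c q y.
have iwq c : bounded_wave c -> mu.-integrable setT (EFin \o wq c).
  by move=> wc; exact: integrable_mul_trigT.
under eq_Rintegral do rewrite mulrDr !expr2 !mulrA.
rewrite (RintegralD _ (integrable_mul_trigT wave_cos (iwq _ wave_cos) iq)
  (integrable_mul_trigT wave_sin (iwq _ wave_sin) iq))//.
rewrite (trigTC wave_cos (iwq _ wave_cos) iq) (trigTC wave_sin (iwq _ wave_sin) iq).
have iK c : bounded_wave c -> forall s, mu.-integrable setT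
    (EFin \o (fun t => q t * trigT c (fun y => c (s * y) * expR (- (e * `|y|))) t)).
  by move=> wc s; apply: integrable_mul_trigT => //; exact: integrable_wave.
rewrite -(RintegralD _ (integrable_mul_trigT wave_cos iq (iwq _ wave_cos))
  (integrable_mul_trigT wave_sin iq (iwq _ wave_sin)))//.
apply: eq_Rintegral => s _; rewrite -mulrDr !weighted_trigT//; try exact: wave_cos; try exact: wave_sin.
rewrite -(RintegralD _ (iK _ wave_cos s) (iK _ wave_sin s))//; congr (_ * _).
by apply: eq_Rintegral => t _; rewrite -mulrDr sum_trigT_poisson.
Qed.

End trigonometric_transform.

Section plancherel.
Context {R : realType}.
Local Notation mu := (@lebesgue_measure R).
Implicit Types (q f : R -> R).

Lemma poisson_le (e t : R) : 0 < e -> `|poisson e t| <= 2 * e^-1.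
Proof.
move=> e0; rewrite ger0_norm ?poisson_ge0// /poisson.
have h : 0 < e ^+ 2 + t ^+ 2 by rewrite ltr_pwDl ?sqr_ge0 ?exprn_gt0.
rewrite ler_pdivrMr//.
have -> : 2 * e = 2 / e * e ^+ 2 by field; rewrite gt_eqF.
by rewrite ler_pM2l ?divr_gt0// lerDl sqr_ge0.
Qed.

Lemma measurable_poisson_prod (e : R) : 0 < e ->
  measurable_fun setT (fun z : R * R => poisson e (z.1 - z.2)).
Proof.
move=> e0.
have cp : continuous (poisson e).
  move=> x; have := @continuous_poisson R e 0 e0 (- x).
  rewrite /continuous_at sub0r opprK => h.
  have -> : poisson e = (fun y => poisson e (0 - y)) \o -%R.
    by apply/funext => y /=; rewrite sub0r opprK.
  apply: continuous_comp; first exact: oppr_continuous.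
  exact: (@continuous_poisson R e 0 e0).
apply: (measurableT_comp (continuous_measurable_fun cp)).
exact: measurable_funB.
Qed.

Lemma quadratic_poisson_ge0 (e x t : R) : 0 < e ->
  (0 <= (x ^+ 2 / 2 * poisson e t)%:E)%E.
Proof.
move=> e0; rewrite lee_fin; apply: mulr_ge0; last exact: poisson_ge0.
by apply: divr_ge0 => //; exact: sqr_ge0.
Qed.

Lemma ge0_quadratic_poisson_le (e : R) q : 0 < e -> measurable_fun setT q ->
  (\int[mu]_s \int[mu]_t (q s ^+ 2 / 2 * poisson e (s - t))%:E <=
   pi%:E * \int[mu]_s (q s ^+ 2)%:E)%E.
Proof.
move=> e0 mq.
have mq2 : measurable_fun setT (fun s => (q s ^+ 2)%:E).
  by apply/measurable_EFinP; exact: measurable_funX.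
rewrite -ge0_integralZl//; last 2 first.
- by move=> s _; rewrite lee_fin sqr_ge0.
- by rewrite lee_fin pi_ge0.
apply: le_integral_nonmeasurable => s _.
  by apply: integral_ge0 => t _; exact: quadratic_poisson_ge0.
have q0 : 0 <= q s ^+ 2 / 2 by apply: divr_ge0 => //; exact: sqr_ge0.
under eq_integral do rewrite EFinM.
rewrite ge0_integralZl//; last 2 first.
- apply/measurable_EFinP; apply: continuous_measurable_fun.
  exact: continuous_poisson.
- by move=> t _; rewrite lee_fin poisson_ge0.
have -> : (pi%:E * (q s ^+ 2)%:E = (q s ^+ 2 / 2)%:E * (2 * pi)%:E)%E.
  by rewrite -!EFinM; congr EFin; field.
by rewrite lee_wpmul2l// integral_poisson_le.
Qed.

(** Schur's test: [|q s| |q t| <= q s ^ 2 / 2 + q t ^ 2 / 2], and the symmetric kernel has mass at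
    most [2 * pi] in either variable. The right-hand side may be infinite. *)
Lemma quadratic_poisson_le q (e : R) : 0 < e -> mu.-integrable setT (EFin \o q) ->
  ((\int[mu]_s (q s * \int[mu]_t (q t * poisson e (s - t))))%:E <=
   (2 * pi)%:E * \int[mu]_s (q s ^+ 2)%:E)%E.
Proof.
move=> e0 iq.
have mq : measurable_fun setT q by apply/measurable_EFinP; exact: (measurable_int mu).
have mp := measurable_poisson_prod e0.
have pb (z : R * R) : `|poisson e (z.1 - z.2)| <= 2 * e^-1 by exact: poisson_le.
under eq_Rintegral do under eq_Rintegral do rewrite mulrC.
pose A (z : R * R) := (q z.1 ^+ 2 / 2 * poisson e (z.1 - z.2))%:E.
pose B (z : R * R) := (q z.2 ^+ 2 / 2 * poisson e (z.1 - z.2))%:E.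
have A0 z : (0 <= A z)%E.
  exact: quadratic_poisson_ge0.
have B0 z : (0 <= B z)%E.
  exact: quadratic_poisson_ge0.
have mA : measurable_fun setT A.
  apply/measurable_EFinP; apply: measurable_funM => //.
  apply: measurable_funM => //; apply: measurable_funX.
  exact: measurableT_comp.
have mB : measurable_fun setT B.
  apply/measurable_EFinP; apply: measurable_funM => //.
  apply: measurable_funM => //; apply: measurable_funX.
  exact: measurableT_comp.
apply: (@le_trans _ _ (\int[mu]_s \int[mu]_t (A (s, t) + B (s, t)))%E).
  have ik := integrable_kernell iq iq mp pb.
  rewrite fineK; last exact: integrable_fin_num.
  apply: le_trans (lee_abs _) _.
  apply: le_trans (le_abse_integral _ _ _) _ => //; first exact: (measurable_int mu).
  apply: le_integral_nonmeasurable => // s _ /=.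
  have iw := integrable_bounded_mulr iq mp pb s.
  rewrite -RintegralZl//.
  have iw2 : mu.-integrable setT (EFin \o (fun t => q s * (poisson e (s - t) * q t))).
    by have := integrableZl measurableT (q s) iw; apply: eq_integrable.
  rewrite EFin_normr_Rintegral//.
  apply: le_trans (le_abse_integral _ _ _) _ => //; first exact: (measurable_int mu).
  apply: le_integral_nonmeasurable => // t _.
  rewrite lee_fin -mulrDl mulrCA normrM ger0_norm ?poisson_ge0// mulrC.
  rewrite ler_wpM2r ?poisson_ge0// normrM.
  have := sqr_ge0 (`|q s| - `|q t|).
  rewrite sqrrB !real_normK ?num_real// -mulr_natl; lra.
have -> : (\int[mu]_s \int[mu]_t (A (s, t) + B (s, t)) =
    \int[mu]_s \int[mu]_t A (s, t) + \int[mu]_s \int[mu]_t B (s, t))%E.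
  rewrite -ge0_integralD//; last 4 first.
  - by move=> s _; exact: integral_ge0.
  - exact: (measurable_fun_fubini_tonelli_F (m2 := mu) _ mA A0).
  - by move=> s _; exact: integral_ge0.
  - exact: (measurable_fun_fubini_tonelli_F (m2 := mu) _ mB B0).
  apply: eq_integral => s _; rewrite ge0_integralD//.
  - exact: (measurableT_comp mA (measurable_pair1 _)).
  - exact: (measurableT_comp mB (measurable_pair1 _)).
have -> : (\int[mu]_s \int[mu]_t B (s, t) = \int[mu]_s \int[mu]_t A (s, t))%E.
  apply: (eq_trans (fubini_tonelli (m1 := mu) (m2 := mu) _ mB B0)).
  apply: eq_integral => s _.
  by apply: eq_integral => t _; rewrite /A /B/= -opprB poissonN.
have -> : ((2 * pi)%:E * \int[mu]_s (q s ^+ 2)%:E =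
    pi%:E * \int[mu]_s (q s ^+ 2)%:E + pi%:E * \int[mu]_s (q s ^+ 2)%:E)%E.
  rewrite -ge0_muleDl ?lee_fin ?pi_ge0// -EFinD; congr (_%:E * _)%E; ring.
have hA := ge0_quadratic_poisson_le e0 mq.
by apply: leeD; exact: hA.
Qed.

Lemma cvg_expR_abs (y : R) :
  expR (- (n.+1%:R^-1 * `|y|)) @[n --> \oo] --> (1 : R).
Proof.
have h : (- (n.+1%:R^-1 * `|y|)) @[n --> \oo] --> - (0 * `|y|).
  by apply: cvgN; apply: cvgM; [exact: cvg_harmonic|exact: cvg_cst].
rewrite mul0r oppr0 in h; rewrite -[X in _ --> X]expR0.
exact: (cvg_comp _ _ h (@continuous_expR R 0)).
Qed.

(** Take [e = 1 / (n + 1)]. The weights increase to 1, so monotone convergence passes to the limit,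
    while the bound does not depend on [e]. *)
Lemma plancherel_le q : mu.-integrable setT (EFin \o q) ->
  (\int[mu]_y (trigT cos q y ^+ 2 + trigT sin q y ^+ 2)%:E <=
   (2 * pi)%:E * \int[mu]_s (q s ^+ 2)%:E)%E.
Proof.
move=> iq.
pose h y := trigT cos q y ^+ 2 + trigT sin q y ^+ 2.
have h0 y : 0 <= h y by rewrite addr_ge0 ?sqr_ge0.
have mh : measurable_fun setT h.
  by apply: measurable_funD; apply: measurable_funX; apply: measurable_trigT => //;
    [exact: wave_cos|exact: wave_sin].
pose g (n : nat) (y : R) := (expR (- (n.+1%:R^-1 * `|y|)) * h y)%:E.
have g0 n y : (0 <= g n y)%E by rewrite lee_fin mulr_ge0 ?expR_ge0.
have mg n : measurable_fun setT (g n).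
  apply/measurable_EFinP; apply: measurable_funM => //.
  exact: measurable_expR_abs.
have ndg y : {homo g ^~ y : n m / (n <= m)%N >-> (n <= m)%E}.
  move=> n m nm; rewrite lee_fin ler_wpM2r// ler_expR lerN2 ler_wpM2r//.
  by rewrite lef_pV2 ?posrE// ler_nat.
have gf y : limn (g ^~ y) = (h y)%:E.
  apply/cvg_lim => //; apply: cvg_EFin; first by near=> n.
  rewrite -[h y]mul1r; apply: cvgM; [exact: cvg_expR_abs|exact: cvg_cst].
have := @cvg_monotone_convergence _ _ _ mu setT measurableT g mg
  (fun n x _ => g0 n x) (fun x _ => @ndg x).
under [X in _ --> X -> _]eq_integral do rewrite gf.
move=> /cvg_lim <-//.
apply: lime_le.
  by apply: ereal_nondecreasing_is_cvgn => n m nm;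
    apply: le_integral_nonmeasurable => x _; [exact: g0|exact: ndg].
apply: nearW => n.
have n0 : 0 < n.+1%:R^-1 :> R by [].
have := quadratic_poisson_le n0 iq; rewrite -weighted_plancherel//.
rewrite fineK//.
apply: integrable_fin_num => //.
have ie := integrable_expR_abs n0.
have ic c : bounded_wave c -> mu.-integrable setT
    (EFin \o (fun y => expR (- (n.+1%:R^-1 * `|y|)) * trigT c q y * trigT c q y)).
  move=> wc; apply: (integrable_mul_trigT wc _ iq).
  exact: (integrable_mul_trigT wc ie iq).
have := integrableD measurableT (ic _ wave_cos) (ic _ wave_sin).
apply: eq_integrable => // y _ /=; rewrite -EFinD; congr EFin; rewrite /h; ring.
Unshelve. all: by end_near. Qed.

End plancherel.

(** * Inversion formula for integrable functions with vanishing sine transform *)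

Section fourier_inversion.
Context {R : realType}.
Local Notation mu := (@lebesgue_measure R).
Implicit Types (f q g : R -> R).

Lemma Rintegral_dominated_cvg (f_ : nat -> R -> R) f g :
  (forall n, measurable_fun setT (f_ n)) ->
  (forall x, f_ n x @[n --> \oo] --> f x) ->
  mu.-integrable setT (EFin \o g) -> (forall n x, `|f_ n x| <= g x) ->
  \int[mu]_x f_ n x @[n --> \oo] --> \int[mu]_x f x.
Proof.
move=> mf cf ig fg.
have mlf : measurable_fun setT f by apply: (measurable_fun_cvg mf) => x _; exact: cf.
have fin (h : R -> R) : measurable_fun setT h -> (forall x, `|h x| <= g x) ->
    (\int[mu]_x (h x)%:E)%E \is a fin_num.
  move=> mh hg; apply: integrable_fin_num => //.
  apply: (le_integrable measurableT _ _ ig); first exact/measurable_EFinP.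
  by move=> x _; rewrite lee_fin (le_trans (hg _))// ler_norm.
have flim x : `|f x| <= g x.
  have h : `|f_ n x| @[n --> \oo] --> `|f x| by apply: cvg_norm; exact: cf.
  rewrite -(cvg_lim (@Rhausdorff R) h); apply: limr_le.
    by apply/cvg_ex; exists `|f x|.
  exact: nearW.
apply: fine_cvg; rewrite fineK; last exact: fin.
apply: (@dominated_cvg _ _ _ mu setT measurableT (fun n x => (f_ n x)%:E)
  (fun x => (f x)%:E) (fun x => (g x)%:E)).
- by move=> n; apply/measurable_EFinP; exact: mf.
- by move=> x _; apply: cvg_EFin; [by apply: nearW|exact: cf].
- by [].
- exact: ig.
- by move=> n x _; rewrite lee_fin.
Qed.

Lemma cvg_atan_scale (z : R) :
  atan (n.+1%:R * z) @[n --> \oo] --> Num.sg z * (pi / 2).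
Proof.
have [->|z0] := eqVneq z 0.
  by under eq_fun do rewrite mulr0 atan0; rewrite sgr0 mul0r; exact: cvg_cst.
have -> : (fun n => atan (n.+1%:R * z)) =
    (fun n => Num.sg z * atan (n.+1%:R * `|z|)).
  apply/funext => n; have [zp|zn|z00] := ltgtP z 0.
  - by rewrite ltr0_sg// ltr0_norm// mulrN atanN mulN1r opprK.
  - by rewrite gtr0_sg// gtr0_norm// mul1r.
  - by rewrite z00 eqxx in z0.
apply: cvgM; first exact: cvg_cst.
apply: (@cvg_comp _ _ _ (fun n : nat => n.+1%:R * `|z|) atan _ +oo); last exact: cvgy_atan.
apply/cvgryPge => A; near=> n; rewrite -ler_pdivrMr ?normr_gt0//.
apply: le_trans (_ : n%:R <= _); last by rewrite ler_nat.
by near: n; exact: nbhs_infty_ger.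
Unshelve. all: by end_near. Qed.

Lemma integrable_indic_itvcc (a b : R) :
  mu.-integrable setT (EFin \o (\1_(`[a, b]%classic) : R -> R)).
Proof. exact: integrable_indic_itv. Qed.

Lemma mem_set_itv (i : interval R) (x : R) : (x \in ([set` i] : set R)) = (x \in i).
Proof. by apply/idP/idP; rewrite inE. Qed.

Lemma Rintegral_indicM (D : set R) g : measurable D ->
  \int[mu]_x (\1_D x * g x) = \int[mu]_(x in D) g x.
Proof.
move=> mD; rewrite [RHS]Rintegral_mkcond; apply: eq_Rintegral => x _.
by rewrite patchE indicE; case: ifPn => _; rewrite ?mul1r ?mul0r.
Qed.

(** Abel means of the inverse transform are Poisson convolutions of [f]. The vanishing sine term is
    added back because only the sum over both waves gives the kernel. *)
Lemma trigT_cos_poisson f (e y : R) : 0 < e -> mu.-integrable setT (EFin \o f) ->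
  (forall t, trigT sin f t = 0) ->
  trigT cos (fun t => expR (- (e * `|t|)) * trigT cos f t) y =
  \int[mu]_x (f x * poisson e (y - x)).
Proof.
move=> e0 fi s0; have ie := integrable_expR_abs e0.
have iK c : bounded_wave c -> mu.-integrable setT
    (EFin \o (fun t => f t * trigT c (fun x => c (y * x) * expR (- (e * `|x|))) t)).
  by move=> wc; apply: integrable_mul_trigT => //; exact: integrable_wave.
have s00 : trigT sin (fun t => expR (- (e * `|t|)) * trigT sin f t) y = 0.
  under [LHS]eq_Rintegral do rewrite s0 !mulr0.
  by rewrite Rintegral_cst// mul0r.
rewrite -[LHS]addr0 -s00 !weighted_trigT//; try exact: wave_cos; try exact: wave_sin.
rewrite -(RintegralD _ (iK _ wave_cos) (iK _ wave_sin))//.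
by apply: eq_Rintegral => x _; rewrite -mulrDr sum_trigT_poisson.
Qed.

(** The Abel means are paired with the indicator of [[a, b]]. On one side dominated convergence
    removes the weight. On the other the Poisson kernel integrates over [[a, b]] to a difference of
    arctangents, whose limit is [2 * pi] times the indicator off the endpoints; no regularity of [f]
    enters. *)
Lemma Rintegral_itv_inversion f (a b : R) : a <= b ->
  mu.-integrable setT (EFin \o f) ->
  (forall t, trigT sin f t = 0) -> mu.-integrable setT (EFin \o trigT cos f) ->
  \int[mu]_(y in `[a, b]) trigT cos (trigT cos f) y =
  2 * pi * \int[mu]_(y in `[a, b]) f y.
Proof.
move=> ab fi s0 iphi.
pose I : R -> R := \1_(`[a, b]%classic).
have iI : mu.-integrable setT (EFin \o I) := integrable_indic_itvcc a b.
pose w (n : nat) (y : R) := expR (- (n.+1%:R^-1 * `|y|)).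
have n0 n : 0 < n.+1%:R^-1 :> R by [].
have iw n : mu.-integrable setT (EFin \o w n) := integrable_expR_abs (n0 n).
have iwp n : mu.-integrable setT (EFin \o (fun t => w n t * trigT cos f t)).
  exact: (integrable_mul_trigT wave_cos (iw n) fi).
have lhs : \int[mu]_y (I y * trigT cos (fun t => w n t * trigT cos f t) y) @[n --> \oo]
    --> \int[mu]_y (I y * trigT cos (trigT cos f) y).
  rewrite (trigTC wave_cos iI iphi).
  under eq_fun do rewrite (trigTC wave_cos iI (iwp _)).
  pose M := \int[mu]_y `|I y|.
  have mp : measurable_fun setT (trigT cos f) by exact: (measurable_trigT wave_cos fi).
  have mI : measurable_fun setT (trigT cos I) by exact: (measurable_trigT wave_cos iI).
  apply: (@Rintegral_dominated_cvg _ _ (fun t => `|M * trigT cos f t|)).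
  - move=> n; apply: measurable_funM => //; apply: measurable_funM => //.
    exact: measurable_expR_abs.
  - move=> t; apply: cvgM; last exact: cvg_cst.
    rewrite -[X in _ --> X]mul1r; apply: cvgM; last exact: cvg_cst.
    exact: cvg_expR_abs.
  - apply: integrable_norm.
    by have := integrableZl measurableT M iphi; apply: eq_integrable.
  - move=> n t; rewrite 3!normrM mulrC.
    have M0 : 0 <= M by exact: Rintegral_ge0.
    rewrite (ger0_norm M0) ler_pM ?mulr_ge0//; first exact: (trigT_bound wave_cos).
    rewrite ler_piMl// ger0_norm ?expR_ge0// /w -expR0 ler_expR oppr_le0.
    by rewrite mulr_ge0.
pose L (n : nat) x : R := 2 * (atan (n.+1%:R * (b - x)) - atan (n.+1%:R * (a - x))).
have swap n : \int[mu]_y (I y * trigT cos (fun t => w n t * trigT cos f t) y) =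
    \int[mu]_x (f x * L n x).
  have mp := measurable_poisson_prod (n0 n).
  have pb (z : R * R) : `|poisson n.+1%:R^-1 (z.1 - z.2)| <= 2 * n.+1%:R^-1^-1.
    exact: poisson_le.
  transitivity (\int[mu]_y (I y * \int[mu]_x (poisson n.+1%:R^-1 (y - x) * f x))).
    apply: eq_Rintegral => y _; rewrite trigT_cos_poisson//; congr (_ * _).
    by apply: eq_Rintegral => x _; rewrite mulrC.
  rewrite (Rintegral_kernelC iI fi mp pb); apply: eq_Rintegral => x _.
  congr (_ * _).
  under eq_Rintegral do rewrite mulrC.
  rewrite Rintegral_indicM//.
  under eq_Rintegral => y _ do rewrite /= -poissonN opprB.
  by rewrite Rintegral_poisson_itv// invrK.
have rhs : \int[mu]_x (f x * L n x) @[n --> \oo] -->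
    \int[mu]_x (f x * (pi * (Num.sg (b - x) - Num.sg (a - x)))).
  have mf : measurable_fun setT f by apply/measurable_EFinP; exact: (measurable_int mu).
  have mat (c : R) (n : nat) : measurable_fun setT (fun x : R => atan (n.+1%:R * (c - x))).
    apply: (measurableT_comp (continuous_measurable_fun (@continuous_atan R))).
    apply: measurable_funM => //; exact: measurable_funB.
  apply: (@Rintegral_dominated_cvg _ _ (fun x => `|2 * pi * f x|)).
  - move=> n; apply: measurable_funM => //; apply: measurable_funM => //.
    exact: measurable_funB.
  - move=> x; apply: cvgM; first exact: cvg_cst.
    have -> : pi * (Num.sg (b - x) - Num.sg (a - x)) =
        2 * (Num.sg (b - x) * (pi / 2) - Num.sg (a - x) * (pi / 2)) :> R.
      by field.
    apply: cvgM; first exact: cvg_cst.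
    by apply: cvgB; exact: cvg_atan_scale.
  - apply: integrable_norm.
    by have := integrableZl measurableT (2 * pi) fi; apply: eq_integrable.
  - move=> n x; rewrite normrM [leRHS]normrM mulrC ler_wpM2r//.
    have h1 := @atan_ltpi2 R (n.+1%:R * (b - x)).
    have h2 := @atan_gtNpi2 R (n.+1%:R * (b - x)).
    have h3 := @atan_ltpi2 R (n.+1%:R * (a - x)).
    have h4 := @atan_gtNpi2 R (n.+1%:R * (a - x)).
    rewrite (@ger0_norm _ (2 * pi)) ?mulr_ge0 ?pi_ge0// /L ler_norml.
    move: (atan _) (atan _) pi h1 h2 h3 h4 => u v p *.
    by apply/andP; split; lra.
have fL : \int[mu]_x (f x * (pi * (Num.sg (b - x) - Num.sg (a - x)))) =
    2 * pi * \int[mu]_(y in `[a, b]) f y.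
  have iIf : mu.-integrable setT (EFin \o (fun x => I x * f x)).
    apply: (integrable_boundedM (c := 1) measurableT fi) => [|x _].
      by apply/measurable_EFinP; exact: (measurable_int mu iI).
    by rewrite /I indicE; case: (_ \in _); rewrite ?normr1 ?normr0.
  have mf : measurable_fun setT f by apply/measurable_EFinP; exact: (measurable_int mu).
  have msg (c : R) : measurable_fun setT (fun x : R => Num.sg (c - x)).
    have -> : (fun x : R => Num.sg (c - x)) =
        (fun x => \1_(`]-oo, c[%classic : set R) x - \1_(`]c, +oo[%classic : set R) x).
      apply/funext => x; rewrite !indicE !mem_set_itv !in_itv/= andbT.
      have [xc|xc|->] := ltgtP x c.
      - by rewrite gtr0_sg ?subr_gt0// subr0.
      - by rewrite ltr0_sg ?subr_lt0// sub0r.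
      - by rewrite subrr sgr0 subr0.
    by apply: measurable_funB; exact: measurable_indic.
  have -> : \int[mu]_(y in `[a, b]) f y = \int[mu]_y (I y * f y).
    by rewrite Rintegral_indicM.
  rewrite -RintegralZl// /Rintegral; congr fine.
  apply: ae_eq_integral => //.
  - apply/measurable_EFinP; apply: measurable_funM => //; apply: measurable_funM => //.
    by apply: measurable_funB; exact: msg.
  - apply/measurable_EFinP; apply: measurable_funM => //.
    by apply/measurable_EFinP; exact: (measurable_int mu iIf).
  (* At the endpoints the limit of the arctangents is not [2 * pi] times the indicator; these points
     form a null set. *)
  exists ([set a] `|` [set b]); split; first exact: measurableU.
    apply: null_set_setU => //; exact: lebesgue_measure_set1.
  move=> x /=; apply: contra_notP => /not_orP[xa xb] _; congr EFin.
  move/eqP: xa => xa; move/eqP: xb => xb; rewrite /I indicE mem_set_itv in_itv/=.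
  case: (ltgtP x a) xa => [xa _|ax _|//].
    rewrite mul0r mulr0 gtr0_sg ?subr_gt0 ?(lt_le_trans xa)//.
    by rewrite gtr0_sg ?subr_gt0// subrr !mulr0.
  case: (ltgtP x b) xb => [xb _|bx _|//].
    by rewrite gtr0_sg ?subr_gt0// ltr0_sg ?subr_lt0//=; ring.
  by rewrite !ltr0_sg ?subr_lt0//= subrr mul0r !mulr0.
rewrite -fL.
have -> : \int[mu]_(y in `[a, b]) trigT cos (trigT cos f) y =
    \int[mu]_y (I y * trigT cos (trigT cos f) y).
  by rewrite Rintegral_indicM.
have lhs' : \int[mu]_x (f x * L n x) @[n --> \oo] -->
    \int[mu]_y (I y * trigT cos (trigT cos f) y).
  by under eq_fun do rewrite -swap.
rewrite -(cvg_lim (@Rhausdorff R) lhs'); exact: (cvg_lim (@Rhausdorff R) rhs).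
Qed.

(** The difference [g] of the two sides has zero integral over every interval, so it vanishes almost
    everywhere by Lebesgue's differentiation theorem. *)
Lemma fourier_inversion_ae f : mu.-integrable setT (EFin \o f) ->
  (forall t, trigT sin f t = 0) -> mu.-integrable setT (EFin \o trigT cos f) ->
  {ae mu, forall y, f y = (2 * pi)^-1 * trigT cos (trigT cos f) y}.
Proof.
move=> fi s0 iphi.
pose g y := f y - (2 * pi)^-1 * trigT cos (trigT cos f) y.
have cF : continuous (trigT cos (trigT cos f)) by exact: (continuous_trigT wave_cos).
have cF' : continuous (fun y => (2 * pi)^-1 * trigT cos (trigT cos f) y).
  by move=> y; apply: cvgM; [exact: cvg_cst|exact: cF].
have iF a b : mu.-integrable `[a, b]
    (EFin \o (fun y => (2 * pi)^-1 * trigT cos (trigT cos f) y)).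
  apply: continuous_compact_integrable; first exact: segment_compact.
  exact: continuous_subspaceT.
have ifab a b : mu.-integrable `[a, b] (EFin \o f).
  exact: (integrableS measurableT).
have ig a b : mu.-integrable `[a, b] (EFin \o g).
  by apply: eq_integrable (integrableB _ (ifab a b) (iF a b)).
have locg : locally_integrable setT g.
  apply: locally_integrableB.
    by apply: open_integrable_locally => //; exact: openT.
  split => //; [exact: continuous_measurable_fun|exact: openT|].
  move=> K _ cK; have : mu.-integrable K
    (EFin \o (fun y => (2 * pi)^-1 * trigT cos (trigT cos f) y)).
    by apply: continuous_compact_integrable => //; exact: continuous_subspaceT.
  by case/integrableP.
have G0 (a x : R) : \int[mu]_(t in `[a, x]) g t = 0.
  have [ax|xa] := leP a x; last by rewrite set_itv_ge ?Rintegral_set0// bnd_simp -ltNge.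
  rewrite RintegralB// RintegralZl//; last first.
    apply: continuous_compact_integrable; first exact: segment_compact.
    exact: continuous_subspaceT.
  rewrite Rintegral_itv_inversion// mulrA mulVf ?mul1r ?subrr//.
  by rewrite mulf_neq0// gt_eqF// pi_gt0.
(* [FTC1] works from a fixed left endpoint; the endpoints [- n] exhaust the line at the cost of
   countably many null sets. *)
have : forall n : nat, {ae mu, forall x, - n%:R < x -> g x = 0}.
  move=> n; have /= := @FTC1 _ g (BLeft (- n%:R)) (ig _) locg.
  apply: (@filterS _ _ (ae_filter_ringOfSetsType mu)) => x h nx.
  have [|_ <-] := h; first by rewrite lte_fin.
  have -> : (fun x => \int[mu]_(t in `[- n%:R, x]) g t) = cst 0.
    by apply/funext => y; exact: G0.
  by rewrite derive1_cst.
move=> /ae_foralln; apply: (@filterS _ _ (ae_filter_ringOfSetsType mu)) => x h; apply/eqP; rewrite -subr_eq0; apply/eqP.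
apply: (h (Num.Def.truncn `|x|).+1); rewrite ltrNl.
apply: le_lt_trans (_ : `|x| < _); first by rewrite -normrN ler_norm.
exact: truncnS_gt.
Qed.

End fourier_inversion.

Section parity.
Context {R : realType}.
Local Notation mu := (@lebesgue_measure R).

Lemma ge0_integral_opp (F : R -> \bar R) : measurable_fun setT F ->
  (forall x, (0 <= F x)%E) -> (\int[mu]_x F (- x)%R = \int[mu]_x F x)%E.
Proof.
move=> mF F0.
have split (G : R -> \bar R) : measurable_fun setT G -> (forall x, (0 <= G x)%E) ->
    (\int[mu]_x G x =
     \int[mu]_(x in `]-oo, 0%R]) G x + \int[mu]_(x in `[0%R, +oo[) G x)%E.
  move=> mG G0; rewrite -integral_itv_obnd_cbnd; last exact: measurable_funTS.
  rewrite -ge0_integral_setU//=.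
  - by congr (integral _ _ _); rewrite -itv_bndbnd_setU ?set_itvNyy.
  - exact: measurable_funTS.
  - apply/disj_setPS => x [/=]; rewrite !in_itv/= andbT => x0.
    by rewrite ltNge x0.
have mFN : measurable_fun setT (fun x : R => F (- x)).
  apply: (measurableT_comp mF); apply: continuous_measurable_fun.
  exact: oppr_continuous.
rewrite (split _ mF F0) (split _ mFN (fun x => F0 _)).
rewrite (ge0_integration_by_substitution0 mF F0).
rewrite (ge0_integration_by_substitution0 mFN (fun x => F0 _)).
by under [X in (_ + X)%E = _]eq_integral do rewrite opprK; rewrite addeC.
Qed.

(** Reflection exchanges the positive and negative parts, so their integrals agree. If both are
    infinite the result is still 0, since [fine] sends infinite values to 0. *)
Lemma Rintegral_odd (g : R -> R) : measurable_fun setT g ->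
  (forall x, g (- x) = - g x) -> \int[mu]_x g x = 0.
Proof.
move=> mg og; rewrite /Rintegral integralE.
have -> : (\int[mu]_x (fun x => (g x)%:E)^\- x = \int[mu]_x (fun x => (g x)%:E)^\+ x)%E.
  rewrite -[RHS]ge0_integral_opp.
  - by apply: eq_integral => x _; rewrite funeposE funenegE/= og.
  - by apply: measurable_funepos; exact/measurable_EFinP.
  - by move=> x; rewrite funeposE le_max lexx orbT.
set I := (\int[mu]_x _)%E.
have : (0 <= I)%E by apply: integral_ge0 => x _; rewrite funeposE le_max lexx orbT.
by case: I => [r| |]//= _; rewrite subrr.
Qed.

Lemma trigT_sin_even (f : R -> R) (t : R) : measurable_fun setT f ->
  (forall x, f (- x) = f x) -> trigT sin f t = 0.
Proof.
move=> mf ef; apply: Rintegral_odd => [|x].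
  by apply: measurable_funM => //; exact: (measurable_wave t wave_sin).
by rewrite mulrN sinN ef mulNr.
Qed.

Lemma trigT_cosN (f : R -> R) (t : R) : trigT cos f (- t) = trigT cos f t.
Proof. by apply: eq_Rintegral => x _; rewrite mulNr cosN. Qed.

End parity.

Section trigonometric_bounds.
Context {R : realType}.
Local Notation mu := (@lebesgue_measure R).

Lemma lebesgue_measure_itvcc (a b : R) : a <= b -> mu `[a, b] = (b - a)%:E.
Proof.
rewrite le_eqVlt => /predU1P[->|ab]; rewrite lebesgue_measure_itv/= lte_fin.
  by rewrite ltxx subrr.
by rewrite ab EFinB.
Qed.

Lemma sin_le_id (x : R) : 0 <= x -> sin x <= x.
Proof.
move=> x0.
have -> : sin x = \int[mu]_(s in `[0, x]) cos s.
  by rewrite (Rintegral_itv_FTC x0 (@continuous_cos R) (@is_derive_sin R)) sin0 subr0.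
have h : x = \int[mu]_(s in `[0, x]) (1 : R).
  by rewrite Rintegral_cst//= lebesgue_measure_itvcc//= subr0 mul1r.
rewrite [leRHS]h; apply: le_Rintegral => //.
- apply: continuous_compact_integrable; first exact: segment_compact.
  by apply: continuous_subspaceT; exact: continuous_cos.
- apply: continuous_compact_integrable; first exact: segment_compact.
  by apply: continuous_subspaceT => ?; apply: cvg_cst.
Qed.

Lemma onem_cos_le (x : R) : 1 - cos x <= x ^+ 2 / 2.
Proof.
wlog x0 : x / 0 <= x.
  move=> h; have [/h//|x0] := leP 0 x.
  by have := h (- x); rewrite cosN sqrrN oppr_ge0 => -> //; exact: ltW.
have dcos (y : R) : is_derive y 1 (fun y : R => - cos y) (sin y).
  by apply: (is_derive_fun (is_deriveN (is_derive_cos y))); rewrite opprK.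
have dsq (y : R) : is_derive y 1 (fun y : R => y ^+ 2 / 2) y.
  have -> : (fun y : R => y ^+ 2 / 2) = (fun y : R => 2^-1 * (y * y)).
    by apply/funext => z; rewrite expr2 mulrC.
  apply: (is_derive_fun (is_derive_scalef 2^-1
    (is_derive_mulf (is_derive_id y 1) (is_derive_id y 1)))).
  by field.
have <- : \int[mu]_(s in `[0, x]) sin s = 1 - cos x.
  rewrite (Rintegral_itv_FTC x0 (@continuous_sin R) dcos) cos0; ring.
have <- : \int[mu]_(s in `[0, x]) s = x ^+ 2 / 2.
  by rewrite (Rintegral_itv_FTC x0 (fun x => cvg_id) dsq) expr0n/= mul0r subr0.
apply: le_Rintegral => //.
- apply: continuous_compact_integrable; first exact: segment_compact.
  by apply: continuous_subspaceT; exact: continuous_sin.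
- apply: continuous_compact_integrable; first exact: segment_compact.
  by apply: continuous_subspaceT => ?; exact: cvg_id.
- by move=> s /=; rewrite in_itv/= => /andP[s0 _]; exact: sin_le_id.
Qed.

End trigonometric_bounds.

(** * Characteristic function of an even density in the smoothness class *)

Section smoothness_class.
Context {R : realType}.
Local Notation mu := (@lebesgue_measure R).
Variables (beta L C K : R) (f : R -> R).
Hypothesis beta0 : 0 < beta.
Hypothesis densf : is_probability_density f.
Hypothesis fK : (\int[mu]_x (x ^+ 2 * f x)%:E <= K%:E)%E.
Hypothesis fL : (\int[mu]_t (`|t| `^ beta * Normc.normc (fourier f t))%:E <= L%:E)%E.
Hypothesis fC : (\int[mu]_t (`|t| `^ (2 * beta) *
  Normc.normc (fourier f t) ^+ 2)%:E <= C%:E)%E.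
Hypothesis evenf : forall x, f (- x) = f x.

Let mf : measurable_fun setT f. Proof. by case: densf. Qed.
Let f0 x : 0 <= f x. Proof. by case: densf. Qed.

Lemma integrable_density : mu.-integrable setT (EFin \o f).
Proof.
apply/integrableP; split; first exact/measurable_EFinP.
under eq_integral => x _ do rewrite /= ger0_norm//.
by case: densf => _ _ ->; rewrite ltry.
Qed.

Let phi := trigT cos f.

Lemma fourier_even t : fourier f t = (phi t)%:C%C.
Proof.
rewrite /fourier /cintegral /phi -[(trigT cos f t)%:C%C]/(Complex (trigT cos f t) 0).
congr Complex.
  apply: eq_Rintegral => x _; rewrite /expC/=; simpc; rewrite expR0/=; ring.
rewrite -[RHS](@trigT_sin_even _ f t)//.
apply: eq_Rintegral => x _; rewrite /expC/=; simpc; rewrite expR0/=; ring.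
Qed.


Lemma normc_real (r : R) : Normc.normc (r%:C)%C = `|r|.
Proof. by rewrite /= expr0n addr0 sqrtr_sqr. Qed.

Let Rf1 : \int[mu]_x f x = 1.
Proof. by rewrite /Rintegral; case: densf => _ _ ->. Qed.

Lemma norm_phi_le1 t : `|phi t| <= 1.
Proof.
apply: le_trans (trigT_bound wave_cos integrable_density t) _.
by rewrite -[leRHS]Rf1 le_eqVlt; apply/orP; left; apply/eqP; apply: eq_Rintegral => x _; rewrite ger0_norm.
Qed.

Lemma continuous_phi : continuous phi.
Proof. exact: (continuous_trigT wave_cos integrable_density). Qed.

Lemma measurable_phi : measurable_fun setT phi.
Proof. by apply: continuous_measurable_fun; exact: continuous_phi. Qed.

Lemma onem_phi_le t : 1 - phi t <= K * t ^+ 2 / 2.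
Proof.
have i2 : mu.-integrable setT (EFin \o (fun x => x ^+ 2 * f x)).
  apply/integrableP; split.
    by apply/measurable_EFinP; apply: measurable_funM => //; exact: measurable_funX.
  have h x : 0 <= x ^+ 2 * f x by apply: mulr_ge0 => //; exact: sqr_ge0.
  under eq_integral => x _ do rewrite /= (ger0_norm (h x)).
  by rewrite (le_lt_trans fK)// ltry.
have i2t : mu.-integrable setT (EFin \o (fun x => t ^+ 2 / 2 * (x ^+ 2 * f x))).
  by apply: eq_integrable (integrableZl measurableT (t ^+ 2 / 2) i2).
have iw := integrable_wave t wave_cos integrable_density.
rewrite -[X in X - _]Rf1 /phi /trigT -RintegralB//; last exact: integrable_density.
apply: (@le_trans _ _ (\int[mu]_x (t ^+ 2 / 2 * (x ^+ 2 * f x)))).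
  apply: le_Rintegral => // [|x _].
    by apply: eq_integrable (integrableB measurableT integrable_density iw).
  rewrite -[X in X - _]mul1r -mulrBl mulrA ler_wpM2r//.
  by apply: le_trans (onem_cos_le _) _; rewrite exprMn mulrAC.
have hK : \int[mu]_x (x ^+ 2 * f x) <= K.
  by rewrite -lee_fin fineK//; exact: integrable_fin_num.
rewrite RintegralZl//; apply: le_trans (ler_wpM2l _ hK) _.
  by apply: divr_ge0 => //; exact: sqr_ge0.
by rewrite le_eqVlt; apply/orP; left; apply/eqP; field.
Qed.

Lemma phi_smooth : (\int[mu]_t (`|t| `^ beta * `|phi t|)%:E <= L%:E)%E.
Proof. by under eq_integral do rewrite -normc_real -fourier_even. Qed.

Lemma integrable_phi_smooth :
  mu.-integrable setT (EFin \o (fun t => `|t| `^ beta * `|phi t|)).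
Proof.
apply/integrableP; split.
  apply/measurable_EFinP; apply: measurable_funM.
    by apply: (measurableT_comp (measurable_powR beta)); exact: normr_measurable.
  by apply: measurableT_comp => //; exact: measurable_phi.
have h x : 0 <= `|x| `^ beta * `|phi x| by apply: mulr_ge0 => //; exact: powR_ge0.
under eq_integral => x _ do rewrite /= (ger0_norm (h x)).
by rewrite (le_lt_trans phi_smooth)// ltry.
Qed.

Lemma powR_ge1 (x b : R) : 1 <= x -> 0 <= b -> 1 <= x `^ b.
Proof.
move=> x1 b0; have := @ge0_ler_powR R b b0 1 x.
by rewrite powR1 !nnegrE; apply => //; rewrite (le_trans ler01).
Qed.

(** [|phi t|] is at most 1 on [[-1, 1]] and at most [|t|^beta |phi t|] beyond. The inversion formula
    needs this. *)
Lemma integrable_phi : mu.-integrable setT (EFin \o phi).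
Proof.
have := integrableD measurableT (integrable_indic_itvcc (- 1) 1) integrable_phi_smooth.
apply: (le_integrable measurableT).
  by apply/measurable_EFinP; exact: measurable_phi.
move=> t _; rewrite /= lee_fin indicE mem_set_itv in_itv/= -ler_norml.
apply: le_trans (ler_norm _); have [t1|t1] := leP `|t| 1.
  by rewrite (le_trans (norm_phi_le1 t))//= lerDl mulr_ge0// powR_ge0.
by rewrite add0r ler_peMl// powR_ge1// ltW.
Qed.

(** Chebyshev's argument: outside the interval the weight [|t|^(2 beta)] is at least
    [T^(2 beta)]. *)
Lemma phi_tail (T : R) : 0 < T ->
  (\int[mu]_(t in ~` `[(- T)%R, T%R]) (phi t ^+ 2)%:E <= (T `^ (- (2 * beta)) * C)%:E)%E.
Proof.
move=> T0.
have m2 : measurable_fun setT (fun t : R => (`|t| `^ (2 * beta) * phi t ^+ 2)%:E).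
  apply/measurable_EFinP; apply: measurable_funM.
    by apply: (measurableT_comp (measurable_powR _)); exact: normr_measurable.
  by apply: measurable_funX; exact: measurable_phi.
have p0 t : (0 <= (`|t| `^ (2 * beta) * phi t ^+ 2)%:E)%E.
  by rewrite lee_fin mulr_ge0 ?powR_ge0 ?sqr_ge0.
apply: (@le_trans _ _ (\int[mu]_(t in ~` `[(- T)%R, T%R])
    ((T `^ (- (2 * beta)))%:E * (`|t| `^ (2 * beta) * phi t ^+ 2)%:E))%E).
  apply: le_integral_nonmeasurable => t; first by rewrite lee_fin sqr_ge0.
  move=> /= tT; rewrite lee_fin mulrA -[leLHS]mul1r ler_wpM2r ?sqr_ge0//.
  have Tt : T <= `|t|.
    by rewrite leNgt; apply/negP => h; apply: tT; rewrite in_itv/= -ler_norml ltW.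
  rewrite powRN mulrC ler_pdivlMr ?powR_gt0// mul1r.
  apply: ge0_ler_powR => //; first by rewrite mulr_ge0// ltW.
  by rewrite nnegrE ltW.
rewrite ge0_integralZl//; last 3 first.
- by apply: measurableC; exact: measurable_itv.
- exact: measurable_funTS.
- by rewrite lee_fin powR_ge0.
rewrite EFinM lee_wpmul2l ?lee_fin ?powR_ge0//.
have mTc : measurable (~` `[- T, T] : set R).
  by apply: measurableC; exact: measurable_itv.
apply: le_trans (ge0_subset_integral mu mTc measurableT m2 (fun t _ => p0 t) _) _ => //.
apply: le_trans fC; rewrite le_eqVlt; apply/orP; left; apply/eqP.
by apply: eq_integral => t _; rewrite fourier_even normc_real real_normK ?num_real.
Qed.

End smoothness_class.

(** * Deviations of empirical trigonometric means *)

Section finite_sums.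
Context d (T : measurableType d) (R : realType).
Variable mu : {measure set T -> \bar R}.

Lemma integrable_sumf (I : Type) (r : seq I) (F : I -> T -> R) :
  (forall i, mu.-integrable setT (EFin \o F i)) ->
  mu.-integrable setT (EFin \o (fun x => \sum_(i <- r) F i x)).
Proof.
move=> iF; elim: r => [|i r ih].
  apply: eq_integrable (integrable0 mu setT) => // x _ /=.
  by rewrite big_nil.
apply: eq_integrable (integrableD measurableT (iF i) ih) => // x _ /=.
by rewrite big_cons EFinD.
Qed.

Lemma Rintegral_sum (I : Type) (r : seq I) (F : I -> T -> R) :
  (forall i, mu.-integrable setT (EFin \o F i)) ->
  \int[mu]_x (\sum_(i <- r) F i x) = \sum_(i <- r) \int[mu]_x F i x.
Proof.
move=> iF; elim: r => [|i r ih].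
  under eq_Rintegral do rewrite big_nil.
  by rewrite Rintegral_cst// mul0r big_nil.
under eq_Rintegral do rewrite big_cons.
by rewrite RintegralD ?ih ?big_cons//; exact: integrable_sumf.
Qed.

Lemma integrable_sqr_mul (f g : T -> R) :
  measurable_fun setT f -> measurable_fun setT g ->
  mu.-integrable setT (EFin \o (fun x => f x ^+ 2)) ->
  mu.-integrable setT (EFin \o (fun x => g x ^+ 2)) ->
  mu.-integrable setT (EFin \o (fun x => f x * g x)).
Proof.
move=> mf mg if2 ig2; apply: (le_integrable measurableT _ _ (integrableD measurableT if2 ig2)).
  by apply/measurable_EFinP; exact: measurable_funM.
move=> x _; rewrite /= lee_fin (@ger0_norm _ (_ + _)) ?addr_ge0 ?sqr_ge0//.
rewrite normrM; have := sqr_ge0 (`|f x| - `|g x|).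
have := sqr_ge0 (f x); have := sqr_ge0 (g x).
rewrite sqrrB !real_normK ?num_real// -mulr_natl; lra.
Qed.

End finite_sums.

Lemma Rintegral_probability_cst d (T : measurableType d) (R : realType)
  (P : probability T R) (c : R) : \int[P]_o c = c.
Proof.
rewrite Rintegral_cst// -[RHS]mulr1; congr (_ * _).
exact: (congr1 fine (probability_setT P)).
Qed.

(** * Independence and the variance of a centred mean *)

Section independence.
Context d (T : measurableType d) (R : realType) (P : probability T R).
Variables (X Y : {mfun T >-> R}).
Hypothesis XY : forall A B : set R, measurable A -> measurable B ->
  P (X @^-1` A `&` Y @^-1` B) = (P (X @^-1` A) * P (Y @^-1` B))%E.

(** The joint law agrees with the product of the marginals on rectangles, hence everywhere by
    uniqueness of the product measure; Fubini's theorem then factors the integral. *)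
Lemma Rintegral_indep_mul (f g : R -> R) :
  measurable_fun setT f -> measurable_fun setT g ->
  P.-integrable setT (EFin \o (f \o X)) -> P.-integrable setT (EFin \o (g \o Y)) ->
  P.-integrable setT (EFin \o (fun o => f (X o) * g (Y o))) ->
  \int[P]_o (f (X o) * g (Y o)) = \int[P]_o f (X o) * \int[P]_o g (Y o).
Proof.
move=> mf mg ifX igY ifg.
pose XYf o := (X o, Y o).
have mXY : measurable_fun setT XYf by exact: measurable_fun_pair.
have mX : measurable_fun setT X by [].
have mY : measurable_fun setT Y by [].
pose D1 := distribution P X; pose D2 := distribution P Y.
have prodE A : measurable A -> (D1 \x D2)%E A = pushforward P XYf A.
  move=> mA.
  exact: (@product_measure_unique _ _ _ _ _ D1 D2 (pushforward P XYf)).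
have mF : measurable_fun setT (fun z : R * R => (f z.1 * g z.2)%:E).
  by apply/measurable_EFinP; apply: measurable_funM; exact: measurableT_comp.
have if1 : D1.-integrable setT (EFin \o f).
  apply/integrableP; split; first exact/measurable_EFinP.
  rewrite ge0_integral_pushforward//; first by case/integrableP: ifX.
  by apply: measurableT_comp => //; exact/measurable_EFinP.
have ig2 : D2.-integrable setT (EFin \o g).
  apply/integrableP; split; first exact/measurable_EFinP.
  rewrite ge0_integral_pushforward//; first by case/integrableP: igY.
  by apply: measurableT_comp => //; exact/measurable_EFinP.
have cst1 (z : R * R) : `|cst (1 : R) z| <= 1 by rewrite normr1.
have ifg12 := @integrable_kernel _ _ _ _ _ D1 D2 f g (cst 1) 1 if1 ig2
  (measurable_cst _) cst1.
have fE : \int[P]_o f (X o) = \int[D1]_x f x.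
  by rewrite /Rintegral integral_pushforward//; exact/measurable_EFinP.
have gE : \int[P]_o g (Y o) = \int[D2]_x g x.
  by rewrite /Rintegral integral_pushforward//; exact/measurable_EFinP.
have -> : \int[P]_o (f (X o) * g (Y o)) =
    fine (\int[pushforward P XYf]_z (f z.1 * g z.2)%:E)%E.
  by rewrite /Rintegral integral_pushforward.
rewrite (eq_measure_integral (D1 \x D2)%E); last first.
  by move=> A mA _; exact: esym (prodE _ mA).
have ifgD : (D1 \x D2)%E.-integrable setT (fun z => (f z.1 * g z.2)%:E).
  by apply: eq_integrable ifg12 => // z _; rewrite mul1r.
rewrite -integral12_prod_meas1// /fubini_F/=.
under eq_integral => x _.
  rewrite (_ : \int[_]_y _ = (f x * \int[D2]_y g y)%:E)%E; last first.
    under eq_integral do rewrite EFinM.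
    by rewrite integralZl// EFinM fineK//; exact: integrable_fin_num.
  over.
by rewrite fE gE -/(Rintegral _ _ _) RintegralZr.
Qed.

End independence.

Section centred_mean.
Context d (T : measurableType d) (R : realType) (P : probability T R).
Variables (n : nat) (X : 'I_n -> {mfun T >-> R}).
Hypothesis indX : forall j k, j != k -> forall A B : set R, measurable A -> measurable B ->
  P (X j @^-1` A `&` X k @^-1` B) = (P (X j @^-1` A) * P (X k @^-1` B))%E.
Variable m2 : R.
Hypothesis X2 : forall j, (\int[P]_o (X j o ^+ 2)%:E <= m2%:E)%E.

Lemma integrable_sqr_rv j : P.-integrable setT (EFin \o (fun o => X j o ^+ 2)).
Proof.
apply/integrableP; split.
  by apply/measurable_EFinP; exact: measurable_funX.
under eq_integral do rewrite /= ger0_norm ?sqr_ge0//.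
exact: le_lt_trans (X2 j) (ltry _).
Qed.

Lemma integrable_probability_cst (c : R) : P.-integrable setT (EFin \o cst c).
Proof. exact: finite_measure_integrable_cst. Qed.

Lemma integrable_of_sqr (f : T -> R) : measurable_fun setT f ->
  P.-integrable setT (EFin \o (fun o => f o ^+ 2)) ->
  P.-integrable setT (EFin \o f).
Proof.
move=> mf if2.
have i1 : P.-integrable setT (EFin \o (fun=> 1 ^+ 2)).
  exact: integrable_probability_cst.
have := integrable_sqr_mul mf (measurable_cst (1:R)) if2 i1.
by apply: eq_integrable => // x _ /=; rewrite mulr1.
Qed.

Lemma integrable_rv j : P.-integrable setT (EFin \o X j).
Proof. by apply: integrable_of_sqr => //; exact: integrable_sqr_rv. Qed.

(** Pairwise independence kills the off-diagonal terms, and each diagonal term is a variance, at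
    most the second moment of [g (X j)] and so at most [m2]. *)
Lemma mean_centred_sqr (g : R -> R) : measurable_fun setT g ->
  (forall x, `|g x| <= `|x|) ->
  (\int[P]_o ((n%:R^-1 * \sum_(j < n) (g (X j o) - \int[P]_p g (X j p))) ^+ 2)%:E
    <= (m2 / n%:R)%:E)%E.
Proof.
move=> mg gx.
pose e j := \int[P]_p g (X j p).
pose Z j o := g (X j o) - e j.
have mgX j : measurable_fun setT (g \o X j) by exact: measurableT_comp.
have mZ j : measurable_fun setT (Z j).
  by apply: measurable_funB; [exact: mgX|exact: measurable_cst].
have ig2 j : P.-integrable setT (EFin \o (fun o => g (X j o) ^+ 2)).
  apply: (le_integrable measurableT _ _ (integrable_sqr_rv j)).
    by apply/measurable_EFinP; apply: measurable_funX; exact: mgX.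
  by move=> o _; rewrite lee_fin !normrX; apply: lerXn2r; rewrite ?nnegrE.
have ig j : P.-integrable setT (EFin \o (g \o X j)).
  by apply: integrable_of_sqr; [exact: mgX|exact: ig2].
have Z2E j o : Z j o ^+ 2 = g (X j o) ^+ 2 + (- 2 * e j) * g (X j o) + e j ^+ 2.
  by rewrite /Z; ring.
have igs j : P.-integrable setT (EFin \o (fun o => g (X j o) ^+ 2 + (- 2 * e j) * g (X j o))).
  have i1 := integrableZl measurableT (- 2 * e j) (ig j).
  by apply: eq_integrable (integrableD measurableT (ig2 j) i1).
have iZ2 j : P.-integrable setT (EFin \o (fun o => Z j o ^+ 2)).
  apply: eq_integrable (integrableD measurableT (igs j) (integrable_probability_cst (e j ^+ 2))) => //.
  by move=> o _; rewrite /= -EFinD Z2E.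
have EZ2 j : \int[P]_o (Z j o ^+ 2) <= m2.
  under eq_Rintegral do rewrite Z2E.
  have i1 : P.-integrable setT (EFin \o (fun o => (- 2 * e j) * g (X j o))).
    by apply: eq_integrable (integrableZl measurableT (- 2 * e j) (ig j)).
  rewrite (RintegralD _ (igs j) (integrable_probability_cst (e j ^+ 2)))//.
  rewrite (RintegralD _ (ig2 j) i1)// RintegralZl//; last exact: ig.
  rewrite -/(e j) Rintegral_probability_cst.
  have : \int[P]_o (g (X j o) ^+ 2) <= m2.
    rewrite -lee_fin fineK; last exact: (integrable_fin_num measurableT (ig2 j)).
    apply: le_trans (X2 j); apply: le_integral_nonmeasurable => o _.
      by rewrite lee_fin sqr_ge0.
    rewrite lee_fin -(real_normK (num_real (g _))) -(real_normK (num_real (X j o))).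
    by apply: lerXn2r; rewrite ?nnegrE.
  have := sqr_ge0 (e j); rewrite expr2; lra.
have iZZ j k : P.-integrable setT (EFin \o (fun o => Z j o * Z k o)).
  exact: (integrable_sqr_mul (mZ j) (mZ k) (iZ2 j) (iZ2 k)).
have iZ j : P.-integrable setT (EFin \o Z j).
  by apply: integrable_of_sqr; [exact: mZ|exact: iZ2].
have EZ j : \int[P]_o Z j o = 0.
  rewrite (RintegralB _ (ig j) (integrable_probability_cst (e j)))//.
  by rewrite Rintegral_probability_cst subrr.
have EZZ j k : j != k -> \int[P]_o (Z j o * Z k o) = 0.
  move=> jk.
  rewrite (@Rintegral_indep_mul _ _ _ P _ _ (indX jk) (fun x => g x - e j) (fun x => g x - e k)) //.
  - by rewrite [X in X * _]EZ mul0r.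
  - exact: measurable_funB.
  - exact: measurable_funB.
  - exact: iZ.
  - exact: iZ.
  - exact: iZZ.
pose S o := \sum_(j < n) \sum_(k < n) Z j o * Z k o.
have SE o : (n%:R^-1 * \sum_(j < n) (g (X j o) - \int[P]_p g (X j p))) ^+ 2 =
    n%:R ^- 2 * S o.
  rewrite exprMn exprVn; congr (_ * _); rewrite expr2 big_distrlr/=.
  by apply: eq_bigr => j _; apply: eq_bigr => k _.
have iSj j : P.-integrable setT (EFin \o (fun o => \sum_(k < n) Z j o * Z k o)).
  by apply: integrable_sumf => k; exact: iZZ.
have iS : P.-integrable setT (EFin \o S) by exact: integrable_sumf.
have ES : \int[P]_o S o = \sum_(j < n) \int[P]_o (Z j o ^+ 2).
  rewrite Rintegral_sum//; apply: eq_bigr => j _.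
  rewrite Rintegral_sum; last by move=> k; exact: iZZ.
  rewrite (bigD1 j)//= big1 ?addr0 => [|k kj]; last by rewrite EZZ// eq_sym.
  by apply: eq_Rintegral => o _; rewrite expr2.
under eq_integral do rewrite SE EFinM.
rewrite integralZl// -[X in (_ * X)%E]fineK; last first.
  exact: (integrable_fin_num measurableT iS).
rewrite -EFinM lee_fin -/(Rintegral _ _ _) ES.
have SM : \sum_(j < n) \int[P]_o (Z j o ^+ 2) <= n%:R * m2.
  rewrite mulr_natl -[n in leRHS]card_ord -sumr_const.
  by apply: ler_sum => j _; exact: EZ2.
apply: le_trans (ler_wpM2l _ SM) _; first by rewrite invr_ge0 sqr_ge0.
(* For the empty mean both sides are 0, by the convention [0^-1 = 0]. *)
have [->|n0] := eqVneq n 0%N; first by rewrite mul0r mulr0 invr0 mulr0.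
have nR : n%:R != 0 :> R by rewrite pnatr_eq0.
by rewrite le_eqVlt; apply/orP; left; apply/eqP; field.
Qed.

End centred_mean.

Section cosine_lower_bound.
Context {R : realType}.
Local Notation mu := (@lebesgue_measure R).

Lemma sin_ge_half (x : R) : 0 <= x <= 1 -> x / 2 <= sin x.
Proof.
move=> /andP[x0 x1].
have -> : sin x = \int[mu]_(s in `[0, x]) cos s.
  by rewrite (Rintegral_itv_FTC x0 (@continuous_cos R) (@is_derive_sin R)) sin0 subr0.
have h : x / 2 = \int[mu]_(s in `[0, x]) (2^-1 : R).
  by rewrite Rintegral_cst//= lebesgue_measure_itvcc//= subr0 mulrC.
rewrite [leLHS]h; apply: le_Rintegral => //.
- apply: continuous_compact_integrable; first exact: segment_compact.
  by apply: continuous_subspaceT => ?; apply: cvg_cst.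
- apply: continuous_compact_integrable; first exact: segment_compact.
  by apply: continuous_subspaceT; exact: continuous_cos.
move=> s /=; rewrite in_itv/= => /andP[s0 sx].
have := onem_cos_le s; have : s ^+ 2 <= 1 by rewrite expr_le1// (le_trans sx).
lra.
Qed.

Lemma onem_cos_ge (x : R) : `|x| <= 1 -> x ^+ 2 / 4 <= 1 - cos x.
Proof.
wlog x0 : x / 0 <= x.
  move=> h; have [/h//|x0] := leP 0 x.
  by have := h (- x); rewrite cosN sqrrN oppr_ge0 normrN; apply; exact: ltW.
rewrite ger0_norm// => x1.
have dcos (y : R) : is_derive y 1 (fun y : R => - cos y) (sin y).
  by apply: (is_derive_fun (is_deriveN (is_derive_cos y))); rewrite opprK.
have dsq (y : R) : is_derive y 1 (fun y : R => y ^+ 2 / 4) (2^-1 * y).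
  have -> : (fun y : R => y ^+ 2 / 4) = (fun y : R => 4^-1 * (y * y)).
    by apply/funext => z; rewrite expr2 mulrC.
  apply: (is_derive_fun (is_derive_scalef 4^-1
    (is_derive_mulf (is_derive_id y 1) (is_derive_id y 1)))).
  by field.
have <- : \int[mu]_(s in `[0, x]) sin s = 1 - cos x.
  rewrite (Rintegral_itv_FTC x0 (@continuous_sin R) dcos) cos0; ring.
have cs : continuous (fun s : R => 2^-1 * s) by exact: mulrl_continuous.
have <- : \int[mu]_(s in `[0, x]) (2^-1 * s) = x ^+ 2 / 4.
  by rewrite (Rintegral_itv_FTC x0 cs dsq) expr0n/= mul0r subr0.
apply: le_Rintegral => //.
- apply: continuous_compact_integrable; first exact: segment_compact.
  exact: continuous_subspaceT.
- apply: continuous_compact_integrable; first exact: segment_compact.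
  by apply: continuous_subspaceT; exact: continuous_sin.
move=> s /=; rewrite in_itv/= => /andP[s0 sx].
by rewrite mulrC sin_ge_half// s0 (le_trans sx).
Qed.

End cosine_lower_bound.

(** * Second moments from the characteristic function near 0 *)

Section second_moment.
Context d (T : measurableType d) (R : realType) (P : probability T R).
Variables (X : {mfun T >-> R}) (c : R).
Hypothesis Xc : forall t, \int[P]_o cos (t * X o) >= 1 - c * t ^+ 2.

Lemma measurable_waveX (w : R -> R) (t : R) : continuous w ->
  measurable_fun setT (fun o => w (t * X o)).
Proof.
move=> cw; apply: (measurableT_comp (continuous_measurable_fun cw)).
exact: measurable_funM.
Qed.

Lemma integrable_waveX (w : R -> R) (t : R) : bounded_wave w ->
  P.-integrable setT (EFin \o (fun o => w (t * X o))).
Proof.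
move=> [cw w1].
have := integrable_boundedM measurableT (integrable_probability_cst P 1)
  (measurable_waveX t cw) (fun x _ => w1 _).
by apply: eq_integrable => // x _ /=; rewrite mulr1.
Qed.

(* [X ^ 2 <= 4 N ^ 2 (1 - cos (X / N))] on the event [|X| <= N]. *)
Lemma second_moment_le : 0 <= c -> (\int[P]_o (X o ^+ 2)%:E <= (4 * c)%:E)%E.
Proof.
move=> c0.
apply: (ge0_integral_le_cover (F := fun n => [set o | `|X o| <= n%:R])) => //.
- by move=> n m nm o /= /le_trans; apply; rewrite ler_nat.
- move=> n; rewrite -[X in measurable X]setTI.
  have mX : measurable_fun setT (fun o => `|X o|) by exact: measurableT_comp.
  rewrite (_ : [set o | _] = (fun o => `|X o|) @^-1` `]-oo, n%:R]).
    by apply: mX => //; exact: measurable_itv.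
  by apply/seteqP; split => o /=; rewrite in_itv.
- by move=> o; exists (Num.Def.truncn `|X o|).+1; rewrite /= ltW// truncnS_gt.
- by apply/measurable_EFinP; exact: measurable_funX.
- by move=> o; rewrite lee_fin sqr_ge0.
move=> n; have [->|n0] := eqVneq n 0%N.
  rewrite integral0_eq ?lee_fin ?mulr_ge0// => o /=.
  by rewrite normr_le0 => /eqP ->; rewrite expr0n.
have nR : 0 < n%:R :> R by rewrite ltr0n lt0n.
have nR0 : n%:R != 0 :> R by rewrite gt_eqF.
pose q o := 4 * n%:R ^+ 2 * (1 - cos (n%:R^-1 * X o)).
have q0 o : 0 <= q o.
  by rewrite mulr_ge0 ?mulr_ge0 ?sqr_ge0// subr_ge0 cos_le1.
have i1 : P.-integrable setT (EFin \o (fun o => 1 - cos (n%:R^-1 * X o))).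
  by apply: eq_integrable (integrableB measurableT (integrable_probability_cst P 1) (integrable_waveX n%:R^-1 wave_cos)).
have iq : P.-integrable setT (EFin \o q).
  by apply: eq_integrable (integrableZl measurableT (4 * n%:R ^+ 2) i1).
apply: (@le_trans _ _ (\int[P]_o (q o)%:E)%E).
  apply: (@le_trans _ _ (\int[P]_(o in [set o | (`|X o| <= n%:R)%R]) (q o)%:E)%E).
    apply: le_integral_nonmeasurable => o /= Xn; rewrite lee_fin ?sqr_ge0//.
    have h : `|n%:R^-1 * X o| <= 1.
      by rewrite normrM gtr0_norm ?invr_gt0// mulrC ler_pdivrMr// mul1r.
    have := ler_wpM2l (_ : 0 <= 4 * n%:R ^+ 2) (onem_cos_ge h).
    rewrite -/(q o) => /(_ _) h2; apply: le_trans (h2 _); last by rewrite mulr_ge0 ?sqr_ge0.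
    by rewrite le_eqVlt; apply/orP; left; apply/eqP; field.
  rewrite integral_mkcond; apply: le_integral_nonmeasurable => o _; rewrite patchE.
    by case: ifPn => _; rewrite ?lee_fin.
  by case: ifPn => _; rewrite ?lee_fin.
rewrite -[leLHS]fineK; last exact: (integrable_fin_num measurableT iq).
rewrite lee_fin -/(Rintegral _ _ _) RintegralZl//.
rewrite (RintegralB _ (integrable_probability_cst P 1) (integrable_waveX n%:R^-1 wave_cos))//.
rewrite Rintegral_probability_cst.
(* At frequency [1 / n] the factor [n ^ 2] of [q] cancels, which makes the bound independent of
   [n]. *)
have h := Xc n%:R^-1.
have h1 : 1 - \int[P]_o cos (n%:R^-1 * X o) <= c * n%:R^-1 ^+ 2 by lra.
apply: le_trans (ler_wpM2l _ h1) _; first by rewrite mulr_ge0 ?sqr_ge0.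
by rewrite le_eqVlt; apply/orP; left; apply/eqP; field.
Qed.

End second_moment.

(** * Uniform deviations over a frequency interval *)

Section deviation.
Context d (T : measurableType d) (R : realType) (P : probability T R).
Local Notation mu := (@lebesgue_measure R).
Variables (n : nat) (X : 'I_n -> {mfun T >-> R}).
Hypothesis indX : forall j k, j != k -> forall A B : set R, measurable A -> measurable B ->
  P (X j @^-1` A `&` X k @^-1` B) = (P (X j @^-1` A) * P (X k @^-1` B))%E.
Variable m2 : R.
Hypothesis X2 : forall j, (\int[P]_o (X j o ^+ 2)%:E <= m2%:E)%E.
Variables (c c' : R -> R) (H : R).
Hypothesis wc' : bounded_wave c'.
Hypothesis wc : bounded_wave c.
Hypothesis dc : forall x : R, is_derive x 1 c (c' x).
Hypothesis H0 : 0 < H.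

Let I : R -> R := \1_(`[0, H]%classic).
Let e j s := \int[P]_o (c' (s * X j o) * X j o).
(** The derivative in the frequency of the centred mean of [c (s * X j)], cut to [[0, H]]. The
    indicator turns integrals over [[0, H]] into integrals over the line, to which the Fubini lemmas
    apply. *)
Let D (z : T * R) := n%:R^-1 * \sum_(j < n)
  (I z.2 * (c' (z.2 * X j z.1) * X j z.1) - I z.2 * e j z.2).

Let iI : mu.-integrable setT (EFin \o I). Proof. exact: integrable_indic_itvcc. Qed.

Let mI : measurable_fun setT I.
Proof. by apply/measurable_EFinP; exact: (measurable_int mu iI). Qed.

Let intI : (\int[mu]_s (I s)%:E = H%:E)%E.
Proof.
rewrite integral_indic// setIT.
by apply: eq_trans (lebesgue_measure_itvcc (ltW H0)) _; rewrite subr0.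
Qed.

Let mk j : measurable_fun setT (fun z : T * R => c' (z.2 * X j z.1)).
Proof.
apply: (measurableT_comp (continuous_measurable_fun wc'.1)).
by apply: measurable_funM => //; exact: measurableT_comp.
Qed.

Let ie j : mu.-integrable setT (EFin \o (fun s => I s * e j s)).
Proof.
exact: (integrable_kernelr (integrable_rv X2 j) iI (mk j) (fun z => wc'.2 _)).
Qed.

Let mD : measurable_fun setT D.
Proof.
apply: measurable_funM => //; apply: measurable_sum => j.
apply: measurable_funB; last first.
  apply: (@measurableT_comp _ _ _ _ _ _ (fun s => I s * e j s)) => //.
  by apply/measurable_EFinP; exact: (measurable_int mu (ie j)).
apply: measurable_funM; first exact: measurableT_comp.
by apply: measurable_funM => //; exact: measurableT_comp.
Qed.

(* The squared L^2([0, H]) norm of the derivative of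
   [t |-> mean of (c (t * X j) - E (c (t * X j)))]; it controls the supremum of that function
   on [0, H] by Cauchy-Schwarz. *)
Definition deviation_energy o := (\int[mu]_s (D (o, s) ^+ 2)%:E)%E.

Lemma measurable_deviation_energy : measurable_fun setT deviation_energy.
Proof.
apply: (measurable_fun_fubini_tonelli_F (m2 := mu) (fun z => (D z ^+ 2)%:E)).
  by apply/measurable_EFinP; exact: measurable_funX.
by move=> z; rewrite lee_fin sqr_ge0.
Qed.

(** Tonelli's theorem reduces this to one frequency at a time, where [|c' (s * x) * x| <= |x|]
    allows the variance bound [m2 / n]. *)
Lemma integral_deviation_energy :
  (\int[P]_o deviation_energy o <= (H * m2 / n%:R)%:E)%E.
Proof.
rewrite /deviation_energy.
have mD2 : measurable_fun setT (fun z => (D z ^+ 2)%:E).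
  by apply/measurable_EFinP; exact: measurable_funX.
have D20 z : (0 <= (D z ^+ 2)%:E)%E by rewrite lee_fin sqr_ge0.
rewrite (fubini_tonelli (m1 := P) (m2 := mu) _ mD2 D20).
have m20 : 0 <= m2 / n%:R.
  case: n X X2 => [|k] Y Y2; first by rewrite invr0 mulr0.
  rewrite divr_ge0// -lee_fin; apply: le_trans (Y2 ord0).
  by apply: integral_ge0 => o _; rewrite lee_fin sqr_ge0.
apply: (@le_trans _ _ (\int[mu]_s ((m2 / n%:R)%:E * (I s)%:E))%E).
  apply: le_integral_nonmeasurable => s _; first exact: integral_ge0.
  have [sH|sH] := boolP (s \in (`[0, H]%classic : set R)); last first.
    have I0 : I s = 0 by rewrite /I indicE (negbTE sH).
    rewrite integral0_eq ?I0 ?mule0// => o _; rewrite /D/= I0 big1 ?mulr0 ?expr0n// => j _.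
    by rewrite !mul0r subrr.
  have I1 : I s = 1 by rewrite /I indicE sH.
  rewrite I1 mule1; have mg : measurable_fun setT (fun x : R => c' (s * x) * x).
    by apply: measurable_funM => //; exact: measurable_wave.
  have h x : `|c' (s * x) * x| <= `|x| by rewrite normrM ler_piMl// wc'.2.
  apply: le_trans (mean_centred_sqr indX X2 mg h).
  rewrite le_eqVlt; apply/orP; left; apply/eqP; apply: eq_integral => o _.
  congr (_ ^+ 2)%:E; rewrite /D/= I1; congr (_ * _); apply: eq_bigr => j _.
  by rewrite !mul1r.
rewrite ge0_integralZl//; last 2 first.
- exact/measurable_EFinP.
- by move=> s _; rewrite lee_fin /I indicE.
rewrite intI -EFinM lee_fin.
by rewrite le_eqVlt; apply/orP; left; apply/eqP; ring.
Qed.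

(** The centred mean vanishes at frequency 0, so it is the integral of its derivative over [[0, t]].
    Cauchy-Schwarz is applied in the form [|D| <= a / 2 + D ^ 2 / (2 * a)] on [[0, H]], where each
    term contributes at most [a * H / 2]. *)
Lemma deviation_bound o (a t : R) : 0 < a ->
  (deviation_energy o <= (H * a ^+ 2)%:E)%E -> 0 <= t <= H ->
  `|n%:R^-1 * \sum_(j < n) (c (t * X j o) - \int[P]_p c (t * X j p))| <= a * H.
Proof.
move=> a0 Eo /andP[t0 tH].
pose J : R -> R := \1_(`[0, t]%classic).
have iJ : mu.-integrable setT (EFin \o J) := integrable_indic_itvcc 0 t.
have mJ : measurable_fun setT J by apply/measurable_EFinP; exact: (measurable_int mu iJ).
have JI s : J s * I s = J s.
  rewrite /J /I !indicE !mem_set_itv !in_itv/=.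
  by case: (leP 0 s) => //= _; case: (leP s t) => [st|_]; rewrite ?mul0r// (le_trans st tH) mulr1.
have J01 s : 0 <= J s <= I s.
  rewrite -JI /J /I !indicE; case: (_ \in _); case: (_ \in _);
  by rewrite ?mulr1 ?mulr0 ?lexx ?ler01.
have iJw (x : R) : mu.-integrable setT (EFin \o (fun s => c' (s * x) * J s)).
  apply: (integrable_boundedM (c := 1) measurableT iJ) => [|s _]; last exact: wc'.2.
  by under eq_fun do rewrite mulrC; exact: measurable_wave.
have cwx (x : R) : continuous (fun s : R => c' (s * x)).
  have -> : (fun s => c' (s * x)) = (fun s => c' (x * s)).
    by apply/funext => s; rewrite mulrC.
  exact: wave_comp_continuous.
have FTCx (x : R) : c (t * x) - c 0 = x * \int[mu]_s (c' (s * x) * J s).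
  under eq_Rintegral do rewrite mulrC.
  rewrite Rintegral_indicM// -RintegralZl//; last first.
    apply: continuous_compact_integrable; first exact: segment_compact.
    exact: continuous_subspaceT.
  have dcx (s : R) : is_derive s 1 (fun s => c (x * s)) (x * c' (s * x)).
    apply: (is_derive_fun (is_derive_compf (dc _) (is_derive_scale x s))).
    by rewrite mulrC (mulrC s).
  have cx : continuous (fun s : R => x * c' (s * x)).
    by move=> s; apply: cvgM; [exact: cvg_cst|exact: cwx].
  by rewrite (Rintegral_itv_FTC t0 cx dcx) mulr0 (mulrC x).
have iJe j : mu.-integrable setT (EFin \o (fun s => J s * e j s)).
  exact: (integrable_kernelr (integrable_rv X2 j) iJ (mk j) (fun z => wc'.2 _)).
(* Differentiation under the expectation, in integrated form: the two integrals are exchanged. *)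
have EFTC j : \int[P]_p c (t * X j p) - c 0 = \int[mu]_s (J s * e j s).
  rewrite -(Rintegral_kernelC (integrable_rv X2 j) iJ (mk j) (fun z => wc'.2 _)).
  under [RHS]eq_Rintegral do rewrite /= -FTCx.
  rewrite (RintegralB _ (integrable_waveX P (X j) t wc) (integrable_probability_cst P (c 0)))//.
  by rewrite Rintegral_probability_cst.
have iJX j : mu.-integrable setT (EFin \o (fun s => X j o * (c' (s * X j o) * J s))).
  by apply: eq_integrable (integrableZl measurableT (X j o) (iJw (X j o))).
have iJd j : mu.-integrable setT (EFin \o
    (fun s => X j o * (c' (s * X j o) * J s) - J s * e j s)).
  by apply: eq_integrable (integrableB measurableT (iJX j) (iJe j)).
have JD s : J s * D (o, s) = n%:R^-1 * \sum_(j < n)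
    (X j o * (c' (s * X j o) * J s) - J s * e j s).
  rewrite /D/= mulrCA mulr_sumr; congr (_ * _); apply: eq_bigr => j _.
  by rewrite mulrBr !mulrA JI; congr (_ - _); ring.
have iJD : mu.-integrable setT (EFin \o (fun s => J s * D (o, s))).
  apply: eq_integrable (integrableZl measurableT n%:R^-1 (integrable_sumf (index_enum _) iJd)) => //.
  by move=> s _; rewrite /= JD.
have -> : n%:R^-1 * \sum_(j < n) (c (t * X j o) - \int[P]_p c (t * X j p)) =
    \int[mu]_s (J s * D (o, s)).
  under [RHS]eq_Rintegral do rewrite JD.
  rewrite RintegralZl//; last exact: integrable_sumf.
  rewrite Rintegral_sum//; congr (_ * _); apply: eq_bigr => j _.
  rewrite (RintegralB _ (iJX j) (iJe j))// RintegralZl// -FTCx -EFTC; ring.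
have mDo : measurable_fun setT (fun s => D (o, s)).
  exact: (measurableT_comp mD (measurable_pair1 _)).
have iD2 : mu.-integrable setT (EFin \o (fun s => D (o, s) ^+ 2)).
  apply/integrableP; split.
    by apply/measurable_EFinP; exact: measurable_funX.
  under eq_integral do rewrite /= ger0_norm ?sqr_ge0//.
  exact: le_lt_trans Eo (ltry _).
have i1 : mu.-integrable setT (EFin \o (fun s => a / 2 * I s)).
  by apply: eq_integrable (integrableZl measurableT (a / 2) iI).
have i2 : mu.-integrable setT (EFin \o (fun s => (2 * a)^-1 * D (o, s) ^+ 2)).
  by apply: eq_integrable (integrableZl measurableT (2 * a)^-1 iD2).
apply: le_trans (le_normr_Rintegral measurableT iJD) _.
apply: (@le_trans _ _ (\int[mu]_s (a / 2 * I s + (2 * a)^-1 * D (o, s) ^+ 2))).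
  apply: le_Rintegral => //; first exact: (integrable_norm iJD).
    by apply: eq_integrable (integrableD measurableT i1 i2).
  move=> s _; rewrite normrM.
  have /andP[J0 JI1] := J01 s; rewrite (ger0_norm J0).
  have [I0 I1] : 0 <= I s /\ I s * I s = I s.
    by rewrite /I indicE; case: (_ \in _); rewrite ?mulr1 ?mulr0.
  apply: (@le_trans _ _ (I s * `|D (o, s)|)); first exact: ler_wpM2r.
  have a2 : 0 <= (2 * a)^-1 by rewrite invr_ge0 mulr_ge0// ltW.
  have := mulr_ge0 a2 (sqr_ge0 (a * I s - `|D (o, s)|)).
  rewrite sqrrB real_normK ?num_real// exprMn (expr2 (I s)) I1.
  rewrite -[X in _ - X + _]mulr_natl.
  have -> : (2 * a)^-1 * (a ^+ 2 * I s - 2 * (a * I s * `|D (o, s)|) + D (o, s) ^+ 2) =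
    a / 2 * I s + (2 * a)^-1 * D (o, s) ^+ 2 - I s * `|D (o, s)|.
    by field; rewrite gt_eqF.
  by rewrite subr_ge0.
rewrite (RintegralD _ i1 i2)// !RintegralZl//.
have -> : \int[mu]_s I s = H.
  by rewrite /Rintegral intI.
have ED : \int[mu]_s (D (o, s) ^+ 2) <= H * a ^+ 2.
  by rewrite -lee_fin fineK//; exact: (integrable_fin_num measurableT iD2).
have a2 : 0 <= (2 * a)^-1 by rewrite invr_ge0 mulr_ge0// ltW.
have := ler_wpM2l a2 ED.
have -> : (2 * a)^-1 * (H * a ^+ 2) = a * H / 2 by field; rewrite gt_eqF.
lra.
Qed.

End deviation.

(** * The distinguished logarithm *)

Section complex_topology.
Local Open Scope complex_scope.
Context {R : realType}.
Local Notation C := (R[i] : numFieldType).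

Lemma normC_normc (z : C) : `|z| = (Normc.normc z)%:C.
Proof. by case: z. Qed.

Lemma normr_Re_le (z : R[i]) : `|complex.Re z| <= Normc.normc z.
Proof.
case: z => x y /=; rewrite -sqrtr_sqr ler_sqrt ?addr_ge0 ?sqr_ge0//.
by rewrite lerDl sqr_ge0.
Qed.

Lemma normr_Im_le (z : R[i]) : `|complex.Im z| <= Normc.normc z.
Proof.
case: z => x y /=; rewrite -sqrtr_sqr ler_sqrt ?addr_ge0 ?sqr_ge0//.
by rewrite lerDr sqr_ge0.
Qed.

Lemma continuous_Re : continuous (@complex.Re R : C -> R).
Proof.
move=> z; apply/(@cvgrPdist_lt _ _ _ (nbhs z)) => e e0.
have e0C : 0 < e%:C :> C by rewrite ltcR.
near=> w; have : `|z - w| < e%:C by near: w; exact: (@nbhsx_ballx _ C z _ e0C).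
rewrite normC_normc ltcR; apply: le_lt_trans.
have -> : complex.Re z - complex.Re w = complex.Re (z - w) by case: (z) (w) => [? ?] [? ?].
exact: normr_Re_le.
Unshelve. all: by end_near. Qed.

Lemma continuous_Im : continuous (@complex.Im R : C -> R).
Proof.
move=> z; apply/(@cvgrPdist_lt _ _ _ (nbhs z)) => e e0.
have e0C : 0 < e%:C :> C by rewrite ltcR.
near=> w; have : `|z - w| < e%:C by near: w; exact: (@nbhsx_ballx _ C z _ e0C).
rewrite normC_normc ltcR; apply: le_lt_trans.
have -> : complex.Im z - complex.Im w = complex.Im (z - w) by case: (z) (w) => [? ?] [? ?].
exact: normr_Im_le.
Unshelve. all: by end_near. Qed.

Lemma continuous_real_complex : continuous (fun x : R => x%:C : C).
Proof.
move=> x; apply/cvgrPdist_lt => /= e e0.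
have eE : e = (complex.Re e)%:C.
  by rewrite RRe_real// gtr0_real.
have e1 : 0 < complex.Re e by move: e0; rewrite {1}eE ltcR.
near=> y; rewrite eE -rmorphB/= normC_normc normc_real ltcR.
by near: y; exact: (@nbhsx_ballx _ R x _ e1).
Unshelve. all: by end_near. Qed.

Lemma continuous_complexP (D : set R) (g : R -> R[i]) :
  {within D, continuous (g : R -> C)} <->
  {within D, continuous (fun t => complex.Re (g t))} /\
  {within D, continuous (fun t => complex.Im (g t))}.
Proof.
split=> [cg|[cr ci]].
  split; apply: (@within_continuous_comp _ _ _ _ _ _ _ cg) => z _.
    exact: continuous_Re.
  exact: continuous_Im.
have -> : g = (fun t => (complex.Re (g t))%:C + 'i * (complex.Im (g t))%:C).
  by apply/funext => t; case: (g t) => x y; simpc.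
move=> t; apply: cvgD.
  exact: (continuous_cvg _ (@continuous_real_complex _) (cr t)).
apply: cvgM; first exact: cvg_cst.
exact: (continuous_cvg _ (@continuous_real_complex _) (ci t)).
Qed.

End complex_topology.

Section distinguished_logarithm.
Local Open Scope complex_scope.
Context {R : realType}.

Lemma expCE (z : R[i]) :
  expC z = (expR (complex.Re z) * cos (complex.Im z)) +i*
           (expR (complex.Re z) * sin (complex.Im z)).
Proof. by rewrite /expC; simpc. Qed.

Lemma normc_expC (z : R[i]) : Normc.normc (expC z) = expR (complex.Re z).
Proof.
rewrite expCE /= !exprMn -mulrDr cos2Dsin2 mulr1 sqrtr_sqr.
by rewrite ger0_norm// expR_ge0.
Qed.

(* A continuous function with values in [2 pi Z] that vanishes at [0]. *)
Lemma angle_unique_ge0 (d : R -> R) (t : R) : 0 <= t ->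
  {within `[0, t], continuous d} ->
  (forall s, s \in `[0, t] -> cos (d s) = 1) -> d 0 = 0 -> d t = 0.
Proof.
move=> t0 cd cos1 d0; apply/eqP; rewrite -normr_eq0; apply/eqP.
have cosn s : s \in `[0, t] -> cos `|d s| = 1.
  by move=> st; case: (ger0P (d s)) => _; rewrite ?cosN cos1.
have tt : t \in `[0, t] by rewrite in_itv/= lexx t0.
have [dlt|pid] := ltP `|d t| pi.
  apply: (@cos_inj R); rewrite ?in_itv/= ?normr_ge0 ?(ltW dlt) ?lexx ?pi_ge0//.
  by rewrite cosn// cos0.
have cnd : {within `[0, t], continuous (fun s => `|d s|)}.
  by apply: (@within_continuous_comp _ _ _ _ _ (fun x : R => `|x|) _ cd) => x _; exact: norm_continuous.
(* If [|d t| >= pi], then [|d|] takes the value [pi] on the way, where the cosine is -1. *)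
have [|s st ds] := IVT t0 cnd (v := pi).
  by rewrite d0 normr0 minEle normr_ge0 maxEle normr_ge0 pi_ge0.
have := cosn s st; rewrite ds cospi; lra.
Qed.

(** The modulus determines the real part. The difference of the imaginary parts has cosine 1
    throughout and vanishes at 0, so [angle_unique_ge0] applies on either side of 0. *)
Lemma distinguished_log_unique (a : R) (phi g1 g2 : R -> R[i]) : 0 <= a ->
  is_distinguished_log a phi g1 -> is_distinguished_log a phi g2 ->
  forall t, t \in `[- a, a] -> g1 t = g2 t.
Proof.
move=> a0 [/continuous_complexP[cr1 ci1] e1 g10] [/continuous_complexP[cr2 ci2] e2 g20].
have ReE t : t \in `[- a, a] -> complex.Re (g1 t) = complex.Re (g2 t).
  by move=> ta; apply: expR_inj; rewrite -!normc_expC e1// e2.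
pose d t := complex.Im (g1 t) - complex.Im (g2 t).
have cd : {within `[- a, a], continuous d}.
  by move=> t; apply: cvgB; [exact: ci1|exact: ci2].
have cosd t : t \in `[- a, a] -> cos (d t) = 1.
  move=> ta; have := e1 t ta; rewrite -e2// !expCE ReE// => -[].
  have h : expR (complex.Re (g2 t)) != 0 by rewrite gt_eqF// expR_gt0.
  move=> /(mulfI h) hc /(mulfI h) hs.
  by rewrite /d cosB hc hs -!expr2 cos2Dsin2.
have d0 : d 0 = 0 by rewrite /d g10 g20 subrr.
move=> t ta; have dt : d t = 0.
  have := ta; rewrite in_itv/= => /andP[at_ ta'].
  have [t0|t0] := leP 0 t.
    apply: angle_unique_ge0 => //.
      apply: continuous_subspaceW cd => s /=; rewrite !in_itv/= => /andP[s0 st].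
      by rewrite (le_trans _ s0) ?oppr_le0// (le_trans st).
    move=> s; rewrite in_itv/= => /andP[s0 st]; apply: cosd.
    by rewrite in_itv/= (le_trans _ s0) ?oppr_le0// (le_trans st).
  have := @angle_unique_ge0 (d \o -%R) (- t); rewrite /= opprK oppr0; apply => //.
  - by rewrite oppr_ge0 ltW.
  - have cdN : {within `[- a, a], continuous d \o -%R}.
      by apply: within_continuous_compN; rewrite opprK.
    apply: continuous_subspaceW cdN => s /=; rewrite !in_itv/= => /andP[s0 st].
    by rewrite (le_trans _ s0) ?oppr_le0// (le_trans st)// lerNl.
  - move=> s; rewrite in_itv/= => /andP[s0 st]; apply: cosd.
    rewrite in_itv/= lerN2; apply/andP; split; last by rewrite (le_trans _ a0)// oppr_le0.
    by apply: le_trans st _; rewrite lerNl.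
have ImE : complex.Im (g1 t) = complex.Im (g2 t) by apply/eqP; rewrite -subr_eq0; apply/eqP.
by apply/eqP; rewrite eq_complex ReE// ImE !eqxx.
Qed.

Lemma Log_eq_in (a : R) (phi1 phi2 : R -> R[i]) :
  (forall t, t \in `[- a, a] -> phi1 t = phi2 t) -> Log a phi1 = Log a phi2.
Proof.
move=> e; rewrite /Log; congr (xget _ _); apply/seteqP; split => g [cg eg g0]; split => // t ta.
  by rewrite eg// e.
by rewrite eg// e.
Qed.

Lemma LogP (a : R) (phi : R -> R[i]) :
  is_distinguished_log a phi (Log a phi) \/ Log a phi = cst 0.
Proof. by rewrite /Log; case: xgetP => [g -> h|_]; [left|right]. Qed.

(** The default value 0 makes this true even when no logarithm exists; hence truncated logarithms
    are integrable in the frequency for every sample. *)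
Lemma Log_continuous (a : R) (phi : R -> R[i]) :
  {within `[- a, a], continuous (fun t => complex.Re (Log a phi t))} /\
  {within `[- a, a], continuous (fun t => complex.Im (Log a phi t))}.
Proof.
case: (LogP a phi) => [[/continuous_complexP cg _ _]//|->].
by split; apply: continuous_subspaceT => t; exact: cvg_cst.
Qed.

End distinguished_logarithm.

(** * Stability of the distinguished logarithm under relative perturbation *)

Section logarithm_perturbation.
Local Open Scope complex_scope.
Context {R : realType}.
Local Notation mu := (@lebesgue_measure R).

Lemma normr_atan_le (x : R) : `|atan x| <= `|x|.
Proof.
wlog x0 : x / 0 <= x.
  move=> h; have [/h//|x0] := leP 0 x.
  by rewrite -normrN -atanN -(normrN x) h// oppr_ge0 ltW.
have cf : continuous (fun y : R => (1 + y ^+ 2)^-1) by exact: continuous_oneDsqrV.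
have atanE : atan x = \int[mu]_(s in `[0, x]) (1 + s ^+ 2)^-1.
  by rewrite (Rintegral_itv_FTC x0 cf (@is_derive1_atan R)) atan0 subr0.
have h : x = \int[mu]_(s in `[0, x]) (1 : R).
  by rewrite Rintegral_cst//= lebesgue_measure_itvcc//= subr0 mul1r.
have p0 (s : R) : 0 <= (1 + s ^+ 2)^-1 by rewrite invr_ge0 addr_ge0 ?sqr_ge0.
rewrite (ger0_norm x0) ger0_norm; last by rewrite atanE; exact: Rintegral_ge0.
rewrite atanE [leRHS]h; apply: le_Rintegral => //.
- apply: continuous_compact_integrable; first exact: segment_compact.
  exact: continuous_subspaceT.
- apply: continuous_compact_integrable; first exact: segment_compact.
  by apply: continuous_subspaceT => ?; apply: cvg_cst.
- by move=> s _; rewrite invf_le1 ?lerDl ?sqr_ge0// ltr_pwDl ?sqr_ge0.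
Qed.

Lemma normr_ln_le (x : R) : `|x - 1| <= 2^-1 -> `|ln x| <= 2 * `|x - 1|.
Proof.
move=> h; have /andP[h1 h2] : - 2^-1 <= x - 1 <= 2^-1 by rewrite -ler_norml.
have x0 : 0 < x by lra.
have up (y : R) : 0 < y -> ln y <= y - 1.
  move=> y0; have := @le_ln1Dx R (y - 1).
  by rewrite (_ : 1 + (y - 1) = y); [apply; lra|ring].
have lo : - ln x <= 2 * `|x - 1|.
  rewrite -lnV ?posrE//; apply: le_trans (up _ _) _; first by rewrite invr_gt0.
  have -> : x^-1 - 1 = - (x - 1) / x by field; rewrite gt_eqF.
  rewrite ler_pdivrMr//; apply: (@le_trans _ _ `|x - 1|).
    by rewrite -normrN ler_norm.
  by rewrite -mulrA mulrCA ler_peMr//; lra.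
rewrite ler_norml; apply/andP; split; first by lra.
apply: le_trans (up _ x0) _; apply: le_trans (ler_norm _) _.
have := normr_ge0 (x - 1); lra.
Qed.

Variables (T delta : R) (pr pm psir psii : R -> R).
Hypothesis T0 : 0 <= T.
(** With this bound the quotient of the two functions keeps its real part above [1 / 2], and
    [6 * delta <= 1 / 2] stays in the range of [normr_ln_le]. *)
Hypothesis delta_itv : 0 <= delta <= 12^-1.
Hypotheses (cpr : continuous pr) (cpm : continuous pm)
  (cpsir : continuous psir) (cpsii : continuous psii).
Hypotheses (pr0 : pr 0 = 1) (pm0 : pm 0 = 0) (psir0 : psir 0 = 0) (psii0 : psii 0 = 0).
Hypothesis pr_close : forall t, t \in `[- T, T] ->
  `|pr t - expR (psir t) * cos (psii t)| <= delta * expR (psir t).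
Hypothesis pm_close : forall t, t \in `[- T, T] ->
  `|pm t - expR (psir t) * sin (psii t)| <= delta * expR (psir t).

Let p t : R[i] := pr t +i* pm t.

(* [u + i v] is the quotient of [p] by [exp (psir + i psii)], which is close
   to [1], so that its principal logarithm is small. *)
Let u t := expR (- psir t) * (pr t * cos (psii t) + pm t * sin (psii t)).
Let v t := expR (- psir t) * (pm t * cos (psii t) - pr t * sin (psii t)).

Let expNr t : expR (- psir t) * expR (psir t) = 1.
Proof. by rewrite -expRD addNr expR0. Qed.

Let bound2 (t a b c s : R) : `|a| <= delta * expR (psir t) -> `|b| <= delta * expR (psir t) ->
  `|c| <= 1 -> `|s| <= 1 -> `|expR (- psir t) * (a * c + b * s)| <= 2 * delta.
Proof.
move=> ha hb c1 s1; rewrite normrM (ger0_norm (expR_ge0 _)).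
have -> : 2 * delta = expR (- psir t) * (delta * expR (psir t) + delta * expR (psir t)).
  transitivity (2 * delta * (expR (- psir t) * expR (psir t))); last by ring.
  by rewrite expNr mulr1.
rewrite ler_wpM2l ?expR_ge0//; apply: le_trans (ler_normD _ _) _.
rewrite !normrM; apply: lerD; [apply: le_trans ha|apply: le_trans hb];
by rewrite ler_piMr.
Qed.

Let u_close t : t \in `[- T, T] -> `|u t - 1| <= 2 * delta.
Proof.
move=> tT.
have -> : u t - 1 = expR (- psir t) * ((pr t - expR (psir t) * cos (psii t)) * cos (psii t)
    + (pm t - expR (psir t) * sin (psii t)) * sin (psii t)).
  rewrite /u !mulrBl addrACA -opprD -!mulrA -mulrDr -!expr2 cos2Dsin2 mulr1.
  by rewrite mulrBr expNr.
by apply: bound2; [exact: pr_close|exact: pm_close|exact: norm_cos_le1|exact: norm_sin_le1].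
Qed.

Let v_close t : t \in `[- T, T] -> `|v t| <= 2 * delta.
Proof.
move=> tT.
have -> : v t = expR (- psir t) * ((pm t - expR (psir t) * sin (psii t)) * cos (psii t)
    + (pr t - expR (psir t) * cos (psii t)) * - sin (psii t)).
  rewrite /v; congr (_ * _); ring.
apply: bound2; [exact: pm_close|exact: pr_close|exact: norm_cos_le1|].
by rewrite normrN norm_sin_le1.
Qed.

Let u_gt0 t : t \in `[- T, T] -> 2^-1 <= u t.
Proof.
move=> tT; have := u_close tT; rewrite ler_norml => /andP[h _].
by move/andP: delta_itv => [_ d]; lra.
Qed.

(** The candidate logarithm: the principal logarithm of [u + i v] is added to [psir + i psii]. Its
    argument is [atan (v / u)] because [u > 0]. *)
Let gr t := psir t + 2^-1 * ln (u t ^+ 2 + v t ^+ 2).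
Let gi t := psii t + atan (v t / u t).

Let n2_gt0 t : t \in `[- T, T] -> 0 < u t ^+ 2 + v t ^+ 2.
Proof.
move=> tT; have := u_gt0 tT => hu.
by rewrite ltr_pwDl ?sqr_ge0// exprn_gt0// (lt_le_trans _ hu).
Qed.

Let gr_close t : t \in `[- T, T] -> `|gr t - psir t| <= 6 * delta.
Proof.
move=> tT; have hu := u_close tT; have hv := v_close tT.
move/andP: delta_itv => [d0 d1].
(* Both [|u - 1|] and [|v|] are at most [2 * delta <= 1 / 6]: the linear term costs [4 * delta] and
   each square [delta / 3]. The factor 2 of [normr_ln_le] cancels the [1 / 2] in [gr]. *)
have h : `|u t ^+ 2 + v t ^+ 2 - 1| <= 6 * delta.
  have -> : u t ^+ 2 + v t ^+ 2 - 1 = (u t - 1) * (u t - 1) + 2 * (u t - 1) + v t * v t by ring.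
  apply: le_trans (ler_normD _ _) _; rewrite normrM.
  apply: le_trans (lerD (ler_normD _ _) (lexx _)) _; rewrite (normrM 2) (normrM (u t - 1)) (@ger0_norm _ 2)//.
  have := normr_ge0 (u t - 1); have := normr_ge0 (v t).
  move: (`|u t - 1|) (`|v t|) hu hv => a b ha hb b0 a0.
  have ha2 : a * a <= a * 6^-1 by rewrite ler_wpM2l//; lra.
  have hb2 : b * b <= b * 6^-1 by rewrite ler_wpM2l//; lra.
  lra.
rewrite /gr addrC addKr normrM ger0_norm//.
have h2 : 6 * delta <= 2^-1 by lra.
have := normr_ln_le (le_trans h h2); lra.
Qed.

Let gi_close t : t \in `[- T, T] -> `|gi t - psii t| <= 6 * delta.
Proof.
move=> tT; have hu := u_gt0 tT; have hv := v_close tT.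
move/andP: delta_itv => [d0 d1].
rewrite /gi addrC addKr; apply: le_trans (normr_atan_le _) _.
have u0 : 0 < u t by lra.
rewrite normrM normfV (gtr0_norm u0) ler_pdivrMr//.
have : 0 <= delta * (u t - 2^-1) by rewrite mulr_ge0// subr_ge0.
by move=> hd; apply: le_trans hv _; lra.
Qed.

Let cu : continuous u.
Proof.
move=> t; apply: cvgM.
  by apply: (continuous_cvg _ (@continuous_expR R _)); apply: cvgN; exact: cpsir.
apply: cvgD; apply: cvgM; [exact: cpr| |exact: cpm|].
  by apply: (continuous_cvg _ (@continuous_cos R _)); exact: cpsii.
by apply: (continuous_cvg _ (@continuous_sin R _)); exact: cpsii.
Qed.

Let cv : continuous v.
Proof.
move=> t; apply: cvgM.
  by apply: (continuous_cvg _ (@continuous_expR R _)); apply: cvgN; exact: cpsir.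
apply: cvgB; apply: cvgM; [exact: cpm| |exact: cpr|].
  by apply: (continuous_cvg _ (@continuous_cos R _)); exact: cpsii.
by apply: (continuous_cvg _ (@continuous_sin R _)); exact: cpsii.
Qed.

Let dlog : is_distinguished_log T p (fun t => gr t +i* gi t).
Proof.
split.
- apply/continuous_complexP; split => /=; apply: continuous_in_subspaceT => t.
    rewrite inE/= => tT; apply: cvgD; first exact: cpsir.
    apply: cvgM; first exact: cvg_cst.
    apply: (continuous_cvg _ (continuous_ln (n2_gt0 tT))).
    by apply: cvgD; rewrite !expr2; apply: cvgM; (exact: cu || exact: cv).
  rewrite inE/= => tT; apply: cvgD; first exact: cpsii.
  apply: (continuous_cvg _ (@continuous_atan R _)); apply: cvgM; first exact: cv.
  by apply: cvgV; [rewrite gt_eqF// (lt_le_trans _ (u_gt0 tT))|exact: cu].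
- move=> t tT; rewrite expCE/=.
  have u0 : 0 < u t by rewrite (lt_le_trans _ (u_gt0 tT)).
  have n0 := n2_gt0 tT.
  pose r := Num.sqrt (u t ^+ 2 + v t ^+ 2).
  have r0 : 0 < r by rewrite sqrtr_gt0.
  have r2 : r ^+ 2 = u t ^+ 2 + v t ^+ 2 by rewrite sqr_sqrtr// ltW.
  have Er : expR (2^-1 * ln (u t ^+ 2 + v t ^+ 2)) = r.
    apply/eqP; rewrite -(@eqrXn2 _ 2)// ?expR_ge0 ?(ltW r0)//; apply/eqP.
    rewrite r2 -expRM_natl -[RHS]lnK ?posrE//; congr expR.
    by rewrite -mulr_natl mulrA mulfV// mul1r.
  have cosE : cos (atan (v t / u t)) = u t / r.
    rewrite cos_atan -[RHS]invrK; congr (_^-1); rewrite invf_div.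
    have ru : 0 <= r / u t by rewrite divr_ge0// ltW.
    rewrite -[RHS](ger0_norm ru) -sqrtr_sqr; congr (Num.sqrt _).
    by rewrite !expr_div_n r2; field; rewrite gt_eqF.
  have sinE : sin (atan (v t / u t)) = v t / r.
    have c0 : cos (atan (v t / u t)) != 0 by rewrite cosE mulf_neq0 ?invr_eq0 ?gt_eqF.
    have := atanK (v t / u t); rewrite /tan => /(congr1 ( *%R^~ (cos (atan (v t / u t))))).
    by rewrite mulfVK// => ->; rewrite cosE; field; rewrite !gt_eqF.
  rewrite /gr expRD Er /gi cosD sinD cosE sinE.
  have eE : expR (psir t) * expR (- psir t) = 1 by rewrite mulrC.
  have cs := cos2Dsin2 (psii t).
  congr (_ +i* _).
    transitivity (expR (psir t) * (u t * cos (psii t) - v t * sin (psii t))).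
      by field; rewrite gt_eqF.
    transitivity (expR (psir t) * expR (- psir t) * (pr t * (cos (psii t) ^+ 2 + sin (psii t) ^+ 2))).
      by rewrite /u /v; ring.
    by rewrite eE cs mul1r mulr1.
  transitivity (expR (psir t) * (u t * sin (psii t) + v t * cos (psii t))).
    by field; rewrite gt_eqF.
  transitivity (expR (psir t) * expR (- psir t) * (pm t * (cos (psii t) ^+ 2 + sin (psii t) ^+ 2))).
    by rewrite /u /v; ring.
  by rewrite eE cs mul1r mulr1.
- rewrite /gr /gi /u /v pr0 pm0 psir0 psii0 oppr0 expR0 cos0 sin0.
  have -> : (1 * (1 * 1 + 0 * 0) : R) = 1 by ring.
  have -> : (1 * (0 * 1 - 1 * 0) : R) = 0 by ring.
  by rewrite expr1n expr0n addr0 ln1 mulr0 mul0r atan0 addr0.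
Qed.

(** The explicit candidate shows that [xget] does return a distinguished logarithm, and uniqueness
    identifies it with the candidate on the window. A function with a logarithm cannot vanish
    there. *)
Lemma Log_close :
  [/\ nonvanishing T p, is_distinguished_log T p (Log T p) &
  forall t, t \in `[- T, T] -> `|complex.Re (Log T p t) - psir t| <= 6 * delta /\
    `|complex.Im (Log T p t) - psii t| <= 6 * delta].
Proof.
have dL : is_distinguished_log T p (Log T p).
  by case: (xgetPex (cst 0) (ex_intro _ _ dlog)) => *; split.
split=> // [t tT|t tT].
  case: dlog => _ <- // _; apply/eqP => /(congr1 (@Normc.normc R)).
  by rewrite normc_expC Normc.normc0 => /eqP; rewrite gt_eqF// expR_gt0.
rewrite (distinguished_log_unique T0 dL dlog tT)/=; split; [exact: gr_close|exact: gi_close].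
Qed.

End logarithm_perturbation.

(** * The model and the estimator *)

Section model_facts.
Local Open Scope complex_scope.
Context {R : realType}.
Local Notation mu := (@lebesgue_measure R).

Lemma expC_itE (t x : R) : expC ('i * (t * x)%:C) = cos (t * x) +i* sin (t * x).
Proof.
have -> : 'i * (t * x)%:C = 0 +i* (t * x) :> R[i] by simpc.
by rewrite expCE/= expR0 !mul1r.
Qed.

Lemma expC_NitE (t x : R) : expC (- 'i * (t * x)%:C) = cos (t * x) -i* sin (t * x).
Proof.
have -> : - 'i * (t * x)%:C = 0 +i* (- (t * x)) :> R[i] by simpc.
by rewrite expCE/= expR0 !mul1r cosN sinN.
Qed.

Lemma phi_empE n (x : 'I_n -> R) (t : R) : phi_emp x t =
  (n%:R^-1 * \sum_(j < n) cos (t * x j)) +i* (n%:R^-1 * \sum_(j < n) sin (t * x j)).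
Proof.
rewrite /phi_emp.
have -> : \sum_(j < n) expC ('i * (t * x j)%:C) =
    (\sum_(j < n) cos (t * x j)) +i* (\sum_(j < n) sin (t * x j)).
  elim/big_ind3: _ => [|a b c a' b' c' -> ->|j _]; last exact: expC_itE.
    by [].
  by simpc.
by simpc.
Qed.

Lemma charfunE d (T : measurableType d) (P : probability T R) (X : {mfun T >-> R}) (t : R) :
  charfun (P := P) X t = (\int[P]_o cos (t * X o)) +i* (\int[P]_o sin (t * X o)).
Proof.
rewrite /charfun /cintegral; congr (_ +i* _); apply: eq_Rintegral => o _;
by rewrite expC_itE.
Qed.

Section symmetric_density.
Variables (lambda : R) (f : R -> R).
Hypothesis densf : is_probability_density f.
Hypothesis evenf : forall x, f (- x) = f x.

Let mf : measurable_fun setT f. Proof. by case: densf. Qed.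
Let fi := integrable_density densf.

(** The sine transform of [f] vanishes, so the phase is exactly linear in [t] and the branch of the
    logarithm is explicit. *)
Lemma phiX_even (gamma sigma t : R) :
  phiX gamma sigma (fun x => lambda * f x) t =
  expC ((- (2^-1 * sigma ^+ 2 * t ^+ 2) + lambda * (trigT cos f t - 1)) +i* (gamma * t)).
Proof.
have f1 : \int[mu]_x f x = 1 by rewrite /Rintegral; case: densf => _ _ ->.
have ic := integrable_wave t wave_cos fi.
have is_ := integrable_wave t wave_sin fi.
have Re : \int[mu]_x complex.Re ((expC ('i * (t * x)%:C) - 1) * (lambda * f x)%:C) =
    lambda * (trigT cos f t - 1).
  rewrite -f1 /trigT -RintegralB// -RintegralZl//; last first.
    by apply: eq_integrable (integrableB measurableT ic fi).
  by apply: eq_Rintegral => x _; rewrite expC_itE; simpc => /=; ring.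
have Im : \int[mu]_x complex.Im ((expC ('i * (t * x)%:C) - 1) * (lambda * f x)%:C) = 0.
  rewrite -[RHS](mulr0 lambda) -(trigT_sin_even t mf evenf) /trigT -RintegralZl//.
  by apply: eq_Rintegral => x _; rewrite expC_itE; simpc => /=; ring.
rewrite /phiX /cintegral Re Im; congr expC.
by simpc; rewrite addrC.
Qed.

End symmetric_density.

Section exponent.
Variables (K gamma sigma lambda : R) (f : R -> R).
Hypothesis densf : is_probability_density f.
Hypothesis fK : (\int[mu]_x (x ^+ 2 * f x)%:E <= K%:E)%E.
Hypothesis lambda0 : 0 <= lambda.

(* [log |phi_X|], the exponent of [phi_X] being [log_modulus t + i gamma t] for even [rho]. *)
Definition log_modulus (t : R) : R :=
  - (2^-1 * sigma ^+ 2 * t ^+ 2) + lambda * (trigT cos f t - 1).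

Lemma continuous_log_modulus : continuous log_modulus.
Proof.
move=> t; apply: cvgD.
  apply: cvgN; apply: cvgM; first exact: cvg_cst.
  by rewrite expr2; under eq_fun do rewrite expr2; apply: cvgM; exact: cvg_id.
apply: cvgM; first exact: cvg_cst.
by apply: cvgB; [exact: (continuous_phi densf)|exact: cvg_cst].
Qed.

Lemma log_modulusN t : log_modulus (- t) = log_modulus t.
Proof. by rewrite /log_modulus sqrrN trigT_cosN. Qed.

Lemma log_modulus0 : log_modulus 0 = 0.
Proof.
rewrite /log_modulus expr0n/= mulr0 oppr0 add0r.
have -> : trigT cos f 0 = 1.
  transitivity (\int[mu]_x f x).
    by apply: eq_Rintegral => x _; rewrite mul0r cos0 mul1r.
  by rewrite /Rintegral; case: densf => _ _ ->.
by rewrite subrr mulr0.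
Qed.

Lemma log_modulus_le0 t : log_modulus t <= 0.
Proof.
have /andP[_ h] : -1 <= trigT cos f t <= 1 by rewrite -ler_norml; exact: norm_phi_le1.
have h2 : 0 <= sigma ^+ 2 * t ^+ 2 by rewrite mulr_ge0 ?sqr_ge0.
have h3 : 0 <= lambda * (1 - trigT cos f t) by rewrite mulr_ge0// subr_ge0.
rewrite /log_modulus; lra.
Qed.

Lemma log_modulus_ge t : - (2^-1 * sigma ^+ 2 * t ^+ 2 + 2 * lambda) <= log_modulus t.
Proof.
have /andP[h _] : -1 <= trigT cos f t <= 1 by rewrite -ler_norml; exact: norm_phi_le1.
have h3 : 0 <= lambda * (1 + trigT cos f t) by rewrite mulr_ge0//; lra.
rewrite /log_modulus; lra.
Qed.

(** The quadratic bound near 0 that [second_moment_le] asks for, from [1 + y <= exp y] and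
    [1 - cos y <= y ^ 2 / 2], with [K] controlling the jumps. *)
Lemma onem_expR_cos_le t :
  1 - (sigma ^+ 2 + lambda * K + gamma ^+ 2) / 2 * t ^+ 2 <=
  expR (log_modulus t) * cos (gamma * t).
Proof.
have h1 := expR_ge1Dx (log_modulus t).
have h2 := onem_cos_le (gamma * t).
have h3 : expR (log_modulus t) <= 1 by rewrite -expR0 ler_expR log_modulus_le0.
have h4 : 0 <= 1 - cos (gamma * t) by rewrite subr_ge0 cos_le1.
have h5 := ler_wpM2l lambda0 (onem_phi_le densf fK t).
have h6 : expR (log_modulus t) * (1 - cos (gamma * t)) <= (gamma * t) ^+ 2 / 2.
  by apply: le_trans h2; rewrite ler_piMl.
move: h1 h6; rewrite exprMn {1}/log_modulus; lra.
Qed.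

End exponent.

Section empirical_characteristic_function.
Context d (T : measurableType d) (P : probability T R).
Variables (n : nat) (X : 'I_n -> {mfun T >-> R}).
Hypothesis n0 : (0 < n)%N.
Variables (m2 H : R) (psir psii : R -> R).
Hypothesis X2 : forall j, (\int[P]_o (X j o ^+ 2)%:E <= m2%:E)%E.
Hypothesis H0 : 0 < H.
Hypothesis psirN : forall t, psir (- t) = psir t.
Hypothesis psiiN : forall t, psii (- t) = - psii t.
Hypothesis XE : forall j t, charfun (P := P) (X j) t = expC (psir t +i* psii t).

Lemma empirical_charfun_close (o : T) (a : R) : 0 < a ->
  (deviation_energy P X sin H o <= (H * a ^+ 2)%:E)%E ->
  (deviation_energy P X cos H o <= (H * a ^+ 2)%:E)%E ->
  forall t, t \in `[- H, H] ->
  `|n%:R^-1 * \sum_(j < n) cos (t * X j o) - expR (psir t) * cos (psii t)| <= a * H /\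
  `|n%:R^-1 * \sum_(j < n) sin (t * X j o) - expR (psir t) * sin (psii t)| <= a * H.
Proof.
move=> a0 Es Ec.
have EXcs j t : \int[P]_p cos (t * X j p) = expR (psir t) * cos (psii t) /\
    \int[P]_p sin (t * X j p) = expR (psir t) * sin (psii t).
  by have := XE j t; rewrite charfunE expCE/= => -[-> ->].
have EXc j t := (EXcs j t).1; have EXs j t := (EXcs j t).2.
have nR : n%:R != 0 :> R by rewrite pnatr_eq0 -lt0n.
have centre (F : 'I_n -> R) (b : R) :
    n%:R^-1 * \sum_(j < n) (F j - b) = n%:R^-1 * \sum_(j < n) F j - b.
  rewrite sumrB mulrBr sumr_const card_ord -[b *+ n]mulr_natl; congr (_ - _).
  by rewrite mulrA mulVf// mul1r.
have pos t : 0 <= t <= H ->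
  `|n%:R^-1 * \sum_(j < n) cos (t * X j o) - expR (psir t) * cos (psii t)| <= a * H /\
  `|n%:R^-1 * \sum_(j < n) sin (t * X j o) - expR (psir t) * sin (psii t)| <= a * H.
  move=> tH.
  (* [deviation_energy] is indexed by the derivative: with [- cos] as primitive of [sin], the energy
     of [sin] controls the cosine mean and that of [cos] the sine mean. *)
  have wN : bounded_wave (fun x : R => - cos x).
    split=> [x|x]; last by rewrite normrN norm_cos_le1.
    by apply: cvgN; exact: continuous_cos.
  have dN (x : R) : is_derive x 1 (fun x : R => - cos x) (sin x).
    by apply: (is_derive_fun (is_deriveN (is_derive_cos x))); rewrite opprK.
  have hs := deviation_bound X2 wave_cos wave_sin (@is_derive_sin R) H0 a0 Ec tH.
  have hc := deviation_bound X2 wave_sin wN dN H0 a0 Es tH.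
  split; last first.
    by move: hs; under eq_bigr do rewrite EXs; rewrite centre.
  move: hc; rewrite -normrN -mulrN -sumrN.
  rewrite (eq_bigr (fun j => cos (t * X j o) - expR (psir t) * cos (psii t))) ?centre// => j _.
  have -> : \int[P]_p (- cos (t * X j p)) = - \int[P]_p cos (t * X j p).
    rewrite -mulN1r -RintegralZl//; last exact: (integrable_waveX P (X j) t wave_cos).
    by apply: eq_Rintegral => p _; rewrite mulN1r.
  by rewrite EXc; ring.
move=> t; rewrite in_itv/= => /andP[t1 t2].
have [t0|t0] := leP 0 t; first by apply: pos; rewrite t0.
have [] := pos (- t); first by rewrite oppr_ge0 ltW//= lerNl.
rewrite psirN psiiN cosN sinN.
have -> : \sum_(j < n) cos (- t * X j o) = \sum_(j < n) cos (t * X j o).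
  by apply: eq_bigr => j _; rewrite mulNr cosN.
have -> : \sum_(j < n) sin (- t * X j o) = - \sum_(j < n) sin (t * X j o).
  by rewrite -sumrN; apply: eq_bigr => j _; rewrite mulNr sinN.
by rewrite !mulrN -opprD normrN => -> ->.
Qed.

End empirical_characteristic_function.
End model_facts.

(** * Kernel statistics of a logarithm close to a quadratic plus a smooth bias *)

Section kernel_estimates.
Context {R : realType}.
Local Notation mu := (@lebesgue_measure R).

Lemma Rintegral_itv_scale (G : R -> R) (T : R) : 0 < T -> continuous G ->
  \int[mu]_(t in `[- T, T]) G (T^-1 * t) = T * \int[mu]_(s in `[- 1, 1]) G s.
Proof.
move=> T0 cG; pose F (t : R) := T^-1 * t.
have Ti0 : 0 < T^-1 by rewrite invr_gt0.
have dF (t : R) : is_derive t 1 F T^-1 by exact: is_derive_scale.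
have dFE : F^`()%classic = cst T^-1.
  by apply/funext => t; rewrite derive1E; case: (dF t).
have cF : continuous F by exact: mulrl_continuous.
have iG a b : mu.-integrable `[a, b] (EFin \o G).
  apply: continuous_compact_integrable; first exact: segment_compact.
  exact: continuous_subspaceT.
have FT : F T = 1 by rewrite /F mulVf// gt_eqF.
have FNT : F (- T) = - 1 by rewrite /F mulrN mulVf// gt_eqF.
have sub : (\int[mu]_(s in `[(- 1)%R, 1%R]) (G s)%:E =
    \int[mu]_(t in `[(- T)%R, T]) (G (T^-1 * t) * T^-1)%:E)%E.
  have := @integration_by_substitution_increasing R F G (- T) T.
  rewrite FT FNT dFE; apply.
  - by lra.
  - by move=> x y _ _ xy; rewrite /F ltr_pM2l.
  - by move=> x _; exact: cvg_cst.
  - exact: is_cvg_cst.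
  - exact: is_cvg_cst.
  - split; first by move=> x _; case: (dF x).
      by apply: cvg_at_right_filter; exact: cF.
    by apply: cvg_at_left_filter; exact: cF.
  - exact: continuous_subspaceT.
have iGF : mu.-integrable `[- T, T] (EFin \o (fun t => G (T^-1 * t))).
  apply: continuous_compact_integrable; first exact: segment_compact.
  apply: continuous_subspaceT => t.
  by apply: continuous_comp; [exact: cF|exact: cG].
rewrite [in RHS]/Rintegral sub -/(Rintegral _ _ _) RintegralZr//.
by rewrite mulrCA mulfV ?mulr1// gt_eqF.
Qed.

(** The behaviour at 0 is only local. Where [|s| >= r], the bound [B] is at most [B / r^beta] times
    [|s|^beta], which makes it global. *)
Lemma kernel_bounds (beta : R) (q : R -> R) : 0 < beta -> is_kernel beta q ->
  (exists2 B : R, 0 < B & forall s, `|q s| <= B) /\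
  (exists2 k : R, 0 < k & forall s, `|q s| <= k * `|s| `^ beta).
Proof.
move=> beta0 [cq q0 /eqO_exP[k0 k00 /nbhs_ballP[r /= r0 nk]]].
have [B B0 qB] : exists2 B, 0 < B & forall s, `|q s| <= B.
  have cn : {within `[- 1, 1], continuous (fun s => `|q s|)}.
    apply: continuous_subspaceT => s.
    by apply: continuous_comp; [exact: cq|exact: norm_continuous].
  have [|c _ cm] := EVT_max _ cn; first by lra.
  exists (`|q c| + 1); first by rewrite ltr_pwDr.
  move=> s; have [s1|s1] := leP `|s| 1; last by rewrite q0// normr0 addr_ge0.
  by rewrite (le_trans (cm s _)) ?lerDl// in_itv/= -ler_norml.
split; first by exists B.
exists (Num.max k0 (B / r `^ beta)); first by rewrite lt_max k00.
move=> s; have [sr|rs] := ltP `|s| r.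
  have := nk s; rewrite /ball/= sub0r normrN => /(_ sr).
  rewrite (ger0_norm (powR_ge0 _ _)) => h; apply: le_trans h _.
  by rewrite ler_wpM2r ?powR_ge0// le_max lexx.
apply: le_trans (qB s) _.
apply: (@le_trans _ _ (B / r `^ beta * `|s| `^ beta)); last first.
  by rewrite ler_wpM2r ?powR_ge0// le_max lexx orbT.
rewrite -mulrA ler_peMr ?(ltW B0)// mulrC ler_pdivlMr ?powR_gt0// mul1r.
by apply: ge0_ler_powR => //; rewrite ?nnegrE//; exact: ltW.
Qed.

Lemma continuous_itv_integrable (a b : R) (g : R -> R) :
  {within `[a, b], continuous g} -> mu.-integrable `[a, b] (EFin \o g).
Proof. by move=> cg; apply: continuous_compact_integrable => //; exact: segment_compact. Qed.

Variables (beta L B k T e Lambda lambda A0 A1 A2 : R) (phi q l : R -> R) (p : nat).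
Hypotheses (beta0 : 0 < beta) (T0 : 0 < T) (B0 : 0 <= B) (k0 : 0 <= k).
Hypothesis lambda_itv : 0 <= lambda <= Lambda.
Hypothesis cphi : continuous phi.
Hypothesis iphi : mu.-integrable setT (EFin \o (fun t => `|t| `^ beta * `|phi t|)).
Hypothesis phiL : \int[mu]_t (`|t| `^ beta * `|phi t|) <= L.
Hypothesis cq : continuous q.
Hypothesis qB : forall s, `|q s| <= B.
Hypothesis qk : forall s, `|q s| <= k * `|s| `^ beta.
Hypothesis cl : {within `[- T, T], continuous l}.
Hypothesis l_close : forall t, t \in `[- T, T] ->
  `|l t - (A2 * t ^+ 2 + A1 * t + A0 + lambda * phi t)| <= e.

Let h := T^-1.
Let m i := \int[mu]_(s in `[- 1, 1]) (s ^+ i * q s).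

Let cqh : continuous (fun t => q (h * t)).
Proof. by move=> t; apply: continuous_comp; [exact: mulrl_continuous|exact: cq]. Qed.

Let cX i : continuous (fun t : R => t ^+ i). Proof. exact: exprn_continuous. Qed.

Let iXq (i : nat) : mu.-integrable `[- T, T] (EFin \o (fun t => t ^+ i * q (h * t))).
Proof.
apply: continuous_itv_integrable; apply: continuous_subspaceT => t.
by apply: cvgM; [exact: cX|exact: cqh].
Qed.

Let moment (i : nat) : \int[mu]_(t in `[- T, T]) (t ^+ i * q (h * t)) = T ^+ i.+1 * m i.
Proof.
have cG : continuous (fun s : R => T ^+ i * (s ^+ i * q s)).
  move=> t; apply: cvgM; first exact: cvg_cst.
  by apply: cvgM; [exact: cX|exact: cq].
have iq1 : mu.-integrable `[- 1, 1] (EFin \o (fun s => s ^+ i * q s)).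
  apply: continuous_itv_integrable; apply: continuous_subspaceT => t.
  by apply: cvgM; [exact: cX|exact: cq].
transitivity (T * \int[mu]_(s in `[- 1, 1]) (T ^+ i * (s ^+ i * q s))).
  rewrite -(Rintegral_itv_scale T0 cG); apply: eq_Rintegral => t _.
  by rewrite mulrA -exprMn mulrA mulfV ?mul1r// gt_eqF.
by rewrite RintegralZl// exprS mulrA.
Qed.

Let iphiq : mu.-integrable `[- T, T] (EFin \o (fun t => phi t * q (h * t))).
Proof.
apply: continuous_itv_integrable; apply: continuous_subspaceT => t.
by apply: cvgM; [exact: cphi|exact: cqh].
Qed.

Let h0 : 0 < h. Proof. by rewrite invr_gt0. Qed.

Let bias : `|\int[mu]_(t in `[- T, T]) (phi t * q (h * t))| <= k * h `^ beta * L.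
Proof.
apply: le_trans (le_normr_Rintegral _ iphiq) _ => //.
pose g t := k * h `^ beta * (`|t| `^ beta * `|phi t|).
have ig : mu.-integrable setT (EFin \o g).
  by apply: eq_integrable (integrableZl measurableT (k * h `^ beta) iphi).
have g0 t : 0 <= g t.
  by rewrite /g; apply: mulr_ge0; apply: mulr_ge0 => //; exact: powR_ge0.
apply: (@le_trans _ _ (\int[mu]_t g t)); last first.
  rewrite RintegralZl// ler_wpM2l//; apply: mulr_ge0 => //; exact: powR_ge0.
rewrite -lee_fin fineK; last first.
  exact: (integrable_fin_num _ (integrable_norm iphiq)).
rewrite fineK; last exact: (integrable_fin_num measurableT ig).
rewrite integral_mkcond; apply: le_integral_nonmeasurable => t _; rewrite patchE.
  by case: ifPn => _; rewrite ?lee_fin.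
case: ifPn => _; rewrite lee_fin//.
rewrite normrM /g mulrC; apply: le_trans (ler_wpM2r (normr_ge0 _) (qk _)) _.
rewrite normrM (gtr0_norm h0) powRM ?(ltW h0)//.
by rewrite le_eqVlt; apply/orP; left; apply/eqP; ring.
Qed.

(** Common to the three preliminary estimators: [p] is 3 for [v], 1 for [u] and 2 for [w], with [l]
    the real or imaginary part of the logarithm. The moments of [q] treat the polynomial exactly;
    what remains is [e] over a window of length [2 * T] and the bias due to [phi]. *)
Lemma kernel_statistic : `|\int[mu]_(t in `[- T, T]) (l t * (h ^+ p * q (h * t))) -
    h ^+ p * (A2 * (T ^+ 3 * m 2) + A1 * (T ^+ 2 * m 1) + A0 * (T * m 0))| <=
  h ^+ p * (e * B * (2 * T) + Lambda * (k * h `^ beta * L)).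
Proof.
pose psi t := A2 * t ^+ 2 + A1 * t + A0 + lambda * phi t.
have cpsi : continuous psi.
  move=> t; apply: cvgD; last by apply: cvgM; [exact: cvg_cst|exact: cphi].
  apply: cvgD; last exact: cvg_cst.
  apply: cvgD; apply: cvgM; (try exact: cvg_cst); [exact: cX|exact: cvg_id].
have i1 : mu.-integrable `[- T, T] (EFin \o (fun t => (l t - psi t) * q (h * t))).
  apply: continuous_itv_integrable => t; apply: cvgM.
    by apply: cvgB; [exact: cl|exact: continuous_subspaceT].
  exact: (continuous_subspaceT cqh).
have i2 : mu.-integrable `[- T, T] (EFin \o (fun t => psi t * q (h * t))).
  apply: continuous_itv_integrable; apply: continuous_subspaceT => t.
  by apply: cvgM; [exact: cpsi|exact: cqh].
have i12 : mu.-integrable `[- T, T] (EFin \o (fun t => (l t - psi t) * q (h * t) + psi t * q (h * t))).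
  by apply: eq_integrable (integrableD _ i1 i2).
have -> : \int[mu]_(t in `[- T, T]) (l t * (h ^+ p * q (h * t))) =
    h ^+ p * (\int[mu]_(t in `[- T, T]) ((l t - psi t) * q (h * t)) +
              \int[mu]_(t in `[- T, T]) (psi t * q (h * t))).
  rewrite -RintegralD// -RintegralZl//; apply: eq_Rintegral => t _; ring.
have iA (a : R) i : mu.-integrable `[- T, T] (EFin \o (fun t => a * (t ^+ i * q (h * t)))).
  by apply: eq_integrable (integrableZl _ a (iXq i)).
have iP : mu.-integrable `[- T, T] (EFin \o (fun t => lambda * (phi t * q (h * t)))).
  by apply: eq_integrable (integrableZl _ lambda iphiq).
have i21 : mu.-integrable `[- T, T] (EFin \o (fun t => A2 * (t ^+ 2 * q (h * t)) + A1 * (t ^+ 1 * q (h * t)))).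
  by apply: eq_integrable (integrableD _ (iA A2 2) (iA A1 1)).
have i210 : mu.-integrable `[- T, T] (EFin \o (fun t => A2 * (t ^+ 2 * q (h * t)) +
    A1 * (t ^+ 1 * q (h * t)) + A0 * (t ^+ 0 * q (h * t)))).
  by apply: eq_integrable (integrableD _ i21 (iA A0 0)).
have -> : \int[mu]_(t in `[- T, T]) (psi t * q (h * t)) =
    A2 * (T ^+ 3 * m 2) + A1 * (T ^+ 2 * m 1) + A0 * (T * m 0) +
    lambda * \int[mu]_(t in `[- T, T]) (phi t * q (h * t)).
  rewrite -[T in T * m 0]expr1 -!moment -!RintegralZl// -!RintegralD//.
  by apply: eq_Rintegral => t _; rewrite /psi expr1 expr0; ring.
set I1 := \int[mu]_(t in _) _; set I2 := \int[mu]_(t in _) _.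
have -> : h ^+ p * (I1 + (A2 * (T ^+ 3 * m 2) + A1 * (T ^+ 2 * m 1) + A0 * (T * m 0) + lambda * I2)) -
    h ^+ p * (A2 * (T ^+ 3 * m 2) + A1 * (T ^+ 2 * m 1) + A0 * (T * m 0)) =
    h ^+ p * (I1 + lambda * I2) by ring.
rewrite normrM (ger0_norm (exprn_ge0 _ (ltW h0))) ler_wpM2l ?exprn_ge0 ?(ltW h0)//.
apply: le_trans (ler_normD _ _) _; apply: lerD.
  have TNT : - T <= T by rewrite (le_trans _ (ltW T0))// oppr_le0 ltW.
  have mT : mu `[- T, T] = (2 * T)%:E.
    by rewrite lebesgue_measure_itvcc//; congr EFin; ring.
  have e0 : 0 <= e.
    by apply: le_trans (normr_ge0 _) (l_close (t := 0) _); rewrite in_itv/= oppr_le0 ltW.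
  have -> : 2 * T = fine (mu `[- T, T]) by rewrite mT.
  apply: Rintegral_le_bound => //.
  - by rewrite [X in (X < _)%E]mT ltry.
  - by rewrite mulr_ge0.
  - by move=> t tT; rewrite normrM ler_pM//; exact: l_close.
move/andP: lambda_itv => [l0 lL].
by rewrite normrM (ger0_norm l0) ler_pM.
Qed.

End kernel_estimates.

(** * Integrated squared error in terms of the spectral error *)

Section fourier_risk.
Local Open Scope complex_scope.
Context {R : realType}.
Local Notation mu := (@lebesgue_measure R).

Lemma trigT_patch (c g : R -> R) (D : set R) (y : R) :
  trigT c (g \_ D) y = \int[mu]_(t in D) (c (y * t) * g t).
Proof.
rewrite /trigT [RHS]Rintegral_mkcond; apply: eq_Rintegral => t _.
by rewrite !patchE; case: ifPn => // _; rewrite mulr0.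
Qed.

Lemma inv_fourierE (h : R) (g : R -> R) (y : R) :
  inv_fourier h g y = ((2 * pi)^-1 * trigT cos (g \_ `[- h^-1, h^-1]) y) +i*
    ((2 * pi)^-1 * trigT (fun x => - sin x) (g \_ `[- h^-1, h^-1]) y).
Proof.
rewrite /inv_fourier /cintegral !trigT_patch.
have -> : \int[mu]_(t in `[- h^-1, h^-1])
    complex.Re (expC (- 'i * (t * y)%:C) * (g t)%:C) =
    \int[mu]_(t in `[- h^-1, h^-1]) (cos (y * t) * g t).
  by apply: eq_Rintegral => t _; rewrite expC_NitE; simpc => /=; rewrite (mulrC t).
have -> : \int[mu]_(t in `[- h^-1, h^-1])
    complex.Im (expC (- 'i * (t * y)%:C) * (g t)%:C) =
    \int[mu]_(t in `[- h^-1, h^-1]) (- sin (y * t) * g t).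
  by apply: eq_Rintegral => t _; rewrite expC_NitE; simpc => /=; rewrite (mulrC t).
by simpc.
Qed.

Lemma integrable_patch (D : set R) (g : R -> R) : measurable D ->
  mu.-integrable D (EFin \o g) -> mu.-integrable setT (EFin \o (g \_ D)).
Proof.
by move=> mD ig; rewrite -restrict_EFin; apply/integrable_restrict => //=; rewrite setTI.
Qed.

Lemma trigTD (c q1 q2 : R -> R) (y : R) : bounded_wave c ->
  mu.-integrable setT (EFin \o q1) -> mu.-integrable setT (EFin \o q2) ->
  trigT c (fun t => q1 t + q2 t) y = trigT c q1 y + trigT c q2 y.
Proof.
move=> wc i1 i2; rewrite /trigT -RintegralD//; try exact: integrable_wave.
by apply: eq_Rintegral => t _; rewrite mulrDr.
Qed.

Lemma trigTZ (c q : R -> R) (a y : R) : bounded_wave c ->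
  mu.-integrable setT (EFin \o q) ->
  trigT c (fun t => a * q t) y = a * trigT c q y.
Proof.
move=> wc iq; rewrite /trigT -RintegralZl//; last exact: integrable_wave.
by apply: eq_Rintegral => t _; rewrite mulrCA.
Qed.

Lemma trigT_Nsin (q : R -> R) (y : R) : mu.-integrable setT (EFin \o q) ->
  trigT (fun x => - sin x) q y = - trigT sin q y.
Proof.
move=> iq; rewrite -mulN1r /trigT -RintegralZl//; last first.
  exact: (integrable_wave y wave_sin iq).
by apply: eq_Rintegral => t _; rewrite mulN1r mulNr.
Qed.

Section estimator.
Variables (h a b c : R) (r s : R -> R).
Let D : set R := `[- h^-1, h^-1]%classic.
Hypotheses (cr : {within D, continuous r}) (cs : {within D, continuous s}).

(* [rho_hat] is the inverse Fourier transform of [spectral_Re + i spectral_Im], an estimate of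
   the real function [lambda phi_f]. *)
Definition spectral_Re : R -> R := (fun t => b + c * t ^+ 2 + r t) \_ D.
Definition spectral_Im : R -> R := (fun t => s t - a * t) \_ D.

Let mD : measurable D. Proof. exact: measurable_itv. Qed.

Let iD (g : R -> R) : {within D, continuous g} -> mu.-integrable setT (EFin \o (g \_ D)).
Proof. by move=> cg; apply: integrable_patch => //; exact: continuous_itv_integrable. Qed.

Let i1 : mu.-integrable setT (EFin \o ((cst (1 : R) : R -> R) \_ D)).
Proof. by apply: iD; apply: continuous_subspaceT => t; exact: cvg_cst. Qed.

Let i_id : mu.-integrable setT (EFin \o ((id : R -> R) \_ D)).
Proof. by apply: iD; apply: continuous_subspaceT => t; exact: cvg_id. Qed.

Let i2 : mu.-integrable setT (EFin \o ((fun t : R => t ^+ 2) \_ D)).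
Proof. by apply: iD; apply: continuous_subspaceT; exact: exprn_continuous. Qed.

Let ir := iD cr.
Let is_ := iD cs.

Let ReE t : spectral_Re t =
  b * ((cst (1 : R) : R -> R) \_ D) t + (c * ((fun t : R => t ^+ 2) \_ D) t + (r \_ D) t).
Proof.
by rewrite /spectral_Re !patchE; case: ifPn => _ /=; rewrite ?mulr0 ?addr0// mulr1 addrA.
Qed.

Let ImE t : spectral_Im t = (s \_ D) t + (- a) * ((id : R -> R) \_ D) t.
Proof.
by rewrite /spectral_Im !patchE; case: ifPn => _ /=; rewrite ?mulr0 ?addr0// mulNr.
Qed.

Let iZ (g : R -> R) (z : R) : mu.-integrable setT (EFin \o g) ->
  mu.-integrable setT (EFin \o (fun t => z * g t)).
Proof. by move=> ig; apply: eq_integrable (integrableZl measurableT z ig). Qed.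

Let iAdd (g1 g2 : R -> R) : mu.-integrable setT (EFin \o g1) ->
  mu.-integrable setT (EFin \o g2) ->
  mu.-integrable setT (EFin \o (fun t => g1 t + g2 t)).
Proof. by move=> ig1 ig2; apply: eq_integrable (integrableD measurableT ig1 ig2). Qed.

Lemma integrable_spectral_Re : mu.-integrable setT (EFin \o spectral_Re).
Proof.
rewrite (funext ReE).
exact: (iAdd (iZ b i1) (iAdd (iZ c i2) ir)).
Qed.

Lemma integrable_spectral_Im : mu.-integrable setT (EFin \o spectral_Im).
Proof.
rewrite (funext ImE).
exact: (iAdd is_ (iZ (- a) i_id)).
Qed.

Let trigRe w y : bounded_wave w -> trigT w spectral_Re y =
  b * trigT w ((cst (1 : R) : R -> R) \_ D) y + (c * trigT w ((fun t : R => t ^+ 2) \_ D) y + trigT w (r \_ D) y).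
Proof.
move=> ww; rewrite (funext ReE).
rewrite (trigTD _ ww (iZ b i1) (iAdd (iZ c i2) ir)) (trigTZ _ _ ww i1).
by rewrite (trigTD _ ww (iZ c i2) ir) (trigTZ _ _ ww i2).
Qed.

Let trigIm w y : bounded_wave w -> trigT w spectral_Im y =
  trigT w (s \_ D) y + (- a) * trigT w ((id : R -> R) \_ D) y.
Proof.
move=> ww; rewrite (funext ImE).
by rewrite (trigTD _ ww is_ (iZ (- a) i_id)) (trigTZ _ _ ww i_id).
Qed.

Lemma fourier_estimatorE (y : R) :
  - 'i * a%:C * inv_fourier h id y + b%:C * inv_fourier h (cst 1) y
  + c%:C * inv_fourier h (fun t => t ^+ 2) y
  + inv_fourier h r y + 'i * inv_fourier h s y =
  ((2 * pi)^-1 * (trigT cos spectral_Re y + trigT sin spectral_Im y)) +i*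
  ((2 * pi)^-1 * (trigT cos spectral_Im y - trigT sin spectral_Re y)).
Proof.
rewrite !inv_fourierE !trigT_Nsin// !trigRe ?trigIm//;
  try exact: wave_cos; try exact: wave_sin.
rewrite -/D; simpc; congr (_ +i* _); ring.
Qed.

End estimator.

Section risk.
Variables (lambda : R) (f GR GI : R -> R).
Hypothesis densf : is_probability_density f.
Hypothesis evenf : forall x, f (- x) = f x.
Local Notation phi := (trigT cos f).
Hypothesis iphi : mu.-integrable setT (EFin \o phi).
Hypothesis iGR : mu.-integrable setT (EFin \o GR).
Hypothesis iGI : mu.-integrable setT (EFin \o GI).

(** Almost everywhere [lambda * f] is the inverse transform of [lambda * phi], so the error is the
    inverse transform of [q + i GI] with [q = GR - lambda * phi]. Separating [q] from [GI] costs a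
    factor 2, and [2 * (2 pi)^-2 * 2 pi] is [1 / pi]. *)
Lemma fourier_risk_le :
  (\int[mu]_y ((Normc.normc
     ((((2 * pi)^-1 * (trigT cos GR y + trigT sin GI y)) +i*
       ((2 * pi)^-1 * (trigT cos GI y - trigT sin GR y))) - (lambda * f y)%:C)) ^+ 2)%:E
   <= (pi^-1)%:E * (\int[mu]_t ((GR t - lambda * phi t) ^+ 2)%:E +
       \int[mu]_t (GI t ^+ 2)%:E))%E.
Proof.
have mf : measurable_fun setT f by case: densf.
have fi := integrable_density densf.
have s0 t : trigT sin f t = 0 by exact: trigT_sin_even.
pose q t := GR t - lambda * phi t.
have il : mu.-integrable setT (EFin \o (fun t => - lambda * phi t)).
  by apply: eq_integrable (integrableZl measurableT (- lambda) iphi).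
have iq : mu.-integrable setT (EFin \o q).
  apply: eq_integrable (integrableD measurableT iGR il) => // t _ /=.
  by rewrite /q mulNr.
have qE : q = (fun t => GR t + - lambda * phi t) by apply/funext => t; rewrite mulNr.
have Cq y : trigT cos q y = trigT cos GR y - lambda * trigT cos phi y.
  by rewrite qE trigTD// ?trigTZ ?mulNr//; exact: wave_cos.
have Sq y : trigT sin q y = trigT sin GR y.
  rewrite qE trigTD ?trigTZ//; try exact: wave_sin.
  rewrite (@trigT_sin_even _ phi) ?mulr0 ?addr0//.
    by apply/measurable_EFinP; exact: (measurable_int mu).
  by move=> t; exact: trigT_cosN.
have pi0 : pi != 0 :> R by rewrite gt_eqF// pi_gt0.
pose F y := (trigT cos q y ^+ 2 + trigT sin q y ^+ 2) +
  (trigT cos GI y ^+ 2 + trigT sin GI y ^+ 2).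
have mtr c g : bounded_wave c -> mu.-integrable setT (EFin \o g) ->
    measurable_fun setT (trigT c g) by move=> *; exact: measurable_trigT.
have m2tr g : mu.-integrable setT (EFin \o g) ->
    measurable_fun setT (fun y => (trigT cos g y ^+ 2 + trigT sin g y ^+ 2)%:E).
  move=> ig; apply/measurable_EFinP; apply: measurable_funD; apply: measurable_funX.
    exact: (mtr _ _ wave_cos).
  exact: (mtr _ _ wave_sin).
have normcE y : (Normc.normc ((((2 * pi)^-1 * (trigT cos GR y + trigT sin GI y)) +i*
    ((2 * pi)^-1 * (trigT cos GI y - trigT sin GR y))) - (lambda * f y)%:C)) ^+ 2 =
    ((2 * pi)^-1 * (trigT cos GR y + trigT sin GI y) - lambda * f y) ^+ 2 +
    ((2 * pi)^-1 * (trigT cos GI y - trigT sin GR y)) ^+ 2.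
  by simpc => /=; rewrite sqr_sqrtr// addr_ge0 ?sqr_ge0.
under eq_integral do rewrite normcE.
apply: (@le_trans _ _ (\int[mu]_y ((2 * (2 * pi) ^- 2)%:E * (F y)%:E))%E).
  apply: ae_ge0_le_integral => //.
  - by move=> y _; rewrite lee_fin addr_ge0 ?sqr_ge0.
  - apply/measurable_EFinP; apply: measurable_funD; apply: measurable_funX.
      apply: measurable_funB; last exact: measurable_funM.
      apply: measurable_funM => //; apply: measurable_funD.
        exact: (mtr _ _ wave_cos).
      exact: (mtr _ _ wave_sin).
    apply: measurable_funM => //; apply: measurable_funB.
      exact: (mtr _ _ wave_cos).
    exact: (mtr _ _ wave_sin).
  - move=> y _; rewrite -EFinM lee_fin mulr_ge0//.
      by rewrite mulr_ge0// invr_ge0 sqr_ge0.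
    by rewrite !addr_ge0 ?sqr_ge0.
  - apply: emeasurable_funM => //.
    have := emeasurable_funD (m2tr _ iq) (m2tr _ iGI).
    by apply: eq_measurable_fun.
  apply: (@filterS _ _ (ae_filter_ringOfSetsType mu) _ _ _ (fourier_inversion_ae fi s0 iphi)).
  move=> y fE _; rewrite -EFinM lee_fin /F Cq Sq {1}fE.
  set A := trigT cos GR y; set B := trigT cos phi y; set E := trigT sin GI y.
  set G := trigT cos GI y; set H := trigT sin GR y.
  have -> : (2 * pi)^-1 * (A + E) - lambda * ((2 * pi)^-1 * B) =
    (2 * pi)^-1 * ((A - lambda * B) + E) by ring.
  rewrite -exprVn; move: (A - lambda * B) ((2 * pi)^-1) => Q z.
  (* The squares of [Q - E] and [G + H] are exactly the gap in [(Q + E)^2 + (G - H)^2 <= 2 (Q^2 +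
     E^2 + G^2 + H^2)]. *)
  have := mulr_ge0 (sqr_ge0 z) (addr_ge0 (sqr_ge0 (Q - E)) (sqr_ge0 (G + H))).
  rewrite !expr2; lra.
rewrite ge0_integralZl//; last 3 first.
- have := emeasurable_funD (m2tr _ iq) (m2tr _ iGI).
  by apply: eq_measurable_fun.
- by move=> y _; rewrite lee_fin !addr_ge0 ?sqr_ge0.
- by rewrite lee_fin mulr_ge0// invr_ge0 sqr_ge0.
under eq_integral do rewrite EFinD.
rewrite ge0_integralD//; last 4 first.
- by move=> y _; rewrite lee_fin addr_ge0 ?sqr_ge0.
- exact: m2tr.
- by move=> y _; rewrite lee_fin addr_ge0 ?sqr_ge0.
- exact: m2tr.
have pq := plancherel_le iq; have pG := plancherel_le iGI.
have q0 : (0 <= \int[mu]_s (q s ^+ 2)%:E)%E.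
  by apply: integral_ge0 => t _; rewrite lee_fin sqr_ge0.
have G0 : (0 <= \int[mu]_s (GI s ^+ 2)%:E)%E.
  by apply: integral_ge0 => t _; rewrite lee_fin sqr_ge0.
apply: (@le_trans _ _ ((2 * (2 * pi) ^- 2)%:E * ((2 * pi)%:E *
  (\int[mu]_s (q s ^+ 2)%:E + \int[mu]_s (GI s ^+ 2)%:E)))%E).
  apply: lee_wpmul2l; first by rewrite lee_fin mulr_ge0// invr_ge0 sqr_ge0.
  by rewrite ge0_muleDr// leeD.
rewrite muleA -EFinM (_ : 2 * (2 * pi) ^- 2 * (2 * pi) = pi^-1)//.
have id (x : R) : x != 0 -> 2 * (2 * x) ^- 2 * (2 * x) = x^-1 by move=> x0; field.
exact: id pi0.
Qed.

End risk.
End fourier_risk.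

Section truncation.
Context {R : realType}.
Variable M : R.

Lemma truncE (r : R) : trunc M r%:E = Num.max (Num.min M r) (- M).
Proof. by rewrite /trunc -EFin_min -EFin_max. Qed.

Lemma normr_trunc_le (y : \bar R) : 0 <= M -> `|trunc M y| <= M.
Proof.
move=> M0; case: y => [r| |].
- rewrite truncE ler_norml le_max lexx orbT/= ge_max ge_min lexx/=.
  by rewrite (le_trans _ M0)// oppr_le0.
- rewrite /trunc (min_idPl (leey M%:E)) -EFin_max/= ger0_norm ?le_max ?M0//.
  by rewrite ge_max lexx (le_trans _ M0)// oppr_le0.
- by rewrite /trunc (min_idPr (leNye M%:E)) (max_idPr (leNye (- M)%:E))/= normrN ger0_norm.
Qed.

Lemma trunc_id (r : R) : `|r| <= M -> trunc M r%:E = r.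
Proof.
rewrite ler_norml => /andP[h1 h2]; rewrite truncE.
by rewrite (min_idPr h2) (max_idPl h1).
Qed.

Lemma continuous_trunc : continuous (fun r : R => trunc M r%:E).
Proof.
have -> : (fun r : R => trunc M r%:E) = ((cst M \min id) \max cst (- M)).
  by apply/funext => r; rewrite truncE.
move=> x; apply: (@continuous_max R R); last exact: cvg_cst.
by apply: (@continuous_min R R); [exact: cvg_cst|exact: cvg_id].
Qed.

End truncation.

Section estimator_bounds.
Local Open Scope complex_scope.
Context {R : realType}.
Local Notation mu := (@lebesgue_measure R).
Variables (n : nat) (x : 'I_n -> R) (T M : R).
Let h := T^-1.
Hypothesis T0 : 0 < T.

(** [phi_k (h * t)] is 1 on the whole window, endpoints included, so the sinc kernel leaves the
    logarithm unchanged. *)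
Lemma phi_emp_kE t : t \in `[- T, T] -> phi_emp_k h x t = phi_emp x t.
Proof.
rewrite in_itv/= => tT; rewrite /phi_emp_k /phi_k indicE mem_set ?mulr1//=.
by rewrite in_itv/= -ler_norml normrM gtr0_norm ?invr_gt0// mulrC ler_pdivrMr// mul1r ler_norml.
Qed.

Lemma Log_phi_emp_k : Log T (phi_emp_k h x) = Log T (phi_emp x).
Proof. by apply: Log_eq_in => t tT; rewrite phi_emp_kE. Qed.

Lemma measure_itvT : mu `[- T, T] = (2 * T)%:E.
Proof.
rewrite lebesgue_measure_itvcc; first by congr EFin; ring.
by rewrite (le_trans _ (ltW T0))// oppr_le0 ltW.
Qed.

(** The window has length [2 / h], which consumes one of the [p.+1] powers of [h]. Here [y] is
    arbitrary: on the bad event the truncation is the only control on the logarithm. *)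
Lemma truncated_statistic_le (y : R -> \bar R) (q : R -> R) (B : R) (p : nat) :
  0 <= M -> 0 <= B -> (forall s, `|q s| <= B) ->
  `|\int[mu]_(t in `[- T, T]) (trunc M (y t) * (h ^+ p.+1 * q (h * t)))| <=
  2 * M * B * h ^+ p.
Proof.
move=> M0 B0 qB; have h0 : 0 < h by rewrite invr_gt0.
have e0 : 0 <= M * (h ^+ p.+1 * B) by rewrite !mulr_ge0// exprn_ge0// ltW.
apply: le_trans (Rintegral_le_bound (c := M * (h ^+ p.+1 * B)) _ _ e0 _) _ => //.
- by rewrite [X in (X < _)%E]measure_itvT ltry.
- move=> t _; rewrite normrM ler_pM ?normr_trunc_le// normrM ger0_norm ?exprn_ge0 ?(ltW h0)//.
  by rewrite ler_wpM2l ?exprn_ge0 ?(ltW h0).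
rewrite [X in fine X](measure_itvT)/= exprS /h.
by rewrite le_eqVlt; apply/orP; left; apply/eqP; field; rewrite gt_eqF.
Qed.

End estimator_bounds.

Section spectral_error.
Context {R : realType}.
Local Notation mu := (@lebesgue_measure R).
Variables (beta C T lambda b : R) (f G : R -> R).
Hypothesis beta0 : 0 < beta.
Hypothesis densf : is_probability_density f.
Hypothesis evenf : forall x, f (- x) = f x.
Hypothesis fC : (\int[mu]_t (`|t| `^ (2 * beta) *
  Normc.normc (fourier f t) ^+ 2)%:E <= C%:E)%E.
Hypothesis T0 : 0 < T.
Hypothesis mG : measurable_fun setT G.
Hypothesis G0 : forall t, t \notin `[- T, T] -> G t = 0.
Hypothesis Gb : forall t, t \in `[- T, T] -> `|G t - lambda * trigT cos f t| <= b.

(** Inside the window [b] acts over a length [2 * T]; outside, [G] is 0 and the tail of the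
    characteristic function remains. The imaginary part is covered by [lambda = 0]. *)
Lemma spectral_error_le :
  (\int[mu]_t ((G t - lambda * trigT cos f t) ^+ 2)%:E <=
   (2 * T * b ^+ 2 + lambda ^+ 2 * (T `^ (- (2 * beta)) * C))%:E)%E.
Proof.
pose D : set R := `[- T, T]%classic.
have mD : measurable D by exact: measurable_itv.
have mphi : measurable_fun setT (trigT cos f) := measurable_phi densf.
pose F t := ((G t - lambda * trigT cos f t) ^+ 2)%:E.
have mF : measurable_fun setT F.
  apply/measurable_EFinP; apply: measurable_funX; apply: measurable_funB => //.
  exact: measurable_funM.
have F0 t : (0 <= F t)%E by rewrite lee_fin sqr_ge0.
rewrite -(setUv D) (@ge0_integral_setU _ _ _ mu D (~` D) mD (measurableC mD) F); last 3 first.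
- exact: measurable_funTS.
- by move=> t _; exact: F0.
- by apply/disj_setPCl.
rewrite EFinD; apply: leeD.
  have b0 : 0 <= b.
    by apply: le_trans (normr_ge0 _) (Gb (t := 0) _); rewrite in_itv/= oppr_le0 !ltW.
  apply: (@le_trans _ _ (\int[mu]_(t in D) (cst (b ^+ 2)%:E t))%E).
    apply: le_integral_nonmeasurable => t Dt; first exact: F0.
    rewrite lee_fin -real_normK ?num_real//; apply: lerXn2r; rewrite ?nnegrE//.
    exact: Gb.
  rewrite integral_cst// [X in (_ * X)%E](measure_itvT T0) -EFinM lee_fin.
  by rewrite mulrC.
apply: (@le_trans _ _ (\int[mu]_(t in ~` D) ((lambda ^+ 2)%:E * (trigT cos f t ^+ 2)%:E))%E).
  apply: le_integral_nonmeasurable => t Dt; first exact: F0.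
  rewrite /F G0; first by rewrite sub0r sqrrN exprMn EFinM.
  by apply/negP => h; exact: Dt.
rewrite ge0_integralZl//; last 4 first.
- exact: measurableC.
- by apply: measurable_funTS; apply/measurable_EFinP; exact: measurable_funX.
- by move=> t _; rewrite lee_fin sqr_ge0.
- by rewrite lee_fin sqr_ge0.
rewrite [in leRHS]EFinM; apply: lee_wpmul2l; first by rewrite lee_fin sqr_ge0.
exact: (phi_tail beta0 densf fC evenf T0).
Qed.

End spectral_error.

(** * Risk for a fixed sample and expected risk *)

Lemma continuous_sumf (R : realType) (I : Type) (r : seq I) (F : I -> R -> R) :
  (forall i, continuous (F i)) -> continuous (fun t => \sum_(i <- r) F i t).
Proof.
move=> cF; elim: r => [|i r ih].
  have -> : (fun t => \sum_(i <- [::]) F i t) = cst 0.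
    by apply/funext => t; rewrite big_nil.
  by move=> t; exact: cvg_cst.
have -> : (fun t => \sum_(j <- i :: r) F j t) = (fun t => F i t + \sum_(j <- r) F j t).
  by apply/funext => t; rewrite big_cons.
by move=> t; apply: cvgD; [exact: cF|exact: ih].
Qed.

Section sample_risk.
Local Open Scope complex_scope.
Context {R : realType}.
Local Notation mu := (@lebesgue_measure R).
Variables (beta L C Lambda B k : R) (v u w : R -> R).
Hypotheses (beta0 : 0 < beta) (B0 : 0 <= B) (k0 : 0 <= k).
Hypotheses (kv : is_kernel_v beta v) (ku : is_kernel_u beta u) (kw : is_kernel_w beta w).
Hypotheses (vB : forall s, `|v s| <= B) (uB : forall s, `|u s| <= B) (wB : forall s, `|w s| <= B).
Hypotheses (vk : forall s, `|v s| <= k * `|s| `^ beta)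
  (uk : forall s, `|u s| <= k * `|s| `^ beta) (wk : forall s, `|w s| <= k * `|s| `^ beta).
Variables (lambda : R) (f : R -> R).
Hypothesis lambda_itv : 0 <= lambda <= Lambda.
Hypothesis densf : is_probability_density f.
Hypothesis evenf : forall y, f (- y) = f y.
Hypothesis fL : (\int[mu]_t (`|t| `^ beta * Normc.normc (fourier f t))%:E <= L%:E)%E.
Hypothesis fC : (\int[mu]_t (`|t| `^ (2 * beta) *
  Normc.normc (fourier f t) ^+ 2)%:E <= C%:E)%E.
Local Notation phi := (trigT cos f).
Variables (n : nat) (x : 'I_n -> R) (T M : R).
Hypotheses (T1 : 1 <= T) (M1 : 1 <= M).
Let h := T^-1.
Let T0 : 0 < T. Proof. exact: lt_le_trans T1. Qed.
Let M0 : 0 <= M. Proof. exact: le_trans M1. Qed.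
Let h0 : 0 < h. Proof. by rewrite invr_gt0. Qed.
Let h1 : h <= 1. Proof. by rewrite invf_le1. Qed.
Let hT : h * T = 1. Proof. by rewrite mulVf// gt_eqF. Qed.

Local Notation a_ := (gamma_tilde w h M x).
Local Notation b_ := (lambda_tilde u h M x).
Local Notation c_ := (sigma2_tilde v h M x / 2).
Let r t := trunc M (complex.Re (Log h^-1 (phi_emp_k h x) t))%:E.
Let s t := trunc M (complex.Im (Log h^-1 (phi_emp_k h x) t))%:E.

Let cr : {within `[- h^-1, h^-1], continuous r}.
Proof.
have [c1 _] := Log_continuous h^-1 (phi_emp_k h x).
by apply: (@within_continuous_comp _ _ _ _ _ (fun y : R => trunc M y%:E) _ c1) => z _; exact: continuous_trunc.
Qed.

Let cs : {within `[- h^-1, h^-1], continuous s}.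
Proof.
have [_ c2] := Log_continuous h^-1 (phi_emp_k h x).
by apply: (@within_continuous_comp _ _ _ _ _ (fun y : R => trunc M y%:E) _ c2) => z _; exact: continuous_trunc.
Qed.

(** Reduces the risk to a uniform spectral error. When [rho_hat] is set to zero, its spectrum is 0
    and the spectral error is [lambda * |phi| <= lambda], whence the second hypothesis. *)
Lemma rho_hat_risk_le (bd : R) :
  (nonvanishing T (phi_emp_k h x) -> forall t, t \in `[- T, T] ->
    `|b_ + c_ * t ^+ 2 + r t - lambda * phi t| <= bd /\ `|s t - a_ * t| <= bd) ->
  (~ nonvanishing T (phi_emp_k h x) -> lambda <= bd) -> 0 <= bd ->
  (\int[mu]_y ((Normc.normc (rho_hat v u w h M x y - (lambda * f y)%:C)) ^+ 2)%:E <=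
   (pi^-1 * (4 * T * bd ^+ 2 + lambda ^+ 2 * (T `^ (- (2 * beta)) * C)))%:E)%E.
Proof.
move=> good lbd bd0.
have /andP[l0 _] := lambda_itv.
have iphi := integrable_phi beta0 densf fL evenf.
have key (GR GI : R -> R) : mu.-integrable setT (EFin \o GR) ->
    mu.-integrable setT (EFin \o GI) ->
    (forall t, t \notin `[- T, T] -> GR t = 0) -> (forall t, t \notin `[- T, T] -> GI t = 0) ->
    (forall t, t \in `[- T, T] -> `|GR t - lambda * phi t| <= bd) ->
    (forall t, t \in `[- T, T] -> `|GI t| <= bd) ->
    (forall y, rho_hat v u w h M x y =
      ((2 * pi)^-1 * (trigT cos GR y + trigT sin GI y)) +i*
      ((2 * pi)^-1 * (trigT cos GI y - trigT sin GR y))) ->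
    (\int[mu]_y ((Normc.normc (rho_hat v u w h M x y - (lambda * f y)%:C)) ^+ 2)%:E <=
   (pi^-1 * (4 * T * bd ^+ 2 + lambda ^+ 2 * (T `^ (- (2 * beta)) * C)))%:E)%E.
  move=> iGR iGI GR0 GI0 GRb GIb hE.
  under eq_integral do rewrite hE.
  apply: le_trans (fourier_risk_le lambda densf evenf iphi iGR iGI) _.
  rewrite EFinM; apply: lee_wpmul2l; first by rewrite lee_fin invr_ge0 pi_ge0.
  have mGR : measurable_fun setT GR by apply/measurable_EFinP; exact: (measurable_int mu).
  have mGI : measurable_fun setT GI by apply/measurable_EFinP; exact: (measurable_int mu).
  have hR := spectral_error_le beta0 densf evenf fC T0 mGR GR0 GRb.
  have GIb' t : t \in `[- T, T] -> `|GI t - 0 * phi t| <= bd.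
    by rewrite mul0r subr0; exact: GIb.
  have := spectral_error_le beta0 densf evenf fC T0 mGI GI0 GIb'.
  under eq_integral do rewrite mul0r subr0.
  rewrite expr0n/= mul0r addr0 => hI.
  apply: le_trans (leeD hR hI) _; rewrite -EFinD lee_fin.
  by rewrite le_eqVlt; apply/orP; left; apply/eqP; ring.
have [nv|nnv] := pselect (nonvanishing T (phi_emp_k h x)); last first.
  apply: (key (cst 0) (cst 0)) => //; try exact: integrable0.
  - move=> t _; rewrite sub0r normrN normrM (ger0_norm l0).
    by apply: le_trans (lbd nnv); rewrite ler_piMr// norm_phi_le1.
  - by move=> t _; rewrite normr0.
  - move=> y; rewrite /rho_hat invrK asboolF//.
    have t0 c : trigT c (cst (0 : R)) y = 0.
      by rewrite /trigT; under eq_Rintegral do rewrite mulr0; rewrite Rintegral_cst// mul0r.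
    by rewrite !t0 addr0 subr0 mulr0.
have notD (g : R -> R) t : t \notin `[- T, T] -> (g \_ `[- h^-1, h^-1]) t = 0.
  by move=> tT; rewrite patchE mem_set_itv invrK (negbTE tT).
apply: (key (spectral_Re h b_ c_ r) (spectral_Im h a_ s)).
- exact: integrable_spectral_Re.
- exact: integrable_spectral_Im.
- exact: notD.
- exact: notD.
- move=> t tT; rewrite /spectral_Re patchE mem_set_itv invrK tT.
  exact: (good nv t tT).1.
- move=> t tT; rewrite /spectral_Im patchE mem_set_itv invrK tT.
  exact: (good nv t tT).2.
- move=> y; rewrite -fourier_estimatorE// /rho_hat asboolT//.
  by rewrite invrK.
Qed.

Let h_itvE : `[- h^-1, h^-1] = `[- T, T] :> interval R.
Proof. by rewrite invrK. Qed.

Let bM : `|b_| <= 2 * M * B.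
Proof.
rewrite /lambda_tilde h_itvE.
have := truncated_statistic_le T0 (log_abs_phi_emp x) 0 M0 B0 uB.
by rewrite expr0 mulr1; under eq_Rintegral do rewrite expr1.
Qed.

Let aM : `|a_| <= 2 * M * B * h.
Proof.
rewrite /gamma_tilde h_itvE.
have := truncated_statistic_le T0 (fun t => (complex.Im (Log h^-1 (phi_emp x) t))%:E) 1 M0 B0 wB.
by rewrite expr1.
Qed.

Let cM : `|c_| <= M * B * h ^+ 2.
Proof.
rewrite /sigma2_tilde h_itvE.
have := truncated_statistic_le T0 (log_abs_phi_emp x) 2 M0 B0 vB.
rewrite normrM (@ger0_norm _ 2^-1)// => hh.
have -> : M * B * h ^+ 2 = 2 * M * B * h ^+ 2 / 2 by field.
by rewrite ler_wpM2r.
Qed.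

(** Since [h * |t| <= 1], the powers of [t] cancel the powers of [h] in the statistics. In units of
    [M], the constant collects [2 * B] from [lambda_tilde], [B] from half of [sigma2_tilde], 1 from
    the truncated logarithm and [Lambda] from the target, as [M >= 1]. *)
Lemma rho_hat_risk_crude :
  (\int[mu]_y ((Normc.normc (rho_hat v u w h M x y - (lambda * f y)%:C)) ^+ 2)%:E <=
   (pi^-1 * (4 * T * ((3 * B + 1 + Lambda) * M) ^+ 2 +
     lambda ^+ 2 * (T `^ (- (2 * beta)) * C)))%:E)%E.
Proof.
have /andP[l0 lL] := lambda_itv.
have L0 : 0 <= Lambda by exact: le_trans lL.
have LM : Lambda <= Lambda * M by rewrite ler_peMr.
have MB : 0 <= M * B by rewrite mulr_ge0.
have LbM : lambda <= (3 * B + 1 + Lambda) * M.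
  apply: le_trans lL _; move: M0 MB LM; lra.
apply: rho_hat_risk_le => //; last by exact: le_trans LbM.
move=> _ t tT.
have tT' : `|t| <= T by move: tT; rewrite in_itv/= -ler_norml.
have ht : h * `|t| <= 1 by rewrite -hT ler_pM2l.
split.
  have ct : `|c_ * t ^+ 2| <= M * B.
    rewrite normrM normrX; apply: le_trans (ler_wpM2r (exprn_ge0 _ (normr_ge0 _)) cM) _.
    by rewrite -(mulrA (M * B)) -exprMn ler_piMr// exprn_ile1// mulr_ge0// ltW.
  have lp : `|lambda * phi t| <= Lambda.
    rewrite normrM (ger0_norm l0); apply: le_trans lL.
    by rewrite ler_piMr// norm_phi_le1.
  have rM : `|r t| <= M by exact: normr_trunc_le.
  apply: le_trans (ler_normB _ _) _; apply: le_trans (lerD (ler_normD _ _) (lexx _)) _.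
  apply: le_trans (lerD (lerD (ler_normD _ _) (lexx _)) (lexx _)) _.
  move: bM ct lp rM MB LM M0; lra.
have at_ : `|a_ * t| <= 2 * M * B.
  rewrite normrM; apply: le_trans (ler_wpM2r (normr_ge0 _) aM) _.
  by rewrite -(mulrA (2 * M * B)) ler_piMr// -(mulrA 2) mulr_ge0.
have sM : `|s t| <= M by exact: normr_trunc_le.
have LM0 : 0 <= Lambda * M by rewrite mulr_ge0.
apply: le_trans (ler_normB _ _) _; move: at_ sM LM0 MB; lra.
Qed.

Variables (gamma sigma delta : R).
Hypothesis delta_itv : 0 <= delta <= 12^-1.
Local Notation psir := (log_modulus sigma lambda f).
Local Notation eta := (6 * delta).
(** The first terms bound the real and imaginary parts of the logarithm of phi_X on the window; the
    final 1 leaves room for the perturbation [6 * delta <= 1 / 2]. *)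
Hypothesis M_large : 2^-1 * sigma ^+ 2 * T ^+ 2 + 2 * lambda + `|gamma| * T + 1 <= M.
Hypothesis n0 : (0 < n)%N.
Let pr t := n%:R^-1 * \sum_(j < n) cos (t * x j).
Let pm t := n%:R^-1 * \sum_(j < n) sin (t * x j).
Hypothesis pr_close : forall t, t \in `[- T, T] ->
  `|pr t - expR (psir t) * cos (gamma * t)| <= delta * expR (psir t).
Hypothesis pm_close : forall t, t \in `[- T, T] ->
  `|pm t - expR (psir t) * sin (gamma * t)| <= delta * expR (psir t).

Let continuous_mean (g : R -> R) : continuous g ->
  continuous (fun t : R => n%:R^-1 * \sum_(j < n) g (t * x j)).
Proof.
move=> cg t; apply: cvgM; first exact: cvg_cst.
apply: continuous_sumf => j {}t; apply: (@continuous_comp _ _ _ (fun t : R => t * x j) g).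
  exact: mulrr_continuous.
exact: cg.
Qed.

Let p_eq : phi_emp x = (fun t => pr t +i* pm t).
Proof. by apply/funext => t; rewrite phi_empE. Qed.

Let log_spec : [/\ nonvanishing T (phi_emp x),
    is_distinguished_log T (phi_emp x) (Log T (phi_emp x)) &
  forall t, t \in `[- T, T] -> `|complex.Re (Log T (phi_emp x) t) - psir t| <= eta /\
    `|complex.Im (Log T (phi_emp x) t) - gamma * t| <= eta].
Proof.
have nR : n%:R != 0 :> R by rewrite pnatr_eq0 -lt0n.
rewrite p_eq; apply: (@Log_close R T delta pr pm psir (fun t => gamma * t)) => //.
- exact: ltW.
- exact: continuous_mean (@continuous_cos R).
- exact: continuous_mean (@continuous_sin R).
- exact: continuous_log_modulus.
- exact: mulrl_continuous.
- rewrite /pr (eq_bigr (fun=> 1)) => [|j _]; last by rewrite mul0r cos0.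
  by rewrite sumr_const card_ord mulVf.
- by rewrite /pm big1 ?mulr0// => j _; rewrite mul0r sin0.
- exact: log_modulus0.
- by rewrite mulr0.
Qed.

Let ell t := complex.Re (Log T (phi_emp x) t).
Let ang t := complex.Im (Log T (phi_emp x) t).

Let ell_close (t : R) : t \in `[- T, T] -> `|ell t - psir t| <= eta.
Proof. by case: log_spec => _ _ /[apply] -[]. Qed.

Let ang_close (t : R) : t \in `[- T, T] -> `|ang t - gamma * t| <= eta.
Proof. by case: log_spec => _ _ /[apply] -[]. Qed.

Let log_absE (t : R) : t \in `[- T, T] -> log_abs_phi_emp x t = (ell t)%:E.
Proof.
case: log_spec => _ [_ e _] _ tT; rewrite /log_abs_phi_emp -(e t tT) normc_expC.
by rewrite /lne leNgt expR_gt0/= expRK.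
Qed.

Let eta_le : 0 <= eta <= 2^-1.
Proof. by move/andP: delta_itv => [d0 d1]; apply/andP; split; lra. Qed.

Let trunc_ell (t : R) : t \in `[- T, T] -> trunc M (ell t)%:E = ell t.
Proof.
move=> tT; apply: trunc_id.
have tT' : `|t| <= T by move: tT; rewrite in_itv/= -ler_norml.
have /andP[l0 _] := lambda_itv.
have t2 : t ^+ 2 <= T ^+ 2.
  rewrite -real_normK ?num_real//; apply: lerXn2r; rewrite ?nnegrE//; exact: ltW.
have s2 : 2^-1 * sigma ^+ 2 * t ^+ 2 <= 2^-1 * sigma ^+ 2 * T ^+ 2.
  by rewrite ler_wpM2l// mulr_ge0// sqr_ge0.
have gT : 0 <= `|gamma| * T by rewrite mulr_ge0// ltW.
have h2 := log_modulus_ge sigma densf l0 t.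
have h3 := log_modulus_le0 sigma densf l0 t.
have := ell_close tT; have := eta_le; move: M_large.
rewrite !ler_norml => m /andP[e0 e1] /andP[e2 e3].
have s0 : 0 <= 2^-1 * sigma ^+ 2 * t ^+ 2 by rewrite mulr_ge0 ?sqr_ge0// mulr_ge0 ?sqr_ge0.
apply/andP; split; move: m e0 e1 e2 e3 s0 s2 gT h2 h3 l0; move: (psir t) (ell t) (2^-1 * sigma ^+ 2 * t ^+ 2) (2^-1 * sigma ^+ 2 * T ^+ 2) (`|gamma| * T) => A1 A2 A3 A4 A5; move: delta => dd; lra.
Qed.

Let trunc_ang (t : R) : t \in `[- T, T] -> trunc M (ang t)%:E = ang t.
Proof.
move=> tT; apply: trunc_id.
have tT' : `|t| <= T by move: tT; rewrite in_itv/= -ler_norml.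
have /andP[l0 _] := lambda_itv.
have gt_ : `|gamma * t| <= `|gamma| * T by rewrite normrM ler_wpM2l.
have s0 : 0 <= 2^-1 * sigma ^+ 2 * T ^+ 2 by rewrite mulr_ge0 ?sqr_ge0// mulr_ge0 ?sqr_ge0.
have := ang_close tT; have /andP[_ e1] := eta_le.
have := ler_normD (ang t - gamma * t) (gamma * t); rewrite subrK.
move: M_large e1 gt_ s0 l0; lra.
Qed.

Let cont_ell : {within `[- T, T], continuous ell}.
Proof. exact: (Log_continuous T (phi_emp x)).1. Qed.

Let cont_ang : {within `[- T, T], continuous ang}.
Proof. exact: (Log_continuous T (phi_emp x)).2. Qed.

Let iphis : mu.-integrable setT (EFin \o (fun t => `|t| `^ beta * `|phi t|)).
Proof. exact: (integrable_phi_smooth densf fL evenf). Qed.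

Let phisL : \int[mu]_t (`|t| `^ beta * `|phi t|) <= L.
Proof.
rewrite -lee_fin fineK; last exact: (integrable_fin_num measurableT iphis).
exact: (phi_smooth densf fL evenf).
Qed.

Let cphi : continuous phi. Proof. exact: continuous_phi. Qed.

Let kernel_moment0 (q : R -> R) :
  \int[mu]_(y in `[- 1, 1]) (y ^+ 0 * q y) = \int[mu]_(y in `[- 1, 1]) q y.
Proof. by apply: eq_Rintegral => y _; rewrite expr0 mul1r. Qed.

Let psir_ell (t : R) : t \in `[- T, T] ->
  `|ell t - (- (sigma ^+ 2 / 2) * t ^+ 2 + 0 * t + (- lambda) + lambda * phi t)| <= eta.
Proof.
move=> tT; have -> : - (sigma ^+ 2 / 2) * t ^+ 2 + 0 * t + (- lambda) + lambda * phi t = psir t.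
  by rewrite /log_modulus; field.
exact: ell_close.
Qed.

Let b_close : `|b_ - lambda| <= h * (eta * B * (2 * T) + Lambda * (k * h `^ beta * L)).
Proof.
have [[cu _ _] u0 u2] := ku.
have := kernel_statistic 1 T0 B0 k0 lambda_itv cphi iphis phisL cu uB uk cont_ell psir_ell.
rewrite /= kernel_moment0 u0 u2 -/h expr1 /lambda_tilde h_itvE.
(* The real part of the logarithm has linear coefficient 0, so the first moment of [u] drops out. *)
have -> : h * (- (sigma ^+ 2 / 2) * (T ^+ 3 * 0) + 0 * (T ^+ 2 *
  \int[mu]_(y in `[- 1, 1]) (y ^+ 1 * u y)) + - lambda * (T * -1)) = lambda.
  by transitivity (lambda * (h * T)); [ring|rewrite hT mulr1].
have -> // : \int[mu]_(t in `[- T, T]) (trunc M (log_abs_phi_emp x t) * (h * u (h * t))) =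
    \int[mu]_(t in `[- T, T]) (ell t * (h * u (h * t))).
apply: eq_Rintegral => t.
by rewrite mem_set_itv => tT; rewrite log_absE// trunc_ell.
Qed.

Let c_close : `|c_ - sigma ^+ 2 / 2| <=
  2^-1 * h ^+ 3 * (eta * B * (2 * T) + Lambda * (k * h `^ beta * L)).
Proof.
have [[cv _ _] v0 v2] := kv.
have iv : mu.-integrable `[- 1, 1] (EFin \o (fun y => y ^+ 2 * v y)).
  apply: continuous_itv_integrable; apply: continuous_subspaceT => t.
  by apply: cvgM; [exact: exprn_continuous|exact: cv].
have v2' : \int[mu]_(y in `[- 1, 1]) (y ^+ 2 * v y) = - 2.
  have : \int[mu]_(t in `[- 1, 1]) (- t ^+ 2 / 2 * v t) = - 2^-1 * \int[mu]_(y in `[- 1, 1]) (y ^+ 2 * v y).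
    by rewrite -RintegralZl//; apply: eq_Rintegral => t _; ring.
  rewrite v2; lra.
have := kernel_statistic 3 T0 B0 k0 lambda_itv cphi iphis phisL cv vB vk cont_ell psir_ell.
rewrite /= kernel_moment0 v0 v2' -/h /sigma2_tilde h_itvE.
have -> : h ^+ 3 * (- (sigma ^+ 2 / 2) * (T ^+ 3 * -2) + 0 * (T ^+ 2 *
  \int[mu]_(y in `[- 1, 1]) (y ^+ 1 * v y)) + - lambda * (T * 0)) = sigma ^+ 2.
  by transitivity (sigma ^+ 2 * (h * T) ^+ 3); [field|rewrite hT expr1n mulr1].
have -> : \int[mu]_(t in `[- T, T]) (trunc M (log_abs_phi_emp x t) * (h ^+ 3 * v (h * t))) =
    \int[mu]_(t in `[- T, T]) (ell t * (h ^+ 3 * v (h * t))).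
  apply: eq_Rintegral => t.
  by rewrite mem_set_itv => tT; rewrite log_absE// trunc_ell.
move=> hh; rewrite -mulrBl normrM (@ger0_norm _ 2^-1)// [leLHS]mulrC -[leRHS]mulrA.
by rewrite ler_wpM2l.
Qed.

Let a_close : `|a_ - gamma| <= h ^+ 2 * (eta * B * (2 * T)).
Proof.
have [[cw _ _] w1] := kw.
(* The phase has no [phi] component: [kernel_statistic] is applied with [lambda = Lambda = 0], and
   no bias term is left. *)
have l00 : 0 <= (0 : R) <= 0 by rewrite lexx.
have psii_ang t : t \in `[- T, T] ->
    `|ang t - (0 * t ^+ 2 + gamma * t + 0 + 0 * phi t)| <= eta.
  by move=> tT; rewrite !mul0r add0r !addr0; exact: ang_close.
have := kernel_statistic 2 T0 B0 k0 l00 cphi iphis phisL cw wB wk cont_ang psii_ang.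
rewrite /= ?mul0r ?addr0 -/h /gamma_tilde h_itvE.
have -> : \int[mu]_(y in `[- 1, 1]) (y ^+ 1 * w y) = 1 by exact: w1.
have -> : h ^+ 2 * (0 + gamma * (T ^+ 2 * 1)) = gamma.
  by transitivity (gamma * (h * T) ^+ 2); [ring|rewrite hT expr1n mulr1].
have -> // : \int[mu]_(t in `[- T, T]) (trunc M (complex.Im (Log h^-1 (phi_emp x) t))%:E *
    (h ^+ 2 * w (h * t))) = \int[mu]_(t in `[- T, T]) (ang t * (h ^+ 2 * w (h * t))).
apply: eq_Rintegral => t.
by rewrite mem_set_itv => tT; rewrite invrK trunc_ang.
Qed.

(** In the real part [lambda_tilde] contributes [2 * B + Lambda * k * L], half of [sigma2_tilde]
    contributes half of that, and the logarithm itself 1, all in units of [h * h^beta]; the constant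
    rounds the sum up. *)
Lemma rho_hat_risk_good : eta <= h * h `^ beta ->
  (\int[mu]_y ((Normc.normc (rho_hat v u w h M x y - (lambda * f y)%:C)) ^+ 2)%:E <=
   (pi^-1 * (4 * T * ((3 * B + 1 + 2 * (Lambda * (k * L))) * (h * h `^ beta)) ^+ 2 +
     lambda ^+ 2 * (T `^ (- (2 * beta)) * C)))%:E)%E.
Proof.
move=> eta_small.
have /andP[l0 lL] := lambda_itv.
have L0 : 0 <= Lambda by exact: le_trans lL.
have LL0 : 0 <= L by apply: le_trans phisL; apply: Rintegral_ge0 => t _; rewrite mulr_ge0// powR_ge0.
have ep0 : 0 <= h * h `^ beta by rewrite mulr_ge0 ?powR_ge0// ltW.
have /andP[e0 _] := eta_le.
have LkL0 : 0 <= Lambda * (k * L) by rewrite !mulr_ge0.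
set ep := h * h `^ beta in eta_small ep0 *.
have Lep : 0 <= Lambda * (k * L) * ep by rewrite mulr_ge0.
have Be : B * eta <= B * ep by rewrite ler_wpM2l.
have nvk : nonvanishing T (phi_emp_k h x).
  by move=> t tT; rewrite phi_emp_kE//; case: log_spec => + _ _; apply.
apply: rho_hat_risk_le => //; last by rewrite mulr_ge0// !addr_ge0 ?mulr_ge0.
move=> _ t tT.
have tT' : `|t| <= T by move: tT; rewrite in_itv/= -ler_norml.
have rE : r t = ell t by rewrite /r invrK Log_phi_emp_k// trunc_ell.
have sE : s t = ang t by rewrite /s invrK Log_phi_emp_k// trunc_ang.
have th1 : h * (eta * B * (2 * T) + Lambda * (k * h `^ beta * L)) =
    2 * (B * eta) + Lambda * (k * L) * ep.
  transitivity (2 * (B * eta) * (h * T) + Lambda * (k * L) * (h * h `^ beta)); first by ring.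
  by rewrite hT mulr1.
rewrite rE sE; split.
  have -> : b_ + c_ * t ^+ 2 + ell t - lambda * phi t =
      (b_ - lambda) + (c_ - sigma ^+ 2 / 2) * t ^+ 2 + (ell t - psir t).
    by rewrite /log_modulus; field.
  have h1_ := b_close; rewrite th1 in h1_.
  have h2_ : `|(c_ - sigma ^+ 2 / 2) * t ^+ 2| <= B * eta + 2^-1 * (Lambda * (k * L) * ep).
    rewrite normrM normrX.
    have t2 : `|t| ^+ 2 <= T ^+ 2 by apply: lerXn2r; rewrite ?nnegrE//; exact: ltW.
    apply: le_trans (ler_pM _ _ c_close t2) _ => //.
    rewrite (_ : _ * T ^+ 2 = 2^-1 * ((h * T) ^+ 2) * (h * (eta * B * (2 * T) + Lambda * (k * h `^ beta * L)))); last by ring.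
    by rewrite th1 hT expr1n; lra.
  have h3_ := ell_close tT.
  apply: le_trans (ler_normD _ _) _; apply: le_trans (lerD (ler_normD _ _) (lexx _)) _.
  move: h1_ h2_ h3_ Be Lep eta_small; lra.
have -> : ang t - a_ * t = (ang t - gamma * t) - (a_ - gamma) * t by ring.
have h1_ : `|(a_ - gamma) * t| <= 2 * (B * eta).
  rewrite normrM; apply: le_trans (ler_pM _ _ a_close tT') _ => //.
  rewrite [leLHS](_ : _ = 2 * (B * eta) * (h * T) ^+ 2); last by ring.
  by rewrite hT expr1n mulr1.
have h2_ := ang_close tT.
have Bep : 0 <= B * ep by rewrite mulr_ge0.
apply: le_trans (ler_normB _ _) _; move: h1_ h2_ Be Bep Lep eta_small; lra.
Qed.

End sample_risk.

Lemma mutually_independent_pair d (T : measurableType d) (R : realType) (P : probability T R)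
    n (X : 'I_n -> {mfun T >-> R}) : mutually_independent (P := P) X ->
  forall j k, j != k -> forall A B : set R, measurable A -> measurable B ->
  P (X j @^-1` A `&` X k @^-1` B) = (P (X j @^-1` A) * P (X k @^-1` B))%E.
Proof.
move=> ind j k jk A B mA mB.
have mF i : measurable (if i == j then A else B) by case: ifP.
have := ind (j |: [set k])%SET (fun i => if i == j then A else B) mF.
have kj : (k == j) = false by rewrite eq_sym (negbTE jk).
rewrite big_setU1 ?inE// big_set1 eqxx kj => <-.
congr (P _); apply/seteqP; split => [p [oA oB] i /=|p /= h].
  by rewrite !inE => /orP[|] /eqP ->; rewrite ?eqxx ?kj.
split.
  by have := h j; rewrite /= !inE eqxx; apply.
by have := h k; rewrite /= !inE eqxx kj orbT; apply.
Qed.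

(** For [T >= 2] the choice [delta = h^(1 + beta) / 6] thus satisfies the requirement
    [delta <= 1 / 12] of [Log_close]. *)
Lemma invr_mul_powR_le (R : realType) (T beta : R) : 2 <= T -> 0 < beta ->
  0 < T^-1 * T^-1 `^ beta <= 2^-1.
Proof.
move=> T2 b0; have T0 : 0 < T by exact: lt_le_trans T2.
have i0 : 0 < T^-1 by rewrite invr_gt0.
have i2 : T^-1 <= 2^-1 by rewrite lef_pV2// posrE.
rewrite mulr_gt0 ?powR_gt0//=; apply: le_trans i2; rewrite ler_piMr ?(ltW i0)//.
rewrite -(powRr0 T^-1); apply: ger_powR => //; last exact: ltW.
by rewrite i0/= invf_le1// (le_trans _ T2)// ler1n.
Qed.

(** * Expected risk, uniformly over the parameters *)

Section expected_risk.
Local Open Scope complex_scope.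
Context {R : realType}.
Local Notation mu := (@lebesgue_measure R).
Variables (beta L C Lambda K Sigma Gamma B k : R) (v u w : R -> R).
Hypotheses (beta0 : 0 < beta) (C0 : 0 <= C) (K0 : 0 <= K) (Lambda0 : 0 <= Lambda)
  (B0 : 0 <= B) (k0 : 0 <= k).
Hypotheses (kv : is_kernel_v beta v) (ku : is_kernel_u beta u) (kw : is_kernel_w beta w).
Hypotheses (vB : forall s, `|v s| <= B) (uB : forall s, `|u s| <= B) (wB : forall s, `|w s| <= B).
Hypotheses (vk : forall s, `|v s| <= k * `|s| `^ beta)
  (uk : forall s, `|u s| <= k * `|s| `^ beta) (wk : forall s, `|w s| <= k * `|s| `^ beta).
Variables (n : nat) (T M : R).
Hypotheses (n0 : (0 < n)%N) (T2 : 2 <= T)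
  (M_large : 2^-1 * Sigma ^+ 2 * T ^+ 2 + 2 * Lambda + Gamma * T + 1 <= M).

Definition bias_bound := Lambda ^+ 2 * (T `^ (- (2 * beta)) * C).
Definition risk_good := pi^-1 *
  (4 * T * ((3 * B + 1 + 2 * (Lambda * (k * L))) * (T^-1 * T^-1 `^ beta)) ^+ 2 + bias_bound).
Definition risk_crude := pi^-1 * (4 * T * ((3 * B + 1 + Lambda) * M) ^+ 2 + bias_bound).
(** The factor 4 of [second_moment_le] times the largest coefficient of [t ^ 2] that
    [onem_expR_cos_le] allows over the class. *)
Definition moment_bound := 4 * ((Sigma ^+ 2 + Lambda * K + Gamma ^+ 2) / 2).
(* [tolerance * T <= delta * |phi_X|] on [-T, T] with [delta = h^(1 + beta) / 6]: the deviation
   of [phi_emp] at which its logarithm is still within [h^(1 + beta)] of that of [phi_X]. *)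
Definition tolerance := T^-1 * T^-1 `^ beta / 6 / T *
  expR (- (2^-1 * Sigma ^+ 2 * T ^+ 2 + 2 * Lambda)).

Section one_law.
Variables (gamma sigma lambda : R) (f : R -> R).
Hypotheses (gammaG : `|gamma| <= Gamma) (sigmaS : 0 < sigma <= Sigma)
  (lambda_itv : 0 <= lambda <= Lambda).
Hypothesis densf : is_probability_density f.
Hypothesis evenf : forall y, f (- y) = f y.
Hypothesis fK : (\int[mu]_y (y ^+ 2 * f y)%:E <= K%:E)%E.
Hypothesis fL : (\int[mu]_t (`|t| `^ beta * Normc.normc (fourier f t))%:E <= L%:E)%E.
Hypothesis fC : (\int[mu]_t (`|t| `^ (2 * beta) *
  Normc.normc (fourier f t) ^+ 2)%:E <= C%:E)%E.
Variables (d : measure_display) (Om : measurableType d) (P : probability Om R)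
  (X : 'I_n -> {mfun Om >-> R}).
Hypothesis iidX : iid_with_charfun (P := P) X (phiX gamma sigma (fun y => lambda * f y)).
Local Notation psir := (log_modulus sigma lambda f).

Let T0 : 0 < T. Proof. exact: lt_le_trans T2. Qed.
Let l0 : 0 <= lambda. Proof. by case/andP: lambda_itv. Qed.

Let s2 : sigma ^+ 2 <= Sigma ^+ 2.
Proof.
by move: sigmaS => /andP[s0 sS]; apply: lerXn2r; rewrite ?nnegrE// ?(ltW s0)// (le_trans (ltW s0)).
Qed.

Let XE j t : charfun (P := P) (X j) t = expC (psir t +i* (gamma * t)).
Proof. by case: iidX => _ _ ->; rewrite phiX_even. Qed.

Let indX := mutually_independent_pair (let: And3 i _ _ := iidX in i).

Let m2_ge0 : 0 <= moment_bound.
Proof. by rewrite /moment_bound !mulr_ge0// !addr_ge0 ?sqr_ge0// mulr_ge0. Qed.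

Let X2 j : (\int[P]_o (X j o ^+ 2)%:E <= moment_bound%:E)%E.
Proof.
have c0 : 0 <= (sigma ^+ 2 + lambda * K + gamma ^+ 2) / 2.
  by rewrite mulr_ge0// !addr_ge0 ?sqr_ge0// mulr_ge0.
apply: (@le_trans _ _ (4 * ((sigma ^+ 2 + lambda * K + gamma ^+ 2) / 2))%:E).
  apply: second_moment_le c0 => t.
  have := XE j t; rewrite charfunE expCE/= => -[-> _].
  exact: onem_expR_cos_le.
have g2 : gamma ^+ 2 <= Gamma ^+ 2.
  by rewrite -(real_normK (num_real gamma)); apply: lerXn2r; rewrite ?nnegrE// (le_trans _ gammaG).
have lK : lambda * K <= Lambda * K by rewrite ler_wpM2r//; case/andP: lambda_itv.
by rewrite lee_fin /moment_bound; move: s2 g2 lK; lra.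
Qed.

Let tol0 : 0 < tolerance.
Proof.
have /andP[e0 _] := invr_mul_powR_le T2 beta0.
by rewrite /tolerance mulr_gt0 ?expR_gt0// divr_gt0// divr_gt0.
Qed.

Let bias_le : lambda ^+ 2 * (T `^ (- (2 * beta)) * C) <= bias_bound.
Proof.
case/andP: lambda_itv => _ lL.
rewrite ler_wpM2r ?mulr_ge0 ?powR_ge0//; apply: lerXn2r; rewrite ?nnegrE//.
Qed.

Let pi_inv0 : 0 <= (pi : R)^-1. Proof. by rewrite invr_ge0 pi_ge0. Qed.

Let F o := (\int[mu]_y ((Normc.normc (rho_hat v u w T^-1 M (fun j => X j o) y -
  (lambda * f y)%:C)) ^+ 2)%:E)%E.

Let F_crude o : (F o <= risk_crude%:E)%E.
Proof.
have s0 : 0 <= 2^-1 * Sigma ^+ 2 * T ^+ 2 by rewrite mulr_ge0 ?sqr_ge0// mulr_ge0 ?sqr_ge0.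
have gT : 0 <= Gamma * T by rewrite mulr_ge0 ?(ltW T0)// (le_trans _ gammaG).
have T1 : 1 <= T by apply: le_trans T2; rewrite ler1n.
have M1 : 1 <= M by move: M_large s0 gT Lambda0; lra.
apply: le_trans (rho_hat_risk_crude beta0 B0 vB uB wB lambda_itv densf evenf fL fC _ T1 M1) _.
by rewrite lee_fin /risk_crude ler_wpM2l// lerD2l.
Qed.

Let F_good o : (deviation_energy P X sin T o <= (T * tolerance ^+ 2)%:E)%E ->
  (deviation_energy P X cos T o <= (T * tolerance ^+ 2)%:E)%E -> (F o <= risk_good%:E)%E.
Proof.
move=> Es Ec.
have /andP[e0 e1] := invr_mul_powR_le T2 beta0.
have T1 : 1 <= T by apply: le_trans T2; rewrite ler1n.
pose delta := T^-1 * T^-1 `^ beta / 6.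
have del : 0 <= delta <= 12^-1 by rewrite /delta; apply/andP; split; move: e0 e1; lra.
have aT t : t \in `[- T, T] -> tolerance * T <= delta * expR (psir t).
  move=> tT; have tT' : `|t| <= T by move: tT; rewrite in_itv/= -ler_norml.
  have -> : tolerance * T = delta * expR (- (2^-1 * Sigma ^+ 2 * T ^+ 2 + 2 * Lambda)).
    by rewrite /tolerance -/delta mulrAC divfK// gt_eqF.
  rewrite ler_wpM2l//; first by case/andP: del.
  rewrite ler_expR; apply: le_trans (log_modulus_ge sigma densf l0 t).
  rewrite lerN2; apply: lerD; last by rewrite ler_wpM2l//; case/andP: lambda_itv.
  apply: ler_pM; rewrite ?sqr_ge0//.
  - by rewrite mulr_ge0 ?sqr_ge0.
  - by rewrite ler_wpM2l.
  by rewrite -(real_normK (num_real t)); apply: lerXn2r; rewrite ?nnegrE// ltW.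
have XN t : gamma * - t = - (gamma * t) by rewrite mulrN.
have close := empirical_charfun_close n0 X2 T0 (log_modulusN sigma lambda f) XN XE tol0 Es Ec.
have ML : 2^-1 * sigma ^+ 2 * T ^+ 2 + 2 * lambda + `|gamma| * T + 1 <= M.
  apply: le_trans M_large; rewrite lerD2r; apply: lerD; last by rewrite ler_wpM2r// ltW.
  apply: lerD; last by rewrite ler_wpM2l//; case/andP: lambda_itv.
  by rewrite ler_wpM2r ?sqr_ge0// ler_wpM2l.
have e6 : 6 * delta <= T^-1 * T^-1 `^ beta by rewrite /delta; lra.
apply: le_trans (rho_hat_risk_good beta0 B0 k0 kv ku kw vB uB wB vk uk wk lambda_itv
  densf evenf fL fC T1 del ML n0 _ _ e6) _.
- by move=> t tT; apply: le_trans (aT t tT); exact: (close t tT).1.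
- by move=> t tT; apply: le_trans (aT t tT); exact: (close t tT).2.
by rewrite lee_fin /risk_good ler_wpM2l// lerD2l.
Qed.

Let bias0 : 0 <= bias_bound.
Proof. by rewrite /bias_bound mulr_ge0 ?sqr_ge0// mulr_ge0// powR_ge0. Qed.

Let good0 : 0 <= risk_good.
Proof. by rewrite /risk_good mulr_ge0// addr_ge0// mulr_ge0 ?sqr_ge0// mulr_ge0// ltW. Qed.

Let crude0 : 0 <= risk_crude.
Proof. by rewrite /risk_crude mulr_ge0// addr_ge0// mulr_ge0 ?sqr_ge0// mulr_ge0// ltW. Qed.

(* Markov's inequality for the event that the empirical characteristic function is not
   uniformly close to the true one. *)
Lemma MISE_le_dens : (\int[P]_o F o <=
  (risk_good + risk_crude * (2 * moment_bound / (n%:R * tolerance ^+ 2)))%:E)%E.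
Proof.
pose E o := (deviation_energy P X sin T o + deviation_energy P X cos T o)%E.
have Es0 c o : (0 <= deviation_energy P X c T o)%E by apply: integral_ge0 => y _; rewrite lee_fin sqr_ge0.
pose b := T * tolerance ^+ 2.
have b0 : 0 < b by rewrite mulr_gt0// exprn_gt0.
have cb0 : 0 <= risk_crude / b by rewrite divr_ge0// ltW.
have mEs := measurable_deviation_energy X2 T wave_sin.
have mEc := measurable_deviation_energy X2 T wave_cos.
have mE : measurable_fun setT E by exact: emeasurable_funD.
have E0 o : (0 <= E o)%E by exact: adde_ge0.
(* Markov's inequality in pointwise form: off the good event one of the energies exceeds [b], so
   [1 <= E o / b]. The right-hand side is measurable, which [F] is not known to be. *)
have FE o : (F o <= risk_good%:E + (risk_crude / b)%:E * E o)%E.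
  have [Es|Es] := leP (deviation_energy P X sin T o) b%:E; last first.
    apply: le_trans (F_crude o) _.
    rewrite -[leLHS]add0e; apply: leeD; first by rewrite lee_fin.
    rewrite -[risk_crude in leLHS](divfK (lt0r_neq0 b0)) EFinM lee_wpmul2l ?lee_fin//.
    exact: le_trans (ltW Es) (leeDl _ (Es0 cos o)).
  have [Ec|Ec] := leP (deviation_energy P X cos T o) b%:E; last first.
    apply: le_trans (F_crude o) _.
    rewrite -[leLHS]add0e; apply: leeD; first by rewrite lee_fin.
    rewrite -[risk_crude in leLHS](divfK (lt0r_neq0 b0)) EFinM lee_wpmul2l ?lee_fin//.
    exact: le_trans (ltW Ec) (leeDr _ (Es0 sin o)).
  apply: le_trans (F_good Es Ec) _; rewrite leeDl// mule_ge0// lee_fin.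
apply: (@le_trans _ _ (\int[P]_o (risk_good%:E + (risk_crude / b)%:E * E o))%E).
  apply: le_integral_nonmeasurable => o _; last exact: FE.
  by apply: integral_ge0 => y _; rewrite lee_fin sqr_ge0.
rewrite ge0_integralD//; last 2 first.
- by move=> o _; rewrite mule_ge0// lee_fin.
- exact: measurable_funeM.
have P1 : (risk_good%:E * P setT <= risk_good%:E)%E by rewrite probability_setT mule1.
rewrite integral_cst// EFinD; apply: (leeD P1).
rewrite (ge0_integralZl_EFin _ measurableT (fun o _ => E0 o) mE cb0).
rewrite (ge0_integralD _ measurableT (fun o _ => Es0 sin o) mEs (fun o _ => Es0 cos o) mEc).
have h1 := integral_deviation_energy indX X2 wave_sin T0.
have h2 := integral_deviation_energy indX X2 wave_cos T0.
apply: le_trans (lee_wpmul2l _ (leeD h1 h2)) _; first by rewrite lee_fin.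
rewrite -EFinD -EFinM lee_fin le_eqVlt; apply/orP; left; apply/eqP.
rewrite /b; field.
by rewrite pnatr_eq0 -lt0n n0 !gt_eqF.
Qed.

End one_law.
End expected_risk.

(** * Rate of convergence *)

Section rate.
Context {R : realType}.

(** A single term of the exponential series at [kappa * T ^ 2] suffices, since [T ^ 2 >= T]. *)
Lemma expr_mul_expRN_le (kappa T : R) (j : nat) : 0 < kappa -> 1 <= T ->
  T ^+ j.+1 * expR (- (kappa * T ^+ 2)) <= (j.+1)`!%:R / kappa ^+ j.+1.
Proof.
move=> k0 T1; have T0 : 0 <= T by exact: le_trans T1.
have kT : 0 <= kappa * T ^+ 2 by rewrite mulr_ge0 ?sqr_ge0// ltW.
have f0 : 0 < (j.+1)`!%:R :> R by rewrite ltr0n fact_gt0.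
rewrite expRN ler_pdivrMr ?expR_gt0// mulrAC ler_pdivlMr ?exprn_gt0//.
apply: (@le_trans _ _ ((kappa * T ^+ 2) ^+ j.+1)).
  rewrite exprMn mulrC ler_wpM2l ?exprn_ge0 ?(ltW k0)// lerXn2r ?nnegrE ?sqr_ge0//.
  by rewrite expr2 ler_peMr.
have := expR_ge1Dxn j kT; rewrite -ler_pdivrMl// mulrC; lra.
Qed.

Variables (beta L C Lambda K Sigma Gamma B k eta : R).
Hypotheses (beta0 : 0 < beta) (C0 : 0 <= C) (K0 : 0 <= K) (Lambda0 : 0 <= Lambda).
Hypotheses (eta0 : 0 < eta) (eta_small : Sigma ^+ 2 < eta^-1).

Let kappa := eta^-1 - Sigma ^+ 2.
Variable j : nat.
(** The powers of [T] on the bad event: 9 from the crude risk and 4 from the inverse square of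
    [tolerance]. That inverse also carries [T^(2 beta)], and reaching the rate [T^(-2 beta)] costs
    [T^(2 beta)] again. *)
Hypothesis jb : 13 + 4 * beta <= j.+1%:R.
Let G := 3 * B + 1 + 2 * (Lambda * (k * L)).
Let Q := 3 * B + 1 + Lambda.
Let m2 := moment_bound Lambda K Sigma Gamma.

(** The good and the bad event in turn. In the second, 72 is twice the square of the 6 in
    [tolerance], and [expR (4 * Lambda)] undoes the jump part of its square. *)
Definition rate_constant : R := pi^-1 * (4 * G ^+ 2 + Lambda ^+ 2 * C) +
  pi^-1 * (4 * Q ^+ 2 / eta ^+ 2 + Lambda ^+ 2 * C) *
  (72 * m2 * expR (4 * Lambda)) * (j.+1)`!%:R / kappa ^+ j.+1.

Let m20 : 0 <= m2.
Proof. by rewrite /m2 /moment_bound !mulr_ge0// !addr_ge0 ?sqr_ge0// mulr_ge0. Qed.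

Let LC0 : 0 <= Lambda ^+ 2 * C. Proof. by rewrite mulr_ge0 ?sqr_ge0. Qed.

Let c0 : 0 <= pi^-1 * (4 * Q ^+ 2 / eta ^+ 2 + Lambda ^+ 2 * C).
Proof.
rewrite mulr_ge0 ?invr_ge0 ?pi_ge0// addr_ge0// divr_ge0 ?sqr_ge0//.
by rewrite mulr_ge0 ?sqr_ge0.
Qed.

Let r0 : 0 <= 72 * m2 * expR (4 * Lambda).
Proof. by rewrite mulr_ge0 ?expR_ge0// mulr_ge0. Qed.

Lemma rate_constant_ge0 : 0 <= rate_constant.
Proof.
have k0 : 0 <= kappa by rewrite subr_ge0 ltW.
rewrite /rate_constant addr_ge0//.
  by rewrite mulr_ge0 ?invr_ge0 ?pi_ge0// addr_ge0// mulr_ge0 ?sqr_ge0.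
by rewrite divr_ge0 ?exprn_ge0// mulr_ge0// mulr_ge0.
Qed.

(* [n * tolerance ^+ 2] is a negative power of [T] times [exp (kappa T^2)]. *)
Lemma risk_rate_le (n : nat) (T M : R) : 1 <= T -> 0 <= M -> M <= T ^+ 4 / eta ->
  n%:R = expR (T ^+ 2 / eta) ->
  risk_good beta L C Lambda B k T + risk_crude beta C Lambda B T M *
    (2 * m2 / (n%:R * tolerance beta Lambda Sigma T ^+ 2)) <=
  rate_constant * T `^ (- (2 * beta)).
Proof.
move=> T1 M0 MT nE.
have T0 : 0 < T by exact: lt_le_trans T1.
set s := T `^ (- (2 * beta)).
have s0 : 0 < s by exact: powR_gt0.
have s1 : s <= 1.
  by rewrite /s powRN invf_le1 ?powR_gt0// powR_ge1// mulr_ge0// ltW.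
have ihs : (T^-1 `^ beta) ^+ 2 = s.
  rewrite /s -powR_inv1 ?(ltW T0)// -powR_mulrn ?powR_ge0// -!powRrM; congr (_ `^ _); ring.
have good : risk_good beta L C Lambda B k T <= pi^-1 * (4 * G ^+ 2 + Lambda ^+ 2 * C) * s.
  rewrite /risk_good /bias_bound -/s -/G -[leRHS]mulrA ler_wpM2l ?invr_ge0 ?pi_ge0//.
  rewrite [leRHS]mulrDl; apply: lerD; last by rewrite [s * C]mulrC mulrA.
  rewrite !exprMn ihs.
  have -> : 4 * T * (G ^+ 2 * (T^-1 ^+ 2 * s)) = T^-1 * (4 * G ^+ 2 * s).
    by field; rewrite gt_eqF.
  by rewrite ler_piMl ?invf_le1// mulr_ge0 ?(ltW s0)// mulr_ge0 ?sqr_ge0.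
have T9 : 1 <= T ^+ 9 by rewrite exprn_ege1.
(* [T ^ 9] is one [T] for the window times [M ^ 2 <= T ^ 8 / eta ^ 2]; the bias term is absorbed by
   [T ^ 9 >= 1]. *)
have crude : risk_crude beta C Lambda B T M <=
    pi^-1 * (4 * Q ^+ 2 / eta ^+ 2 + Lambda ^+ 2 * C) * T ^+ 9.
  rewrite /risk_crude /bias_bound -/s -/Q -[leRHS]mulrA ler_wpM2l ?invr_ge0 ?pi_ge0//.
  rewrite [leRHS]mulrDl; apply: lerD.
    rewrite exprMn.
    have -> : 4 * Q ^+ 2 / eta ^+ 2 * T ^+ 9 = 4 * T * (Q ^+ 2 * (T ^+ 4 / eta) ^+ 2).
      by field; rewrite gt_eqF.
    rewrite ler_wpM2l ?mulr_ge0 ?(ltW T0)// ler_wpM2l ?sqr_ge0//.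
    by apply: lerXn2r; rewrite ?nnegrE// (le_trans M0).
  rewrite [s * C]mulrC mulrA ler_wpM2l//; exact: le_trans s1 T9.
have ratio : 2 * m2 / (n%:R * tolerance beta Lambda Sigma T ^+ 2) =
    72 * m2 * expR (4 * Lambda) * (T ^+ 4 / s * expR (- (kappa * T ^+ 2))).
  have tol2 : n%:R * tolerance beta Lambda Sigma T ^+ 2 =
      s / (36 * T ^+ 4) * (expR (kappa * T ^+ 2) / expR (4 * Lambda)).
    rewrite /tolerance exprMn -expRM_natl nE.
    have -> : expR (kappa * T ^+ 2) / expR (4 * Lambda) = expR (T ^+ 2 / eta) *
        expR (2%:R * - (2^-1 * Sigma ^+ 2 * T ^+ 2 + 2 * Lambda)).
      rewrite -expRN -!expRD; congr expR; rewrite /kappa; field.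
      by rewrite gt_eqF.
    rewrite -ihs; field; by rewrite gt_eqF.
  rewrite tol2 expRN; field; by rewrite !gt_eqF ?expR_gt0.
have s2 : T ^+ 13 * s^-1 <= s * T ^+ j.+1.
  rewrite -ler_pdivrMl// mulrCA -expr2.
  have -> : s^-1 ^+ 2 = T `^ (4 * beta).
    rewrite /s -powRN opprK -powR_mulrn ?powR_ge0// -powRrM; congr (_ `^ _); ring.
  by rewrite -!powR_mulrn ?(ltW T0)// -powRD ?(gt_eqF T0) ?implybT// ler_powR.
rewrite /rate_constant [leRHS]mulrDl; apply: lerD => //.
rewrite ratio; apply: le_trans (ler_wpM2r _ crude) _.
  by rewrite mulr_ge0// mulr_ge0 ?expR_ge0// divr_ge0 ?exprn_ge0 ?(ltW s0) ?(ltW T0).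
have -> : pi^-1 * (4 * Q ^+ 2 / eta ^+ 2 + Lambda ^+ 2 * C) * T ^+ 9 *
    (72 * m2 * expR (4 * Lambda) * (T ^+ 4 / s * expR (- (kappa * T ^+ 2)))) =
  pi^-1 * (4 * Q ^+ 2 / eta ^+ 2 + Lambda ^+ 2 * C) * (72 * m2 * expR (4 * Lambda)) *
    (T ^+ 13 * expR (- (kappa * T ^+ 2)) * s^-1).
  by ring.
rewrite -!(mulrA (pi^-1 * _ * _)) ler_wpM2l//; first exact: mulr_ge0.
have -> : T ^+ 13 * expR (- (kappa * T ^+ 2)) * s^-1 =
    T ^+ 13 * s^-1 * expR (- (kappa * T ^+ 2)) by ring.
apply: le_trans (ler_wpM2r (expR_ge0 _) s2) _.
rewrite -[leLHS]mulrA [leRHS]mulrC ler_wpM2l ?(ltW s0)//.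
by apply: expr_mul_expRN_le => //; rewrite subr_gt0.
Qed.

End rate.

Section scaled_density.
Context {R : realType}.
Local Notation mu := (@lebesgue_measure R).
Variables (lambda : R) (f : R -> R).
Hypotheses (lambda0 : 0 < lambda) (densf : is_probability_density f).

Let integral_scaled : (\int[mu]_x (lambda * f x)%:E = lambda%:E)%E.
Proof.
case: densf => mf f0 f1; under eq_integral do rewrite EFinM.
rewrite ge0_integralZl_EFin ?f1 ?mule1 ?(ltW lambda0)//; first by move=> x _; rewrite lee_fin.
exact/measurable_EFinP.
Qed.

Lemma is_levy_density_scaled : is_levy_density (fun x => lambda * f x).
Proof.
case: densf => mf f0 _; split; first exact: measurable_funM.
  by move=> x; rewrite mulr_ge0// ltW.
by rewrite integral_scaled lte_fin lambda0 ltry.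
Qed.

Lemma jump_density_scaled : jump_density (fun x => lambda * f x) = f.
Proof.
apply/funext => x; rewrite /jump_density /intensity /Rintegral integral_scaled/=.
by rewrite mulrC mulKf// gt_eqF.
Qed.

End scaled_density.

Section bandwidth.
Context {R : realType}.
Variables (eta : R) (n : nat).
Hypotheses (eta0 : 0 < eta) (n2 : (2 <= n)%N).
Local Notation T := (bandwidth eta n)^-1.

Let ln_n0 : 0 < ln (n%:R : R). Proof. by rewrite ln_gt0// ltr1n. Qed.

Let invT : T = (eta * ln n%:R) `^ 2^-1.
Proof. by rewrite /bandwidth powRN invrK. Qed.

Lemma bandwidth_sqr : T ^+ 2 = eta * ln n%:R.
Proof.
have en0 : 0 <= eta * ln n%:R by rewrite mulr_ge0// ltW.
by rewrite invT -powR_mulrn ?powR_ge0// -powRrM mulVf// powRr1.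
Qed.

Lemma bandwidth_inv_gt0 : 0 < T.
Proof. by rewrite invT powR_gt0// mulr_gt0. Qed.

Lemma natr_bandwidth : n%:R = expR (T ^+ 2 / eta).
Proof.
rewrite bandwidth_sqr mulrAC mulfV ?mul1r ?gt_eqF// lnK// posrE ltr0n.
exact: leq_trans n2.
Qed.

Lemma bandwidth_powR (beta : R) :
  T `^ (- (2 * beta)) = eta `^ (- beta) * ln n%:R `^ (- beta).
Proof.
rewrite -powRM ?(ltW eta0) ?(ltW ln_n0)// -bandwidth_sqr.
rewrite -powR_mulrn ?(ltW bandwidth_inv_gt0)// -powRrM.
by rewrite mulrN.
Qed.

Lemma truncationE (m : nat -> R) : truncation eta m n = m n * T ^+ 2.
Proof. by rewrite /truncation exprVn. Qed.

End bandwidth.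

Theorem theorem3p1 (R : realType)
    (beta L C Lambda K Sigma Gamma eta : R) (m : nat -> R) (v u w : R -> R) :
  0 < beta -> 0 < L -> 0 < C -> 0 < Lambda -> 0 < K -> 0 < Sigma ->
  0 < Gamma ->
  0 < eta < Sigma ^- 2 ->
  m @ \oo --> +oo ->
  m =o_\oo (fun n : nat => ln n%:R : R) ->
  (forall n : nat, (2 <= n)%N -> 0 < truncation eta m n) ->
  is_kernel_v beta v -> is_kernel_u beta u -> is_kernel_w beta w ->
  exists (A : R) (n0 : nat), 0 < A /\
    forall n : nat, (n0 <= n)%N ->
    forall (d : measure_display) (T : measurableType d)
      (P : R -> R -> (R -> R) -> probability T R)
      (X : 'I_n -> {mfun T >-> R}),
    levy_sample P X ->
    (ereal_sup [set
       ereal_sup [set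
         ereal_sup [set
           MISE v u w (bandwidth eta n) (truncation eta m n)
             (P gamma sigma rho) X rho
         | rho in Wsym_star beta L C Lambda K]
       | sigma in [set s | (0 < s <= Sigma)%R]]
     | gamma in [set g | (`|g| <= Gamma)%R]]
     <= (A * (ln n%:R) `^ (- beta))%:E)%E.
Proof.
move=> beta0 L0 C0 Lambda0 K0 Sigma0 Gamma0 /andP[eta0 eta_lt] m_infty m_o _ kv ku kw.
have eta_small : Sigma ^+ 2 < eta^-1.
  by rewrite -[ltLHS]invrK ltf_pV2// posrE invr_gt0 exprn_gt0.
have [kerv _ _] := kv; have [keru _ _] := ku; have [kerw _] := kw.
have [[Bv Bv0 vB] [cv cv0 vk]] := kernel_bounds beta0 kerv.
have [[Bu Bu0 uB] [cu cu0 uk]] := kernel_bounds beta0 keru.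
have [[Bw Bw0 wB] [cw cw0 wk]] := kernel_bounds beta0 kerw.
pose B := Bv + Bu + Bw; pose k := cv + cu + cw.
have vB' s : `|v s| <= B by apply: le_trans (vB s) _; rewrite /B; move: Bv0 Bu0 Bw0; lra.
have uB' s : `|u s| <= B by apply: le_trans (uB s) _; rewrite /B; move: Bv0 Bu0 Bw0; lra.
have wB' s : `|w s| <= B by apply: le_trans (wB s) _; rewrite /B; move: Bv0 Bu0 Bw0; lra.
have vk' s : `|v s| <= k * `|s| `^ beta.
  by apply: le_trans (vk s) _; rewrite ler_wpM2r ?powR_ge0// /k; move: cv0 cu0 cw0; lra.
have uk' s : `|u s| <= k * `|s| `^ beta.
  by apply: le_trans (uk s) _; rewrite ler_wpM2r ?powR_ge0// /k; move: cv0 cu0 cw0; lra.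
have wk' s : `|w s| <= k * `|s| `^ beta.
  by apply: le_trans (wk s) _; rewrite ler_wpM2r ?powR_ge0// /k; move: cv0 cu0 cw0; lra.
have B0 : 0 <= B by rewrite /B !addr_ge0// ltW.
have k0 : 0 <= k by rewrite /k !addr_ge0// ltW.
have [j jb] : exists j : nat, 13 + 4 * beta <= j.+1%:R.
  exists (Num.bound (13 + 4 * beta)); apply: ltW.
  apply: lt_le_trans (archi_boundP _) _; last by rewrite ler_nat.
  by rewrite addr_ge0// mulr_ge0// ltW.
pose A0 := rate_constant L C Lambda K Sigma Gamma B k eta j.
have A00 : 0 <= A0 by exact: rate_constant_ge0 (ltW C0) (ltW K0) (ltW Lambda0) eta_small _.
(* Multiplied by [H ^ 2], which dominates both [H] and 1, this becomes the lower bound on the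
   truncation level that [MISE_le_dens] requires. *)
have m_ge : \forall n \near \oo,
    2^-1 * Sigma ^+ 2 + 2 * Lambda + Gamma + 1 <= m n.
  by move/cvgryPge : m_infty; apply.
(* With [H ^ 2 = eta * ln n] this gives the polynomial bound [H ^ 4 / eta] on the truncation
   level. *)
have m_le : \forall n \near \oo, `|m n| <= `|ln n%:R|.
  move/eqoP: m_o => /(_ 1 ltr01).
  by apply: filterS => n; rewrite mul1r.
(* Makes [H ^ 2 = eta * ln n] at least 4, hence [H >= 2]. *)
have n_ge : \forall n \near \oo, expR (4 / eta) <= n%:R by exact: nbhs_infty_ger.
have [N _ hN] : \forall n \near \oo, [/\ (2 <= n)%N,
    2^-1 * Sigma ^+ 2 + 2 * Lambda + Gamma + 1 <= m n, `|m n| <= `|ln n%:R|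
    & expR (4 / eta) <= n%:R].
  by near=> n; split; near: n => //; exact: nbhs_infty_ge.
(* The power of [eta] comes from writing [H^(-2 beta)] in terms of [ln n]; the added 1 makes the
   constant positive. *)
exists (A0 * eta `^ (- beta) + 1), N; split.
  by rewrite ltr_wpDl// mulr_ge0// powR_ge0.
move=> n Nn d T P X sampleX.
have [n2 mM mln nexp] := hN n Nn.
have n0 : (0 < n)%N by exact: leq_trans n2.
set H := (bandwidth eta n)^-1.
have H0 : 0 < H by exact: bandwidth_inv_gt0.
have lnn : 4 / eta <= ln n%:R by rewrite -[leLHS]expRK ler_ln ?posrE ?expR_gt0 ?ltr0n.
have H2 : 2 <= H.
  rewrite -(@ler_pXn2r _ 2) ?nnegrE ?(ltW H0)//.
  by rewrite bandwidth_sqr// mulrC -ler_pdivrMr//; apply: le_trans lnn; rewrite ler_wpM2r ?invr_ge0 ?(ltW eta0)//; lra.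
have H1 : 1 <= H by apply: le_trans H2; rewrite ler1n.
have mn0 : 0 <= m n by apply: le_trans mM; rewrite !addr_ge0 ?mulr_ge0 ?sqr_ge0 ?ltW.
have lnn0 : 0 <= ln n%:R :> R by apply: le_trans lnn; rewrite divr_ge0 ?(ltW eta0).
have HH : H <= H ^+ 2 by rewrite expr2 ler_peMr ?(ltW H0).
have HH1 : 1 <= H ^+ 2 by exact: le_trans H1 HH.
have ML : 2^-1 * Sigma ^+ 2 * H ^+ 2 + 2 * Lambda + Gamma * H + 1 <= truncation eta m n.
  rewrite truncationE -/H; apply: le_trans (ler_wpM2r (sqr_ge0 _) mM).
  have := ler_wpM2l (ltW Lambda0) HH1; have := ler_wpM2l (ltW Gamma0) HH; move: HH1.
  by move: (H ^+ 2) => H'; lra.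
have MT : truncation eta m n <= H ^+ 4 / eta.
  rewrite truncationE -/H (_ : H ^+ 4 / eta = ln n%:R * H ^+ 2).
    rewrite ler_wpM2r ?sqr_ge0//; apply: le_trans (ler_norm _) _.
    by rewrite (le_trans mln)// ger0_norm.
  by rewrite (exprM H 2 2) bandwidth_sqr//; field; rewrite gt_eqF.
have M0 : 0 <= truncation eta m n by rewrite truncationE mulr_ge0 ?sqr_ge0.
apply: ge_ereal_sup => _ [gamma /= gG <-].
apply: ge_ereal_sup => _ [sigma /= sS <-].
apply: ge_ereal_sup => _ [rho /= [[[lambda [f [[-> densf] fK fL lL]]] evenrho] fC] <-].
have /andP[l0 lLam] := lL.
rewrite /= jump_density_scaled// in fC.
have evenf y : f (- y) = f y by have /(mulfI (lt0r_neq0 l0)) := evenrho y.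
have lI : 0 <= lambda <= Lambda by rewrite ltW.
have s0 : 0 <= sigma by case/andP: sS => /ltW.
have iidX := sampleX gamma sigma _ s0 (is_levy_density_scaled l0 densf).
have := MISE_le_dens beta0 (ltW C0) (ltW K0) (ltW Lambda0) B0 k0 kv ku kw vB' uB' wB' vk' uk' wk'
  n0 H2 ML gG sS lI densf evenf fK fL fC iidX.
rewrite invrK => MISE_le; apply: le_trans MISE_le _; rewrite lee_fin.
have rate := risk_rate_le L Gamma B k beta0 (ltW C0) (ltW K0) (ltW Lambda0) eta0 eta_small
  jb H1 M0 MT (natr_bandwidth eta0 n2).
apply: le_trans rate _.
rewrite bandwidth_powR// mulrA ler_wpM2r ?powR_ge0//.
by rewrite -/A0 lerDl.
Unshelve. all: by end_near.
Qed.
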